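(* Let $n>2$ and let $m_1,\dots,m_n>0$. Let $h,c\in\mathbb{C}$ with $(h,c)\neq(0,0)$. Then the complexified planar $n$-body problem with masses $m_1,\dots,m_n$, restricted to the level $\mathcal{M}_{h,c}$, is not integrable in the restricted sense, i.e. there do not exist $2(n-1)-2$ rational functions $I_3,\dots,I_{2(n-1)}$ on $\mathcal{M}$ such that, with $I_1=H-h$ and $I_2=C-c$, all Poisson brackets $\{I_i,I_j\}$ vanish on $\mathcal{M}_{h,c}$ and the Jacobian matrix of $(I_1,\dots,I_{2(n-1)})$ has maximal rank $2(n-1)$ on an open dense subset of $\mathcal{M}_{h,c}$.
   Context: For $\mathbf{a},\mathbf{b}\in\mathbb{C}^k$ write $\mathbf{a}\cdot\mathbf{b}=\sum a_ib_i$ (complex bilinear, not Hermitian) and $|\mathbf{x}|^2=\mathbf{x}\cdot\mathbf{x}$. Let $J_2=\begin{bmatrix}0&-1\\1&0\end{bmatrix}$. Let $\mathcal{N}=(\mathbb{C}^2)^n\times(\mathbb{C}^2)^n\times(\mathbb{C}^* )^{n(n-1)/2}$ with coordinates $(\mathbf{r},\mathbf{p},\mathbf{d})$, $\mathbf{r}=(\mathbf{r}_1,\dots,\mathbf{r}_n)$, $\mathbf{p}=(\mathbf{p}_1,\dots,\mathbf{p}_n)$, $\mathbf{r}_i,\mathbf{p}_i\in\mathbb{C}^2$, $\mathbf{d}=(d_{i,j})_{1\le i<j\le n}$. Let $\widetilde{\mathcal{M}}=\{(\mathbf{r},\mathbf{p},\mathbf{d})\in\mathcal{N}: d_{i,j}^2=|\mathbf{r}_i-\mathbf{r}_j|^2,\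 1\le i<j\le n\}$, with symplectic structure induced by the canonical form $\sum_i d\mathbf{r}_i\wedge d\mathbf{p}_i$ (the $d_{i,j}$ are locally functions of $\mathbf{r}$). Let $m=\sum m_i$, $\mathbf{r}_s=\frac1m\sum m_i\mathbf{r}_i$, $\mathbf{p}_s=\sum\mathbf{p}_i$, and $\mathcal{M}=\widetilde{\mathcal{M}}\cap\{\mathbf{r}_s=0,\ \mathbf{p}_s=0\}$, a symplectic manifold of dimension $4(n-1)$. On it consider the rational Hamiltonian $H=\sum_{i}\frac{1}{2m_i}\mathbf{p}_i\cdot\mathbf{p}_i-\sum_{i<j}\frac{m_im_j}{d_{i,j}}$ and the angular momentum $C=\sum_i \mathbf{r}_i^TJ_2^T\mathbf{p}_i$, which are Poisson commuting first integrals. Set $\mathcal{M}_{h,c}=\{x\in\mathcal{M}: H(x)=h,\ C(x)=c\}$. Restricted integrability (general definition): for a rational Hamiltonian $H$ on a symplectic algebraic manifold $\mathcal{M}$ of dimension $2N$ with functionally independent, Poisson commuting rational first integrals $I_1=H,\dots,I_k$ whose common level $\mathcal{S}=\{I_1=\dots=I_k=0\}$ is an irreducible algebraic variety of dimension $2N-k$, $H$ is integrable restricted to $\mathcal{S}$ if there exist $N-k$ rational functions $I_{k+1},\dots,I_N$ on $\mathcal{M}$ such that $\{I_i,I_j\}=0$ on $\mathcal{S}$ for all $i,j$, and the Jacobian matrix of $(I_1,\dots,I_N)$ has maximal rank $N$ on an open dense subset of $\mathcal{S}$. Other levels are handled by subtracting constants from the $I_i$. *)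

(* Defs.v *)
From HB Require Import structures.
From mathcomp Require Import all_boot all_order all_algebra.
From mathcomp Require Import reals.
From mathcomp Require Import complex.
From mathcomp Require Import mpoly.

Set Implicit Arguments.
Unset Strict Implicit.
Unset Printing Implicit Defensive.

Import Order.TTheory GRing.Theory Num.Theory.
Local Open Scope ring_scope.

(* Ambient space N = (C^2)^n x (C^2)^n x (C^* )^{n(n-1)/2}.            *)

Definition pairs (n : nat) := {e : 'I_n * 'I_n | (e.1 < e.2)%N}.

Definition var (n : nat) : finType :=
  (('I_n * 'I_2) + ('I_n * 'I_2) + pairs n)%type.

Definition nv (n : nat) : nat := #|var n|.

Definition vr {n} (i : 'I_n) (a : 'I_2) : 'I_(nv n) := enum_rank (inl (inl (i, a)) : var n).
Definition vp {n} (i : 'I_n) (a : 'I_2) : 'I_(nv n) := enum_rank (inl (inr (i, a)) : var n).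
Definition vd {n} (e : pairs n) : 'I_(nv n) := enum_rank (inr e : var n).

Section NBody.

Variable R : realType.
Local Notation C := R[i].
Variable n : nat.
Variable m : 'I_n -> R.

Definition cm (x : R) : C := Complex x 0.

Definition mtot : R := \sum_(i < n) m i.

Definition point := 'I_(nv n) -> C.

Definition poly := {mpoly C[nv n]}.

Definition ratfun := (poly * poly)%type.

Definition rdefined (F : ratfun) (x : point) : Prop := (F.2).@[x] != 0.
Definition reval (F : ratfun) (x : point) : C := (F.1).@[x] / (F.2).@[x].

Definition rpartial (F : ratfun) (k : 'I_(nv n)) (x : point) : C :=
  ((F.2).@[x] * (F.1^`M(k)).@[x] - (F.1).@[x] * (F.2^`M(k)).@[x])
    / ((F.2).@[x]) ^+ 2.

Definition rdiff (F : ratfun) (x : point) (w : point) : C :=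
  \sum_(k < nv n) rpartial F k x * w k.

Definition pdiff (g : poly) (x : point) (w : point) : C :=
  \sum_(k < nv n) (g^`M(k)).@[x] * w k.

Definition Xr (i : 'I_n) (a : 'I_2) : poly := 'X_(vr i a).
Definition Xp (i : 'I_n) (a : 'I_2) : poly := 'X_(vp i a).
Definition Xd (e : pairs n) : poly := 'X_(vd e).

Definition pi1 (e : pairs n) : 'I_n := (val e).1.
Definition pi2 (e : pairs n) : 'I_n := (val e).2.

Definition eq_dist (e : pairs n) : poly :=
  Xd e ^+ 2 - \sum_(a < 2) (Xr (pi1 e) a - Xr (pi2 e) a) ^+ 2.
Definition eq_rs (a : 'I_2) : poly :=
  (cm mtot)^-1 *: \sum_(i < n) (cm (m i) *: Xr i a).
Definition eq_ps (a : 'I_2) : poly := \sum_(i < n) Xp i a.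

Definition inN (x : point) : Prop := forall e : pairs n, x (vd e) != 0.

Definition inM (x : point) : Prop :=
  [/\ inN x,
      (forall e : pairs n, (eq_dist e).@[x] = 0),
      (forall a : 'I_2, (eq_rs a).@[x] = 0) &
      (forall a : 'I_2, (eq_ps a).@[x] = 0)].

Definition tangent (x : point) (w : point) : Prop :=
  [/\ (forall e : pairs n, pdiff (eq_dist e) x w = 0),
      (forall a : 'I_2, pdiff (eq_rs a) x w = 0) &
      (forall a : 'I_2, pdiff (eq_ps a) x w = 0)].

(* restriction to M of the canonical form  sum_i dr_i /\ dp_i *)
Definition omega (v w : point) : C :=
  \sum_(i < n) \sum_(a < 2) (v (vr i a) * w (vp i a) - v (vp i a) * w (vr i a)).

Definition ham_vec (F : ratfun) (x : point) (X : point) : Prop :=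
  tangent x X /\ (forall w, tangent x w -> omega X w = rdiff F x w).

(* the Poisson bracket {F,G} (for the symplectic structure of M)
   vanishes at x:  {F,G}(x) = dG_x(X_F) = 0 *)
Definition poisson_zero (F G : ratfun) (x : point) : Prop :=
  forall X, ham_vec F x X -> rdiff G x X = 0.

Definition ratfun_on_M (F : ratfun) : Prop :=
  exists x, inM x /\ rdefined F x.

(* H = sum_i p_i.p_i/(2 m_i) - sum_{i<j} m_i m_j / d_{ij},
   written over the common denominator prod_{i<j} d_{ij} *)
Definition Hden : poly := \prod_(e : pairs n) Xd e.
Definition Hkin : poly :=
  \sum_(i < n) ((cm (2 * m i))^-1 *: \sum_(a < 2) Xp i a ^+ 2).
Definition Hnum : poly :=
  Hkin * Hden
  - \sum_(e : pairs n)
      (cm (m (pi1 e) * m (pi2 e)) *: \prod_(e' : pairs n | e' != e) Xd e').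
Definition Hrat : ratfun := (Hnum, Hden).

Definition J2 : 'M[C]_2 := \matrix_(a < 2, b < 2)
  (if (a == 0) && (b == 1) then -1 else if (a == 1) && (b == 0) then 1 else 0).
Definition Cpoly : poly :=
  \sum_(i < n) \sum_(a < 2) \sum_(b < 2) (J2^T a b *: (Xr i a * Xp i b)).
Definition Crat : ratfun := (Cpoly, 1).

Definition rsubc (F : ratfun) (c : C) : ratfun := (F.1 - c *: F.2, F.2).

Definition inMhc (h c : C) (x : point) : Prop :=
  [/\ inM x, rdefined Hrat x, reval Hrat x = h & reval Crat x = c].

Definition zopen_in (S U : point -> Prop) : Prop :=
  (forall x, U x -> S x) /\
  exists Z : poly -> Prop,
    forall x, S x -> (U x <-> exists g, Z g /\ g.@[x] != 0).

Definition zdense_in (S U : point -> Prop) : Prop :=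
  forall V, zopen_in S V -> (exists x, V x) -> exists x, V x /\ U x.

(* the differentials of Is restricted to T_xM are linearly independent,
   i.e. the Jacobian of (I_1,...,I_N) on M has rank N = size Is at x *)
Definition jac_full_rank (Is : seq ratfun) (x : point) : Prop :=
  forall lam : 'I_(size Is) -> C,
    (forall w, tangent x w ->
       \sum_(k < size Is) lam k * rdiff (nth (0, 1) Is k) x w = 0) ->
    forall k, lam k = 0.

Definition restricted_integrable (h c : C) : Prop :=
  exists J : seq ratfun,
    [/\ size J = (2 * (n - 1) - 2)%N,
        (forall F, F \in J -> ratfun_on_M F) &
        let Is := rsubc Hrat h :: rsubc Crat c :: J in
        (forall i j : 'I_(size Is), forall x, inMhc h c x ->
           rdefined (nth (0, 1) Is i) x -> rdefined (nth (0, 1) Is j) x ->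
           poisson_zero (nth (0, 1) Is i) (nth (0, 1) Is j) x) /\
        (exists U : point -> Prop,
           [/\ zopen_in (inMhc h c) U, zdense_in (inMhc h c) U &
               forall x, U x ->
                 (forall F, F \in Is -> rdefined F x) /\ jac_full_rank Is x])].

End NBody.

(* Main.v *)
(** Rescale r = rho/eps, p = pi/eps, d = delta/eps: Newton's equations become a
perturbation, of size eps^3 in the forces, of a free collinear motion
x_i = al_i + be_i t with sum m be = sum m be^2 = 0.  They have a solution that is a
power series in eps over a ring of hyperlogarithms with letters 1/(t - t_e), where
t_e is the time at which the pair e meets in the free motion.  A rational first
integral is constant along the solution, hence annihilated by the infinitesimal
monodromies N_b; so the differentials of all the I_k vanish on the tangent vectors
eta_b = N_b xi.  Where the I_k are independent and in involution, the common kernel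
of their differentials is isotropic, while omega(eta_a, eta_b) = eps^9 (Omega + O(eps)).
The coefficient Omega is dominated by the triangle of the bodies 0, 1, 2 when the
other pairs meet at far away times, and then does not vanish, whatever the signs of
the distances; these signs are used to reach the dense open set on which the I_k are
independent. *)

(* On the rescaled level the energy reads kinetic part - eps^3 potential = h eps^2 and the angular
   momentum is c eps^2, so both must vanish for the free motion at eps = 0: collinearity cancels the
   one, sum m be^2 = 0 the other, and as the masses are positive the velocities are complex.
   Monodromy is kept algebraic: it deletes the last letter of a word, commutes with d/dt, and
   expansion at t = 0 is injective, so no path is ever continued. The hypotheses on the I_k,
   however, concern complex points, and formal series are not points. The bridge is a
   Nullstellensatz: a finitely generated subalgebra of a domain over C has, for each nonzero
   element, a C-valued character that does not kill it; images divided by that of eps form a genuine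
   point of the level. Positions acquire monodromy at order eps^3, momenta only at order eps^6,
   hence the exponent 9. The signs enter because a square root of a polynomial in eps has no
   preferred value at eps = 1: a polynomial that vanishes along the families of all sign choices
   vanishes at the point aimed at. *)
Require Import Defs.
From HB Require Import structures.
From mathcomp Require Import all_boot all_order all_algebra.
From mathcomp Require Import reals.
From mathcomp Require Import complex.
From mathcomp Require Import mpoly.
From mathcomp Require Import boolp.
From mathcomp Require Import ring lra zify.

Set Implicit Arguments.
Unset Strict Implicit.
Unset Printing Implicit Defensive.

Import Order.TTheory GRing.Theory Num.Theory.
Local Open Scope ring_scope.

(** * Shuffle algebras *)

(* Formal series on words under the shuffle product.  For one letter, the coefficient
   of the word of length k is the k-th derivative at 0. *)
Record sh (Q : Type) (R : Type) := Sh {cf : seq Q -> R}.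

Section ShRing.
Variables (Q : Type) (R : comNzRingType).
Implicit Types f g : sh Q R.

HB.instance Definition _ := gen_eqMixin (sh Q R).
HB.instance Definition _ := gen_choiceMixin (sh Q R).

Lemma shP f g : (forall w, cf f w = cf g w) -> f = g.
Proof. by case: f g => [f] [g] /= fg; congr Sh; apply/funext. Qed.

(** The rule for a first letter is the Leibniz rule, so that [strip] is a derivation by
    definition. *)
Fixpoint shmulw (f g : seq Q -> R) (w : seq Q) : R :=
  if w is q :: w' then
    shmulw (fun u => f (q :: u)) g w' + shmulw f (fun u => g (q :: u)) w'
  else f [::] * g [::].

Lemma shmulwC f g w : shmulw (cf f) (cf g) w = shmulw (cf g) (cf f) w.
Proof.
move: {f g}(cf f) (cf g) => f g; elim: w f g => [|q w IH] f g /=; first by rewrite mulrC.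
by rewrite addrC (IH f) (IH _ g).
Qed.

Lemma shmulwDl (f g h : seq Q -> R) w :
  shmulw (fun u => f u + g u) h w = shmulw f h w + shmulw g h w.
Proof.
elim: w f g h => [|q w IH] f g h /=; first by rewrite mulrDl.
by rewrite !IH addrACA.
Qed.

Lemma shmulwDr (f g h : seq Q -> R) w :
  shmulw h (fun u => f u + g u) w = shmulw h f w + shmulw h g w.
Proof.
elim: w f g h => [|q w IH] f g h /=; first by rewrite mulrDr.
by rewrite !IH addrACA.
Qed.

Lemma shmulwA (f g h : seq Q -> R) w :
  shmulw f (shmulw g h) w = shmulw (shmulw f g) h w.
Proof.
elim: w f g h => [|q w IH] f g h /=; first by rewrite mulrA.
by rewrite shmulwDl shmulwDr !IH addrA.
Qed.

Definition sh_mul f g := Sh (shmulw (cf f) (cf g)).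
Definition shC (c : R) : sh Q R := Sh (fun w => if w is [::] then c else 0).

Let shmulw0 (f : seq Q -> R) w : shmulw (fun=> 0) f w = 0.
Proof. by elim: w f => [|q w IH] f /=; rewrite ?mul0r // !IH addr0. Qed.

Lemma shmulwC1 c f w :
  shmulw (fun w => if w is [::] then c else 0) (cf f) w = c * cf f w.
Proof.
move: {f}(cf f) => f; elim: w f => [|q w IH] f //=.
by rewrite shmulw0 add0r IH.
Qed.

Fact shaddA : associative (fun f g => Sh (fun w => cf f w + cf g w)).
Proof. by move=> f g h; apply: shP => w /=; rewrite addrA. Qed.
Fact shaddC : commutative (fun f g => Sh (fun w => cf f w + cf g w)).
Proof. by move=> f g; apply: shP => w /=; rewrite addrC. Qed.
Fact shadd0 : left_id (Sh (fun=> 0)) (fun f g => Sh (fun w => cf f w + cf g w)).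
Proof. by move=> f; apply: shP => w /=; rewrite add0r. Qed.
Fact shaddN : left_inverse (Sh (fun=> 0)) (fun f => Sh (fun w => - cf f w))
  (fun f g => Sh (fun w => cf f w + cf g w)).
Proof. by move=> f; apply: shP => w /=; rewrite addNr. Qed.

HB.instance Definition _ := GRing.isZmodule.Build (sh Q R) shaddA shaddC shadd0 shaddN.

Fact sh_mulA : associative sh_mul.
Proof. by move=> f g h; apply: shP => w /=; rewrite shmulwA. Qed.
Fact sh_mulC : commutative sh_mul.
Proof. by move=> f g; apply: shP => w /=; rewrite shmulwC. Qed.
Fact sh_mul1 : left_id (shC 1) sh_mul.
Proof. by move=> f; apply: shP => w /=; rewrite shmulwC1 mul1r. Qed.
Fact sh_mulD : left_distributive sh_mul +%R.
Proof. by move=> f g h; apply: shP => w /=; rewrite shmulwDl. Qed.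
Fact sh_1neq0 : shC 1 != 0.
Proof.
apply/eqP => /(congr1 (fun f => cf f [::])) /= /eqP; apply/negP; exact: oner_neq0.
Qed.

HB.instance Definition _ := GRing.Zmodule_isComNzRing.Build (sh Q R)
  sh_mulA sh_mulC sh_mul1 sh_mulD sh_1neq0.

Lemma cfD f g w : cf (f + g) w = cf f w + cf g w. Proof. by []. Qed.
Lemma cfN f w : cf (- f) w = - cf f w. Proof. by []. Qed.
Lemma cfB f g w : cf (f - g) w = cf f w - cf g w. Proof. by []. Qed.
Lemma cf0 w : cf (0 : sh Q R) w = 0. Proof. by []. Qed.
Lemma cfM0 f g : cf (f * g) [::] = cf f [::] * cf g [::]. Proof. by []. Qed.
Lemma cf_sum I (r : seq I) (P : pred I) (F : I -> sh Q R) w :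
  cf (\sum_(i <- r | P i) F i) w = \sum_(i <- r | P i) cf (F i) w.
Proof. by apply: (big_morph (fun f => cf f w)). Qed.

Definition strip (q : Q) f : sh Q R := Sh (fun w => cf f (q :: w)).
Lemma cfMS f g q w :
  cf (f * g) (q :: w) = cf (strip q f * g) w + cf (f * strip q g) w.
Proof. by []. Qed.

Lemma shCM c f w : cf (shC c * f) w = c * cf f w.
Proof. exact: shmulwC1. Qed.

Fact shC_additive : zmod_morphism shC.
Proof. by move=> a b; apply: shP => -[|q w] //=; rewrite subr0. Qed.
HB.instance Definition _ := GRing.isZmodMorphism.Build R (sh Q R) shC shC_additive.
Fact shC_monoid : monoid_morphism shC.
Proof. by split => // a b; apply: shP => -[|q w]; rewrite shCM //= mulr0. Qed.
HB.instance Definition _ := GRing.isMonoidMorphism.Build R (sh Q R) shC shC_monoid.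

Definition cst f : R := cf f [::].
Fact cst_additive : zmod_morphism cst. Proof. by []. Qed.
HB.instance Definition _ := GRing.isZmodMorphism.Build (sh Q R) R cst cst_additive.
Fact cst_monoid : monoid_morphism cst. Proof. by []. Qed.
HB.instance Definition _ := GRing.isMonoidMorphism.Build (sh Q R) R cst cst_monoid.

End ShRing.
Arguments shC {Q R}.
Arguments cst {Q R} f : simpl never.

Definition derivation (A : nzRingType) (D : A -> A) :=
  {morph D : x y / x + y} /\ forall x y, D (x * y) = D x * y + x * D y.

Section Derivation.
Variables (A : comNzRingType) (D : A -> A).
Hypothesis derD : derivation D.

Lemma der0 : D 0 = 0.
Proof. by apply: (addrI (D 0)); rewrite -derD.1 !addr0. Qed.
Lemma derN x : D (- x) = - D x.
Proof. by apply/eqP; rewrite -addr_eq0 -derD.1 addNr der0. Qed.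
Lemma derB x y : D (x - y) = D x - D y.
Proof. by rewrite derD.1 derN. Qed.
Lemma derM x y : D (x * y) = D x * y + x * D y. Proof. exact: derD.2. Qed.
Lemma der_sum I (r : seq I) (P : pred I) (F : I -> A) :
  D (\sum_(i <- r | P i) F i) = \sum_(i <- r | P i) D (F i).
Proof. exact: (big_morph D derD.1 der0). Qed.
Lemma der1 : D 1 = 0.
Proof. by have := derM 1 1; rewrite !mulr1 mul1r => h; apply: (addrI (D 1)); rewrite addr0 -h. Qed.
Lemma derX x k : D (x ^+ k.+1) = k.+1%:R * x ^+ k * D x.
Proof.
elim: k => [|k IH]; first by rewrite !expr1 expr0 !mul1r.
rewrite exprS derM IH (exprS x k) -[k.+2%:R]natr1; ring.
Qed.
End Derivation.

Section ShMaps.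
Variable Q : Type.

Definition shmap (R R' : Type) (h : R -> R') (f : sh Q R) : sh Q R' := Sh (fun w => h (cf f w)).

Section Morph.
Variables (R R' : comNzRingType) (h : {rmorphism R -> R'}).
Fact shmap_additive : zmod_morphism (shmap h).
Proof. by move=> f g; apply: shP => w /=; rewrite rmorphB. Qed.
Fact shmap_monoid : monoid_morphism (shmap h).
Proof.
split; first by apply: shP => -[|q w] /=; rewrite ?rmorph1 ?rmorph0.
move=> [f] [g]; apply: shP => w /=.
elim: w f g => [|q w IH] f g /=; first by rewrite rmorphM.
by rewrite rmorphD !IH.
Qed.
HB.instance Definition _ := GRing.isZmodMorphism.Build (sh Q R) (sh Q R') (shmap h) shmap_additive.
HB.instance Definition _ := GRing.isMonoidMorphism.Build (sh Q R) (sh Q R') (shmap h) shmap_monoid.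
Lemma shmapC c : shmap h (shC c) = shC (h c).
Proof. by apply: shP => -[|q w] //=; rewrite rmorph0. Qed.
End Morph.

Variable R : comNzRingType.

Lemma shmap_der (D : R -> R) : derivation D -> derivation (shmap D).
Proof.
move=> derD; split=> [f g|[f] [g]]; first by apply: shP => w /=; rewrite derD.1.
apply: shP => w; rewrite cfD /=.
elim: w f g => [|q w IH] f g /=; first by rewrite derM.
by rewrite derD.1 !IH addrACA.
Qed.

Lemma shmap_derC (D : R -> R) c : derivation D -> shmap D (shC c : sh Q R) = shC (D c).
Proof. by move=> derD; apply: shP => -[|q w] //=; rewrite der0. Qed.

Lemma strip_der (q : Q) : derivation (@strip Q R q).
Proof. by split=> [f g|f g]; apply: shP => w //=. Qed.

(** When the first letter of a word is the outermost form of an iterated integral, the last one is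
    the innermost. Deleting it commutes with [strip], hence with d/dt, and is the infinitesimal
    monodromy. *)
Definition rstrip (q : Q) (f : sh Q R) : sh Q R := Sh (fun w => cf f (rcons w q)).

Lemma rstrip_der q : derivation (rstrip q).
Proof.
split=> [f g|[f] [g]]; apply: shP => w //=.
elim: w f g => [|p w IH] f g //=; last by rewrite !IH addrACA.
Qed.
End ShMaps.

Lemma rstripC (Q : Type) (R : comNzRingType) (q : Q) (c : R) : rstrip q (shC c) = 0.
Proof. by apply: shP => -[|p w]. Qed.
Lemma stripC (Q : Type) (R : comNzRingType) (q : Q) (c : R) : strip q (shC c) = 0.
Proof. by apply: shP => w. Qed.

(** * Power series in one variable, with derivatives as coefficients *)

Section OneLetter.
Variable R : comNzRingType.
Implicit Types f g : sh unit R.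

Definition gen : sh unit R := Sh (fun w => if w is [:: tt] then 1 else 0).

Lemma strip_gen q : strip q gen = 1.
Proof. by case: q; apply: shP => -[|[] []]. Qed.

Lemma cst_gen : cst gen = 0. Proof. by []. Qed.

Lemma shunitP f g : cst f = cst g -> strip tt f = strip tt g -> f = g.
Proof.
move=> h0 h1; apply: shP => -[|[] w]; first exact: h0.
by have := congr1 (fun f => cf f w) h1.
Qed.

Definition co f k := cf f (nseq k tt).
Lemma coE f k : co f k = cst (iter k (strip tt) f).
Proof. by elim: k f => // k IH f; rewrite iterSr -IH. Qed.
Lemma coS f k : co (strip tt f) k = co f k.+1. Proof. by []. Qed.
Lemma coMS f g k : co (f * g) k.+1 = co (strip tt f * g) k + co (f * strip tt g) k.
Proof. by []. Qed.
Lemma nseq_unit (w : seq unit) : w = nseq (size w) tt.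
Proof. by elim: w => //= -[] w {1}->. Qed.
Lemma coP f g : co f =1 co g -> f = g.
Proof. by move=> fg; apply: shP => w; rewrite (nseq_unit w); apply: fg. Qed.

(** The binomial factor appears because coefficients are derivatives; it is the reason why
    [sh_unit_nzd] asks for characteristic 0. *)
Lemma coM_low i j f g :
  (forall a, (a < i)%N -> co f a = 0) -> (forall b, (b < j)%N -> co g b = 0) ->
  co (f * g) (i + j) = 'C(i + j, i)%:R * (co f i * co g j).
Proof.
have nolow (f' : sh unit R) b : (b < 0)%N -> co f' b = 0 by [].
move nE: (i + j)%N => n; elim: n i j nE f g => [|n IH] i j nE f g hf hg.
  by move/eqP: nE; rewrite addn_eq0 => /andP[/eqP-> /eqP->]; rewrite mul1r.
case: i nE hf => [|i] nE hf.
  rewrite add0n in nE; subst j; rewrite coMS.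
  have hg' b : (b < n)%N -> co g b = 0 by move=> ?; apply/hg/ltnW.
  have -> := IH 0%N n erefl (strip tt f) g (nolow _) hg'.
  have -> := IH 0%N n erefl f (strip tt g) hf (fun b => hg b.+1).
  by rewrite !bin0 !mul1r (hg n) // mulr0 add0r.
case: j nE hg => [|j] nE hg.
  rewrite addn0 in nE; case: nE => nE; subst i; rewrite coMS.
  have hf' b : (b < n)%N -> co f b = 0 by move=> ?; apply/hf/ltnW.
  have -> := IH n 0%N (addn0 n) (strip tt f) g (fun a => hf a.+1) hg.
  have -> := IH n 0%N (addn0 n) f (strip tt g) hf' (nolow _).
  by rewrite !binn !mul1r (hf n) // mul0r addr0.
rewrite coMS.
have n1 : (i + j.+1)%N = n by move: nE; rewrite addSn => -[].
have n2 : (i.+1 + j)%N = n by move: nE; rewrite addnS => -[].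
have -> := IH i j.+1 n1 (strip tt f) g (fun a => hf a.+1) hg.
have -> := IH i.+1 j n2 f (strip tt g) hf (fun a => hg a.+1).
by rewrite !coS -mulrDl -natrD binS addnC.
Qed.

Lemma co_order f : f != 0 -> exists2 i, co f i != 0 & forall a, (a < i)%N -> co f a = 0.
Proof.
move=> f0; have ex : exists i, co f i != 0.
  apply: contrapT => nex; move/eqP: f0; apply; apply: coP => k; apply: contrapT => /eqP nz.
  by apply: nex; exists k.
exists (ex_minn ex); first by case: ex_minnP.
case: ex_minnP => i _ imin a ai; apply/eqP; apply: contraTT ai => fa.
by rewrite -leqNgt imin.
Qed.

Lemma sh_unit_nzd (charR : forall k, (k.+1)%:R != 0 :> R)
  (nzd : forall x y : R, x * y = 0 -> x = 0 \/ y = 0) f g :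
  f * g = 0 -> f = 0 \/ g = 0.
Proof.
move=> fg; have [->|f0] := eqVneq f 0; first by left.
have [->|g0] := eqVneq g 0; first by right.
have [i fi hi] := co_order f0; have [j gj hj] := co_order g0.
have := coM_low hi hj; rewrite fg /co cf0 => /esym /nzd [].
  have: (0 < 'C(i + j, i))%N by rewrite bin_gt0 leq_addr.
  by case: 'C(_, _) => // k _ /eqP; rewrite (negPf (charR k)).
by move=> /nzd [] /eqP; rewrite ?(negPf fi) ?(negPf gj).
Qed.

Lemma cf_genM f (w : seq unit) : cf (gen * f) (tt :: w) = cf f w + cf (gen * strip tt f) w.
Proof. by rewrite cfMS strip_gen mul1r. Qed.

(* [agree k f g]: equality modulo the k-th power of the variable. *)
Definition agree k f g := forall w, (size w < k)%N -> cf f w = cf g w.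

Lemma agree_refl k f : agree k f f. Proof. by []. Qed.
Lemma agreeW k f g : agree k.+1 f g -> agree k f g.
Proof. by move=> h w hw; apply: h; apply: ltnW. Qed.
Lemma agreeD k f f' g g' : agree k f f' -> agree k g g' -> agree k (f + g) (f' + g').
Proof. by move=> hf hg w hw; rewrite !cfD hf ?hg. Qed.
Lemma agreeN k f f' : agree k f f' -> agree k (- f) (- f').
Proof. by move=> hf w hw; rewrite !cfN hf. Qed.
Lemma agreeB k f f' g g' : agree k f f' -> agree k g g' -> agree k (f - g) (f' - g').
Proof. by move=> hf hg; apply: agreeD => //; apply: agreeN. Qed.
Lemma agreeM k f f' g g' : agree k f f' -> agree k g g' -> agree k (f * g) (f' * g').
Proof.
move=> hf hg w; elim: w k f f' g g' hf hg => [|q w IH] k f f' g g' hf hg hw.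
  by rewrite !cfM0 hf ?hg.
case: k hf hg hw => // k hf hg hw; rewrite !cfMS.
congr (_ + _); apply: (IH k) => // u hu.
- exact: hf.
- exact: hg (ltnW hu).
- exact: hf (ltnW hu).
- exact: hg.
Qed.
Lemma agreeX k f f' p : agree k f f' -> agree k (f ^+ p) (f' ^+ p).
Proof. by move=> hf; elim: p => // p IH; rewrite !exprS; apply: agreeM. Qed.
Lemma agree_sum k I (r : seq I) (P : pred I) (F G : I -> sh unit R) :
  (forall i, agree k (F i) (G i)) ->
  agree k (\sum_(i <- r | P i) F i) (\sum_(i <- r | P i) G i).
Proof. by move=> h w hw; rewrite !cf_sum; apply: eq_bigr => i _; apply: h. Qed.
Lemma agree_gen k f f' : agree k f f' -> agree k.+1 (gen * f) (gen * f').
Proof.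
move=> hf w; elim: w k f f' hf => [|[] w IH] k f f' hf hw; first by rewrite !cfM0 !mul0r.
case: k hf hw => // k hf hw; rewrite !cf_genM hf //.
by congr (_ + _); apply: (IH k) => // u hu; apply: hf.
Qed.
Lemma agree_genX p k f f' : agree k f f' -> agree (p + k) (gen ^+ p * f) (gen ^+ p * f').
Proof.
move=> hf; elim: p => [|p IH]; first by rewrite !expr0 !mul1r.
by rewrite !exprS -!mulrA addSn; apply: agree_gen.
Qed.

(** Contraction principle in the adic topology. The k-th iterate is final modulo the k-th power, so
    a word is read off the first iterate whose index exceeds its length. The index type X serves to
    solve a whole system of equations at once. *)
Lemma strict_causal_fixpoint (X : Type) (Psi : (X -> sh unit R) -> X -> sh unit R) :
  (forall k Y Y', (forall x, agree k (Y x) (Y' x)) -> forall x, agree k.+1 (Psi Y x) (Psi Y' x)) ->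
  exists Y, forall x, Y x = Psi Y x.
Proof.
move=> causal; pose It k := iter k Psi (fun=> 0).
have stab k l : (k <= l)%N -> forall x, agree k (It k x) (It l x).
  elim: k l => [|k IH] [|l] // kl x; exact: causal (IH l kl) x.
pose Y x := Sh (fun w => cf (It (size w).+1 x) w).
have YIt k x : agree k (Y x) (It k x) by move=> w hw /=; apply: (stab _ _ hw).
exists Y => x; apply: shP => w.
have := @causal (size w) Y (It (size w)) (YIt (size w)) x w (leqnn _) => ->.
by rewrite /Y.
Qed.

End OneLetter.
Arguments gen {R}.

(** * Places of finitely generated algebras *)

Section Places.
Variables (F : closedFieldType) (K : comNzRingType) (iota : {rmorphism F -> K}).
Hypothesis nzd : forall x y : K, x * y = 0 -> x = 0 \/ y = 0.

Record subalg (A : K -> Prop) : Prop := Subalg {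
  subalgC : forall c, A (iota c);
  subalgD : forall x y, A x -> A y -> A (x + y);
  subalgM : forall x y, A x -> A y -> A (x * y) }.

(** An algebra morphism from A to F, kept as a total function constrained on A only: subalgebras
    then stay predicates on one ring while elements are adjoined one by one. *)
Record place (A : K -> Prop) (phi : K -> F) : Prop := Place {
  placeC : forall c, phi (iota c) = c;
  placeD : forall x y, A x -> A y -> phi (x + y) = phi x + phi y;
  placeM : forall x y, A x -> A y -> phi (x * y) = phi x * phi y }.

Definition separated (A : K -> Prop) :=
  forall b, A b -> b <> 0 -> exists2 phi, place A phi & phi b != 0.

Section Subalg.
Variable A : K -> Prop.
Hypothesis subA : subalg A.

Lemma subalg0 : A 0. Proof. by rewrite -(rmorph0 iota); apply: subalgC. Qed.
Lemma subalg1 : A 1. Proof. by rewrite -(rmorph1 iota); apply: subalgC. Qed.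
Lemma subalgN x : A x -> A (- x).
Proof.
move=> Ax; rewrite -mulN1r -(rmorph1 iota) -rmorphN.
by apply: subalgM => //; apply: subalgC.
Qed.
Lemma subalgB x y : A x -> A y -> A (x - y).
Proof. by move=> Ax Ay; apply: subalgD => //; apply: subalgN. Qed.
Lemma subalgX x k : A x -> A (x ^+ k).
Proof. by move=> Ax; elim: k => [|k IH]; [exact: subalg1|rewrite exprS; apply: subalgM]. Qed.
Lemma subalg_sum I (r : seq I) (P : pred I) (G : I -> K) :
  (forall i, A (G i)) -> A (\sum_(i <- r | P i) G i).
Proof. by move=> h; elim/big_rec: _ => [|i x _ Ax]; [exact: subalg0|apply: subalgD]. Qed.
Section PlaceTheory.
Variable phi : K -> F.
Hypothesis pl : place A phi.
Lemma place0 : phi 0 = 0. Proof. by rewrite -(rmorph0 iota) (placeC pl). Qed.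
Lemma place1 : phi 1 = 1. Proof. by rewrite -(rmorph1 iota) (placeC pl). Qed.
Lemma placeN x : A x -> phi (- x) = - phi x.
Proof.
move=> Ax; rewrite -mulN1r -(rmorph1 iota) -rmorphN (placeM pl) // ?(placeC pl) ?mulN1r //.
exact: subalgC.
Qed.
Lemma placeX x k : A x -> phi (x ^+ k) = phi x ^+ k.
Proof.
move=> Ax; elim: k => [|k IH]; first exact: place1.
by rewrite !exprS (placeM pl) ?IH //; apply: subalgX.
Qed.
Lemma place_sum I (r : seq I) (P : pred I) (G : I -> K) :
  (forall i, A (G i)) -> phi (\sum_(i <- r | P i) G i) = \sum_(i <- r | P i) phi (G i).
Proof.
move=> h; elim: r => [|i r IH]; first by rewrite !big_nil place0.
by rewrite !big_cons; case: ifP => // _; rewrite (placeD pl) ?IH //; apply: subalg_sum.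
Qed.
End PlaceTheory.

Definition over (p : {poly K}) := forall i, A p`_i.

Lemma overC a : A a -> over a%:P.
Proof. by move=> Aa [|i]; rewrite coefC //=; apply: subalg0. Qed.
Lemma over0 : over 0. Proof. by move=> i; rewrite coef0; apply: subalg0. Qed.
Lemma over1 : over 1. Proof. exact/overC/subalg1. Qed.
Lemma overX : over 'X.
Proof. by move=> i; rewrite coefX; case: eqP => _; [exact: subalg1|exact: subalg0]. Qed.
Lemma overD p q : over p -> over q -> over (p + q).
Proof. by move=> hp hq i; rewrite coefD; apply: subalgD. Qed.
Lemma overB p q : over p -> over q -> over (p - q).
Proof. by move=> hp hq i; rewrite coefB; apply: subalgB. Qed.
Lemma overM p q : over p -> over q -> over (p * q).
Proof. by move=> hp hq i; rewrite coefM; apply: subalg_sum => j; apply: subalgM. Qed.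
Lemma overZ a p : A a -> over p -> over (a *: p).
Proof. by move=> Aa hp i; rewrite coefZ; apply: subalgM. Qed.
Lemma overXn k : over 'X^k.
Proof. by elim: k => [|k IH]; [exact: over1|rewrite exprS; apply: overM => //; apply: overX]. Qed.

(** Leading coefficients are not invertible in A, whence the power in front of f. *)
Lemma pseudo_division f g : over f -> over g -> g != 0 ->
  exists k q r, [/\ over q, over r, lead_coef g ^+ k *: f = q * g + r & (size r < size g)%N].
Proof.
move=> hf hg g0; have Al : A (lead_coef g) by apply: hg.
move: {2}(size f) (leqnn (size f)) => s; elim: s f hf => [|s IH] f hf sf.
  exists 0%N, 0, f; split => //; first exact: over0.
    by rewrite scale1r mul0r add0r.
  by move: sf; rewrite leqn0 => /eqP ->; rewrite size_poly_gt0.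
have [sfg|sfg] := ltnP (size f) (size g).
  by exists 0%N, 0, f; split => //; [exact: over0|rewrite scale1r mul0r add0r].
have [k [q [r [hq hr e sr]]]] : exists k q r, [/\ over q, over r,
    lead_coef g ^+ k *: (lead_coef g *: f - (lead_coef f *: 'X^(size f - size g)) * g)
      = q * g + r & (size r < size g)%N].
  apply: IH.
    apply: overB; first exact: overZ.
    by apply: overM => //; apply: overZ; [exact: hf|exact: overXn].
  apply/leq_sizeP => j sj; rewrite coefB coefZ -scalerAl coefZ coefXnM.
  have g1 : (0 < size g)%N by rewrite size_poly_gt0.
  have f1 : (0 < size f)%N by apply: leq_trans sfg.
  have jf : (size f <= j.+1)%N by apply: leq_trans sf _.
  rewrite ifF; last by apply/negbTE; rewrite -leqNgt; lia.
  have [e|ne] := eqVneq j (size f).-1.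
    rewrite e /lead_coef (_ : ((size f).-1 - (size f - size g))%N = (size g).-1); last by lia.
    by rewrite mulrC subrr.
  have sfj : (size f <= j)%N by move/eqP: ne; lia.
  rewrite (nth_default _ sfj) nth_default ?mulr0 ?subrr //.
  by move: sfg sfj; move: (size f) (size g) => a b; lia.
exists k.+1, (q + lead_coef g ^+ k *: (lead_coef f *: 'X^(size f - size g))), r; split => //.
  apply: overD => //; apply: overZ; first exact: subalgX.
  by apply: overZ; [exact: hf|exact: overXn].
by rewrite mulrDl addrAC -e scalerBr exprSr -[in LHS]scalerA -!scalerAl subrK.
Qed.

Definition adjoin (x : K) : K -> Prop := fun y => exists2 p, over p & y = p.[x].

Lemma adjoin_subalg x : subalg (adjoin x).
Proof.
split=> [c|_ _ [p hp ->] [q hq ->]|_ _ [p hp ->] [q hq ->]].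
- by exists (iota c)%:P; [apply: overC; apply: subalgC|rewrite hornerC].
- by exists (p + q); [apply: overD|rewrite hornerD].
- by exists (p * q); [apply: overM|rewrite hornerM].
Qed.
Lemma adjoin_sub x y : A y -> adjoin x y.
Proof. by move=> Ay; exists y%:P; [apply: overC|rewrite hornerC]. Qed.
Lemma adjoin_mem x : adjoin x x.
Proof. by exists 'X; [apply: overX|rewrite hornerX]. Qed.

Section Extend.
Variables (phi : K -> F) (x : K) (c : F).
Hypothesis pl : place A phi.

Definition polyphi (p : {poly K}) : {poly F} := \poly_(i < size p) phi p`_i.
Lemma coef_polyphi p i : (polyphi p)`_i = phi p`_i.
Proof. by rewrite coef_poly; case: ltnP => // h; rewrite nth_default // (place0 pl). Qed.
Lemma polyphiD p q : over p -> over q -> polyphi (p + q) = polyphi p + polyphi q.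
Proof.
move=> hp hq; apply/polyP => i; rewrite coefD !coef_polyphi coefD (placeD pl) //.
Qed.
Lemma polyphiM p q : over p -> over q -> polyphi (p * q) = polyphi p * polyphi q.
Proof.
move=> hp hq; apply/polyP => i; rewrite coefM !coef_polyphi coefM (place_sum pl) //.
  by apply: eq_bigr => j _; rewrite !coef_polyphi (placeM pl).
by move=> j; apply: subalgM.
Qed.
Lemma polyphiC a : polyphi a%:P = (phi a)%:P.
Proof. by apply/polyP => -[|i]; rewrite coef_polyphi !coefC //= (place0 pl). Qed.

Hypothesis kills : forall p, over p -> p.[x] = 0 -> (polyphi p).[c] = 0.

(** By [kills] the value given to p.[x] does not depend on p, so x may be sent to c; outside A[x]
    the value is 0. *)
Lemma place_extend : exists2 psi, place (adjoin x) psi &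
  forall p, over p -> psi p.[x] = (polyphi p).[c].
Proof.
have uniq p q : over p -> over q -> p.[x] = q.[x] -> (polyphi p).[c] = (polyphi q).[c].
  move=> hp hq e; have hpq : over (p - q) by apply: overB.
  have := kills hpq; rewrite hornerD hornerN e subrr => /(_ erefl) k0.
  by rewrite -[p](subrK q) polyphiD // hornerD k0 add0r.
have ex y : exists v, forall p, over p -> y = p.[x] -> v = (polyphi p).[c].
  have [[p hp e]|n] := pselect (adjoin x y).
    by exists (polyphi p).[c] => q hq e'; apply: uniq => //; rewrite -e.
  by exists 0 => p hp e; case: n; exists p.
have [psi psiP] := choice ex.
have psiE p : over p -> psi p.[x] = (polyphi p).[c] by move=> hp; apply: psiP.
exists psi => //; split=> [a|_ _ [p hp ->] [q hq ->]|_ _ [p hp ->] [q hq ->]].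
- rewrite -[iota a](hornerC _ x) psiE; last exact: overC (subalgC subA a).
  by rewrite polyphiC hornerC (placeC pl).
- by rewrite -hornerD !psiE ?polyphiD ?hornerD //; apply: overD.
- by rewrite -hornerM !psiE ?polyphiM ?hornerM //; apply: overM.
Qed.
End Extend.

Hypothesis sepA : separated A.

Lemma poly_nonroot (p : {poly F}) : p != 0 -> exists c, p.[c] != 0.
Proof.
move=> p0; have [sp|sp] := leqP (size p) 1.
  exists 0; rewrite (size1_polyC sp) hornerC; apply: contra p0 => /eqP p00.
  by rewrite (size1_polyC sp) p00.
have : size (p - 1) != 1%N.
  by rewrite size_polyDl ?size_polyN ?size_poly1 //; case: (size p) sp => [|[]].
move/closed_rootP => [c]; rewrite rootE hornerD hornerN hornerC subr_eq0 => /eqP e.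
by exists c; rewrite e oner_neq0.
Qed.

Lemma min_over (S : {poly K} -> Prop) : (exists p, S p) ->
  exists2 p, S p & forall q, S q -> (size p <= size q)%N.
Proof.
move=> [p Sp]; have ex : exists k, `[< exists2 p, S p & size p = k >].
  by exists (size p); apply/asboolP; exists p.
case: (ex_minnP ex) => k /asboolP[q Sq <-] kmin; exists q => // r Sr.
by apply: kmin; apply/asboolP; exists r.
Qed.

Lemma nzdX (a : K) k : a != 0 -> a ^+ k != 0.
Proof.
move=> a0; elim: k => [|k IH]; first exact: oner_neq0.
by rewrite exprS; apply/eqP => /nzd[] /eqP; apply/negP.
Qed.

(** If x is transcendental over A, take a place that keeps the leading coefficient of [pb] and send
    x to a non-root. If x has a minimal equation p over A, some nonzero combination of p and [pb] is
    a constant of A; take a place that kills neither it nor the leading coefficient of p, and send x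
    to a root of the image of p: there [pb] cannot vanish. *)
Lemma separated_adjoin x : separated (adjoin x).
Proof.
move=> b [pb hb eb] /eqP b0.
have [alg|tr] := pselect (exists p, [/\ over p, p != 0 & p.[x] = 0]); last first.
  have pb0 : pb != 0 by apply: contraNneq b0 => pb0; rewrite eb pb0 horner0.
  have lb : lead_coef pb <> 0 by apply/eqP; rewrite lead_coef_eq0.
  have [phi pl phi0] := sepA (hb (size pb).-1) lb.
  have [|c hc] := @poly_nonroot (polyphi phi pb).
    by apply: contraNneq phi0 => e; rewrite -(coef_polyphi pl) e coef0.
  have [|psi pls psiE] := @place_extend phi x c pl.
    move=> p hp px; have [->|p0] := eqVneq p 0; last by case: tr; exists p.
    by rewrite (polyphiC pl) (place0 pl) hornerC.
  by exists psi => //; rewrite eb psiE.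
have [p [hp p0 px] pmin] := min_over alg.
have sp2 : (1 < size p)%N.
  rewrite ltnNge; apply/negP => sp; move: px p0; rewrite (size1_polyC sp) hornerC => ->.
  by rewrite eqxx.
have small r : over r -> r.[x] = 0 -> (size r < size p)%N -> r = 0.
  move=> hr rx sr; apply/eqP; apply: contraTT sr => r0; rewrite -leqNgt; exact: pmin.
(* A shortest nonzero element r of the ideal of p and [pb] acts as their gcd: up to powers of its
   leading coefficient it divides both. It will turn out to be constant. *)
pose S r := [/\ over r, r != 0 & exists s u, [/\ over s, over u & r = s * p + u * pb]].
have [|r [hr r0 [s [u [hs hu er]]]] rmin] := @min_over S.
  exists p; split => //; exists 1, 0; split; [exact: over1|exact: over0|].
  by rewrite mul1r mul0r addr0.
have lr0 : lead_coef r != 0 by rewrite lead_coef_eq0.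
have exact f s' u' : over f -> over s' -> over u' -> f = s' * p + u' * pb ->
    exists k q, over q /\ lead_coef r ^+ k *: f = q * r.
  move=> hf hs' hu' ef; have [k [q [r' [hq hr' e sr']]]] := pseudo_division hf hr r0.
  exists k, q; split => //; rewrite e; suff -> : r' = 0 by rewrite addr0.
  apply/eqP; apply: contraTT sr' => r'0; rewrite -leqNgt; apply: rmin; split => //.
  have Al : A (lead_coef r ^+ k) by apply: subalgX; apply: hr.
  exists (lead_coef r ^+ k *: s' - q * s), (lead_coef r ^+ k *: u' - q * u); split.
  - by apply: overB; [exact: overZ|exact: overM].
  - by apply: overB; [exact: overZ|exact: overM].
  have -> : r' = lead_coef r ^+ k *: f - q * r by rewrite e addrC addKr.
  rewrite ef er -!mul_polyC; ring.
have [k [q [hq eq]]] := exact p 1 0 hp over1 over0 (esym (etrans (congr2 +%R (mul1r p) (mul0r pb)) (addr0 p))).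
have [k' [q' [hq' eq']]] := exact pb 0 1 hb over0 over1 (esym (etrans (congr2 +%R (mul0r p) (mul1r pb)) (add0r pb))).
have lk0 := nzdX k lr0; have lk0' := nzdX k' lr0.
have rx : r.[x] != 0.
  apply: contraNneq b0 => rx; rewrite eb; move: (congr1 (fun f => f.[x]) eq').
  rewrite hornerZ hornerM rx mulr0 => /nzd[/eqP|->//]; by rewrite (negPf lk0').
have qx : q.[x] = 0.
  move: (congr1 (fun f => f.[x]) eq); rewrite hornerZ hornerM px mulr0 => /esym /nzd[//|/eqP].
  by rewrite (negPf rx).
have lp0 : lead_coef r ^+ k *: p != 0.
  apply/eqP => /polyP /(_ (size p).-1); rewrite coefZ coef0 => /nzd[] /eqP; first exact/negP.
  by rewrite -[_`_ _]/(lead_coef p) lead_coef_eq0 (negPf p0).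
have q0 : q != 0 by apply: contraNneq lp0 => q0; rewrite eq q0 mul0r.
have lqr : lead_coef q * lead_coef r != 0.
  by apply/eqP => /nzd[] /eqP; rewrite ?(negPf lr0) // lead_coef_eq0 (negPf q0).
have sq : (size p <= size q)%N.
  by rewrite leqNgt; apply: contra q0 => sq; apply/eqP/small.
(* q kills x, hence is at least as long as p, while [q * r] is no longer than p. *)
have sr : size r = 1%N.
  have : (size (q * r)%R <= size p)%N by rewrite -eq; apply: size_scale_leq.
  rewrite size_proper_mul //; have : (0 < size r)%N by rewrite size_poly_gt0.
  by move: sq sp2; move: (size p) (size q) (size r) => j1 j2 j3; clear; lia.
have er0 : r = (r`_0)%:P by apply: size1_polyC; rewrite sr.
have r00 : r`_0 <> 0 by move=> h; move: r0; rewrite er0 h eqxx.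
have Ar : A (r`_0 * lead_coef p) by apply: (subalgM subA); [apply: hr|apply: hp].
have [|phi pl] := sepA Ar.
  by move=> /nzd[//|/eqP]; rewrite lead_coef_eq0 (negPf p0).
rewrite (placeM pl) ?mulf_eq0 ?negb_or; [|exact: hr|exact: hp] => /andP[phir phil].
have [c hc] : exists c, root (polyphi phi p) c.
  apply/closed_rootP; apply/eqP => sp1.
  have : (polyphi phi p)`_(size p).-1 != 0 by rewrite (coef_polyphi pl).
  by rewrite nth_default ?eqxx // sp1; move: sp2; case: (size p) => [|[|j1]].
have kills f : over f -> f.[x] = 0 -> (polyphi phi f).[c] = 0.
  move=> hf fx; have [j [q1 [r1 [hq1 hr1 e1 sr1]]]] := pseudo_division hf hp p0.
  have Al : A (lead_coef p) by apply: hp.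
  have r10 : r1 = 0.
    apply: small => //; move: (congr1 (fun f => f.[x]) e1).
    by rewrite hornerZ hornerD hornerM fx px !mulr0 add0r.
  move: (congr1 (fun f => (polyphi phi f).[c]) e1); rewrite r10 addr0 -mul_polyC.
  rewrite !(polyphiM pl) //; last by apply/overC/subalgX.
  rewrite !hornerM (eqP hc) mulr0 (polyphiC pl) hornerC (placeX pl) // => /eqP.
  by rewrite mulf_eq0 expf_eq0 (negPf phil) andbF => /eqP.
have [psi pls psiE] := place_extend pl kills.
exists psi => //; rewrite eb psiE //; apply: contraNneq phir => pb0.
have <- : (polyphi phi r).[c] = phi r`_0 by rewrite {1}er0 (polyphiC pl) hornerC.
rewrite er (polyphiD pl) ?(polyphiM pl) //; try exact: overM.
by rewrite hornerD !hornerM pb0 (eqP hc) !mulr0 addr0.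
Qed.

End Subalg.

Lemma separated_base : injective iota -> separated (fun y => exists c, y = iota c).
Proof.
move=> inj _ [c ->] c0; have ex y : exists v, forall c, y = iota c -> v = c.
  have [[v e]|n] := pselect (exists c, y = iota c).
    by exists v => v' e'; apply: inj; rewrite -e.
  by exists 0 => v e; case: n; exists v.
have [phi phiP] := choice ex.
have phiE a : phi (iota a) = a by apply: phiP.
exists phi; last by rewrite phiE; apply/eqP => e; apply: c0; rewrite e rmorph0.
split => // _ _ [a ->] [b ->]; rewrite -?rmorphD -?rmorphM !phiE //.
Qed.

(* A Nullstellensatz: finitely generated subalgebras have enough points over [F]. *)
Lemma places_exist (xs : seq K) : exists A : K -> Prop,
  [/\ subalg A, forall x, x \in xs -> A x & separated A].
Proof.
have inj : injective iota by apply: fmorph_inj.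
elim: xs => [|x xs [A [subA Axs sepA]]].
  exists (fun y => exists c, y = iota c); split => //; last exact: separated_base.
  split=> [c|_ _ [a ->] [b ->]|_ _ [a ->] [b ->]]; first by exists c.
    by exists (a + b); rewrite rmorphD.
  by exists (a * b); rewrite rmorphM.
exists (adjoin A x); split; first exact: adjoin_subalg.
  by move=> y; rewrite inE => /predU1P[->|/Axs Ay]; [exact: adjoin_mem|exact: adjoin_sub].
exact: separated_adjoin.
Qed.

End Places.

(** * Hyperlogarithms *)

(* A ring of hyperlogarithms with the letters [1 / (t - tm i)]: [hk] embeds the constants,
   [hd] is d/dt, [hN i] is the infinitesimal monodromy around [tm i], [hev] is the value at
   t = 0, [hy i] is 1 / (t - tm i), [hI] is the primitive that vanishes at 0, and [hT] is the
   Taylor expansion at 0. *)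
Record hyperlog (F : numFieldType) (q : nat) (tm : 'I_q -> F) := Hyperlog {
  hE :> comNzRingType;
  hk : {rmorphism F -> hE};
  hd : hE -> hE;
  hN : 'I_q -> hE -> hE;
  hev : {rmorphism hE -> F};
  hy : 'I_q -> hE;
  ht : hE;
  hI : hE -> hE;
  hT : {rmorphism hE -> sh unit F};
  hd_der : derivation hd;
  hN_der : forall i, derivation (hN i);
  hdN : forall i f, hd (hN i f) = hN i (hd f);
  hdk : forall c, hd (hk c) = 0;
  hNk : forall i c, hN i (hk c) = 0;
  hdt : hd ht = 1;
  hNt : forall i, hN i ht = 0;
  hNy : forall i j, hN i (hy j) = 0;
  hyK : forall i, (ht - hk (tm i)) * hy i = 1;
  hdI : forall f, hd (hI f) = f;
  hevI : forall f, hev (hI f) = 0;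
  hevk : forall c, hev (hk c) = c;
  hevt : hev ht = 0;
  hNI : forall i j, hN i (hI (hy j)) = (i == j)%:R;
  hTd : forall f, hT (hd f) = strip tt (hT f);
  hTev : forall f, cst (hT f) = hev f;
  hT_inj : forall f, hT f = 0 -> f = 0 }.

(** * Construction of the hyperlogarithms: rational functions, iterated integrals, Taylor
    expansion *)

Section Taylor.
Variable F : numFieldType.
Local Notation T := (sh unit F).
Local Notation t := (gen : T).
Local Notation dt := (strip tt : T -> T).

Definition taylor_der : derivation (strip tt : T -> T) := strip_der F tt.

Lemma F_natS_neq0 k : (k.+1)%:R != 0 :> F. Proof. by rewrite pnatr_eq0. Qed.

Lemma taylor_nzd (f g : T) : f * g = 0 -> f = 0 \/ g = 0.
Proof.
apply: sh_unit_nzd; first exact: F_natS_neq0.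
by move=> x y /eqP; rewrite mulf_eq0 => /orP[] /eqP; [left|right].
Qed.
Lemma taylorI (f g h : T) : f != 0 -> f * g = f * h -> g = h.
Proof.
move=> f0 /eqP; rewrite -subr_eq0 -mulrBr => /eqP /taylor_nzd[/eqP|/eqP].
  by rewrite (negPf f0).
by rewrite subr_eq0 => /eqP.
Qed.

Definition emb (p : {poly F}) : T := (map_poly (shC : F -> T) p).[t].
Fact emb_zmod : zmod_morphism emb.
Proof. by move=> p q; rewrite /emb rmorphB hornerD hornerN. Qed.
HB.instance Definition _ := GRing.isZmodMorphism.Build {poly F} T emb emb_zmod.
Fact emb_monoid : monoid_morphism emb.
Proof. by split=> [|p q]; rewrite /emb ?rmorph1 ?hornerC // rmorphM hornerM. Qed.
HB.instance Definition _ := GRing.isMonoidMorphism.Build {poly F} T emb emb_monoid.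

Lemma embC c : emb c%:P = shC c. Proof. by rewrite /emb map_polyC hornerC. Qed.
Lemma embX : emb 'X = t. Proof. by rewrite /emb map_polyX hornerX. Qed.

Lemma emb_deriv p : dt (emb p) = emb p^`().
Proof.
elim/poly_ind: p => [|p c IH].
  by rewrite rmorph0 deriv0 rmorph0; apply: shP.
rewrite derivD derivM derivX derivC addr0 mulr1 !rmorphD !rmorphM /= embX embC.
rewrite (taylor_der.1) (derM taylor_der) stripC strip_gen IH addr0 mulr1; ring.
Qed.

Lemma cst_emb p : cst (emb p) = p`_0.
Proof.
elim/poly_ind: p => [|p c IH]; first by rewrite rmorph0 coef0.
by rewrite rmorphD rmorphM /= embX embC rmorphD rmorphM /= cst_gen mulr0 add0r coefD coefMX coefC add0r.
Qed.

Lemma emb_eq0 p : emb p = 0 -> p = 0.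
Proof.
move: {2}(size p) (leqnn (size p)) => s; elim: s p => [|s IH] p.
  by rewrite leqn0 size_poly_eq0 => /eqP.
move=> sp ep; have [//|pn0] := eqVneq p 0; have p00 : p`_0 = 0 by rewrite -cst_emb ep.
have d0 : p^`() = 0.
  apply: IH; last by rewrite -emb_deriv ep; apply: shP.
  by rewrite -ltnS; apply: leq_trans (lt_size_deriv pn0) sp.
apply/polyP => -[|i]; rewrite coef0 //.
by have /polyP /(_ i) := d0; rewrite coef_deriv coef0 -mulr_natr => /eqP; rewrite mulf_eq0 (negPf (F_natS_neq0 _)) orbF => /eqP.
Qed.
Lemma emb_inj p q : emb p = emb q -> p = q.
Proof. by move=> e; apply/eqP; rewrite -subr_eq0; apply/eqP/emb_eq0; rewrite rmorphB /= e subrr. Qed.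

Variables (q : nat) (tm : 'I_q -> F).
Hypotheses (tm_inj : injective tm) (tm0 : forall i, tm i != 0).

(** The successive derivatives of 1 / (t - tm i) at 0. *)
Definition yy i : T := Sh (fun w => - (size w)`!%:R / tm i ^+ (size w).+1).

Lemma yyK i : (t - shC (tm i)) * yy i = 1.
Proof.
have tg (f : T) k : co (t * f) k.+1 = k.+1%:R * co f k.
  elim: k f => [|k IH] f; first by rewrite /co cf_genM cfM0 /= !mul0r addr0 mul1r.
  rewrite -[LHS]/(cf (t * f) (tt :: nseq k.+1 tt)) cf_genM -[cf (t * _) _]/(co (t * dt f) k.+1) IH.
  by rewrite coS -[cf f _]/(co f k.+1) -{1}[co f _]mul1r -mulrDl -[k.+2%:R]natr1 addrC.
apply: coP => -[|k]; rewrite mulrBl /co cfB shCM.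
  by rewrite cfM0 /= fact0 expr1; have := tm0 i => ti; field.
rewrite -[cf (t * _) _]/(co (t * yy i) k.+1) tg /co /= size_nseq.
have := tm0 i; rewrite factS natrM !exprS => ti; field.
by rewrite ti expf_neq0.
Qed.

Lemma yy_deriv i : dt (yy i) = - yy i ^+ 2.
Proof.
have := congr1 (strip tt) (yyK i); rewrite (derM taylor_der) (derB taylor_der) stripC subr0 strip_gen mul1r (der1 taylor_der).
move=> /(congr1 ( *%R (yy i))); rewrite mulr0 mulrDr mulrA [yy i * (_ - _)]mulrC yyK mul1r => /eqP.
by rewrite addrC addr_eq0 => /eqP ->; rewrite expr2.
Qed.

Lemma yyM i j : tm i != tm j -> yy i * yy j = shC (tm i - tm j)^-1 * (yy i - yy j).
Proof.
move=> ij; have tij : tm i - tm j != 0 by rewrite subr_eq0.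
have e : yy i - yy j = shC (tm i - tm j) * (yy i * yy j).
  rewrite -{1}[yy i]mulr1 -{1}(yyK j) -{2}[yy j]mulr1 -{1}(yyK i) rmorphB /=; ring.
by rewrite e mulrA -rmorphM /= mulVf // rmorph1 mul1r.
Qed.

(** Rational functions with poles among the tm i, given through partial fractions: primitives can
    then be taken term by term. *)
Inductive R0 : T -> Prop :=
| R0_t k : R0 (t ^+ k)
| R0_y i k : R0 (yy i ^+ k.+1)
| R0_D f g : R0 f -> R0 g -> R0 (f + g)
| R0_Z c f : R0 f -> R0 (shC c * f).

Lemma R0_0 : R0 0.
Proof. by rewrite -(mul0r (t ^+ 0)) -(rmorph0 (shC : F -> T)); apply: R0_Z; apply: R0_t. Qed.
Lemma R0_C c : R0 (shC c).
Proof. by rewrite -[shC c]mulr1 -(expr0 t); apply: R0_Z; apply: R0_t. Qed.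
Lemma R0_1 : R0 1. Proof. by rewrite -(expr0 t); apply: R0_t. Qed.
Lemma R0_N f : R0 f -> R0 (- f).
Proof. by move=> hf; rewrite -mulN1r -(rmorph1 (shC : F -> T)) -rmorphN; apply: R0_Z. Qed.
Lemma R0_yX i k : R0 (yy i ^+ k).
Proof. by case: k => [|k]; [rewrite expr0; exact: R0_1|exact: R0_y]. Qed.

Lemma R0_Mt f : R0 f -> R0 (t * f).
Proof.
elim=> [k|i k|f' g _ IHf _ IHg|c f' _ IHf].
- by rewrite -exprS; apply: R0_t.
- have -> : t * yy i ^+ k.+1 = yy i ^+ k + shC (tm i) * yy i ^+ k.+1.
    by rewrite exprS -[X in X + _]mul1r -(yyK i); ring.
  by apply: R0_D; [apply: R0_yX|apply: R0_Z; apply: R0_y].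
- by rewrite mulrDr; apply: R0_D.
- by rewrite mulrCA; apply: R0_Z.
Qed.
Lemma R0_My i f : R0 f -> R0 (yy i * f).
Proof.
elim=> [k|j k|f' g _ IHf _ IHg|c f' _ IHf].
- elim: k => [|k IH]; first by rewrite expr0 mulr1 -(expr1 (yy i)); apply: R0_y.
  have -> : yy i * t ^+ k.+1 = t ^+ k + shC (tm i) * (yy i * t ^+ k).
    by rewrite exprS -[X in X + _]mul1r -(yyK i); ring.
  by apply: R0_D; [apply: R0_t|apply: R0_Z].
- have [->|ij] := eqVneq i j; first by rewrite -exprS; apply: R0_y.
  have tij : tm i != tm j by rewrite (inj_eq tm_inj).
  elim: k => [|k IH].
    rewrite expr1 yyM //; apply: R0_Z; apply: R0_D; last apply: R0_N.
      by rewrite -(expr1 (yy i)); apply: R0_y.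
    by rewrite -(expr1 (yy j)); apply: R0_y.
  rewrite exprS mulrA yyM // -mulrA mulrBl -exprS; apply: R0_Z; apply: R0_D => //.
  by apply: R0_N; apply: R0_y.
- by rewrite mulrDr; apply: R0_D.
- by rewrite mulrCA; apply: R0_Z.
Qed.
Lemma R0_M f g : R0 f -> R0 g -> R0 (f * g).
Proof.
move=> hf hg; elim: hf => [k|i k|f' g' _ IHf _ IHg|c f' _ IHf].
- by elim: k => [|k IH]; rewrite ?expr0 ?mul1r // exprS -mulrA; apply: R0_Mt.
- elim: k => [|k IH]; first by rewrite expr1; apply: R0_My.
  by rewrite exprS -mulrA; apply: R0_My.
- by rewrite mulrDl; apply: R0_D.
- by rewrite -mulrA; apply: R0_Z.
Qed.
Lemma R0_sum I (r : seq I) (P : pred I) (G : I -> T) :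
  (forall i, R0 (G i)) -> R0 (\sum_(i <- r | P i) G i).
Proof. by move=> h; elim/big_rec: _ => [|i x _ ?]; [exact: R0_0|apply: R0_D]. Qed.

Lemma R0_deriv f : R0 f -> R0 (dt f).
Proof.
elim=> [[|k]|i k|f' g _ IHf _ IHg|c f' _ IHf].
- by rewrite expr0 (der1 taylor_der); apply: R0_0.
- rewrite (derX taylor_der) strip_gen mulr1 -(rmorph_nat (shC : F -> T)).
  by apply: R0_Z; apply: R0_t.
- rewrite (derX taylor_der) yy_deriv -mulrA mulrN -exprD -(rmorph_nat (shC : F -> T)).
  by apply: R0_Z; apply: R0_N; apply: R0_yX.
- by rewrite taylor_der.1; apply: R0_D.
- by rewrite (derM taylor_der) stripC mul0r add0r; apply: R0_Z.
Qed.

Lemma R0_emb p : R0 (emb p).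
Proof.
elim/poly_ind: p => [|p c IH]; first by rewrite rmorph0; exact: R0_0.
by rewrite rmorphD rmorphM /= embX embC mulrC; apply: R0_D; [exact: R0_Mt|exact: R0_C].
Qed.

Lemma shC_natVK k : shC k.+1%:R^-1 * k.+1%:R = 1 :> T.
Proof.
have -> : k.+1%:R = shC k.+1%:R :> T by rewrite rmorph_nat.
by rewrite -rmorphM mulVf ?F_natS_neq0 // rmorph1.
Qed.

(** Only the first powers of the y i lack a primitive in [R0]; their coefficients are the
    residues. *)
Lemma R0_int f : R0 f -> exists2 gc : T * ('I_q -> F), R0 gc.1 &
  f = dt gc.1 + \sum_i shC (gc.2 i) * yy i.
Proof.
have S0 : \sum_i shC 0 * yy i = 0 by rewrite big1 // => i _; rewrite rmorph0 mul0r.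
elim=> [k|i [|k]|f' g _ [[u c] /= hu ->] _ [[v d] /= hv ->]|a f' _ [[u c] /= hu ->]].
- exists (shC k.+1%:R^-1 * t ^+ k.+1, fun=> 0) => /=; first by apply: R0_Z; apply: R0_t.
  rewrite S0 addr0 (derM taylor_der) stripC mul0r add0r (derX taylor_der) strip_gen mulr1.
  by rewrite mulrA shC_natVK mul1r.
- exists (0, fun j => (j == i)%:R) => /=; first exact: R0_0.
  rewrite (der0 taylor_der) add0r (bigD1 i) //= eqxx rmorph1 mul1r big1 ?addr0 //.
  by move=> j /negPf ->; rewrite rmorph0 mul0r.
- exists (- (shC k.+1%:R^-1 * yy i ^+ k.+1), fun=> 0) => /=.
    by apply: R0_N; apply: R0_Z; apply: R0_y.
  rewrite S0 addr0 (derN taylor_der) (derM taylor_der) stripC mul0r add0r (derX taylor_der) yy_deriv.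
  by rewrite mulrN mulrN opprK -[_%:R * _ * _]mulrA [shC _ * _]mulrA shC_natVK mul1r -exprD addn2.
- exists (u + v, fun i => c i + d i) => /=; first exact: R0_D.
  rewrite taylor_der.1 addrACA; congr (_ + _); rewrite -big_split /=; apply: eq_bigr => i _.
  by rewrite rmorphD /= mulrDl.
- exists (shC a * u, fun i => a * c i) => /=; first exact: R0_Z.
  rewrite mulrDr (derM taylor_der) stripC mul0r add0r mulr_sumr; congr (_ + _).
  by apply: eq_bigr => i _; rewrite rmorphM mulrA.
Qed.

Definition Wp : {poly F} := \prod_i ('X - (tm i)%:P).
Lemma emb_XsubC c : emb ('X - c%:P) = t - shC c.
Proof. by rewrite rmorphB /= embX embC. Qed.

Lemma Wp_neq0 : Wp != 0.
Proof. by rewrite /Wp prodf_seq_neq0; apply/allP => i _; rewrite /= polyXsubC_eq0. Qed.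

Lemma emb_Wy i : emb Wp * yy i = emb (\prod_(j | j != i) ('X - (tm j)%:P)).
Proof.
rewrite /Wp (bigD1 i) //= rmorphM /= emb_XsubC mulrAC mulrC.
by rewrite yyK mulr1.
Qed.

Lemma R0_den f : R0 f -> exists N p, emb (Wp ^+ N) * f = emb p.
Proof.
elim=> [k|i k|f' g _ [N [p ep]] _ [M [r er]]|c f' _ [N [p ep]]].
- by exists 0%N, ('X^k); rewrite expr0 rmorph1 mul1r rmorphXn /= embX.
- exists k.+1, ((\prod_(j | j != i) ('X - (tm j)%:P)) ^+ k.+1).
  by rewrite !rmorphXn /= -emb_Wy exprMn.
- exists (N + M)%N, (Wp ^+ M * p + Wp ^+ N * r).
  by rewrite mulrDr !rmorphD !rmorphM /= -ep -er exprD rmorphM /=; ring.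
- by exists N, (c%:P * p); rewrite mulrCA ep rmorphM /= embC.
Qed.

Lemma R0_pole f a : R0 f -> exists K, exists2 rp : {poly F} * {poly F},
  rp.1.[tm a] != 0 & (t - shC (tm a)) ^+ K * emb rp.1 * f = emb rp.2.
Proof.
move=> /R0_den[N [p ep]]; exists N, ((\prod_(j | j != a) ('X - (tm j)%:P)) ^+ N, p) => /=.
  rewrite horner_exp expf_neq0 // horner_prod prodf_seq_neq0; apply/allP => j _.
  by apply/implyP => ja; rewrite hornerXsubC subr_eq0 (inj_eq tm_inj) eq_sym.
rewrite -ep -emb_XsubC -rmorphXn -rmorphM /= -exprMn; congr (emb (_ ^+ _) * _).
by rewrite /Wp [RHS](bigD1 a).
Qed.

(** Let K be the order of the pole of g at tm a. If K > 0, the derivative has there a pole of order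
    K + 1 > 1, and the right-hand side has none of that order; if K = 0, the derivative has no pole
    at all and c a = 0. Everything is phrased with polynomials, evaluated at tm a after clearing
    denominators. *)
Lemma R0_no_residue g (c : 'I_q -> F) : R0 g -> dt g = \sum_i shC (c i) * yy i ->
  forall i, c i = 0.
Proof.
move=> hg eg a.
have ex : exists K, `[< exists2 rp : {poly F} * {poly F},
  rp.1.[tm a] != 0 & (t - shC (tm a)) ^+ K * emb rp.1 * g = emb rp.2 >].
  by have [K h] := R0_pole a hg; exists K; apply/asboolP.
pose u := 'X - (tm a)%:P : {poly F}.
pose Da := \prod_(j | j != a) ('X - (tm j)%:P).
have eW : Wp = u * Da by rewrite /Wp (bigD1 a).
have Da0 : Da.[tm a] != 0.
  rewrite horner_prod prodf_seq_neq0; apply/allP => j _.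
  by apply/implyP => ja; rewrite hornerXsubC subr_eq0 (inj_eq tm_inj) eq_sym.
have u0 : u.[tm a] = 0 by rewrite hornerXsubC subrr.
pose S := \sum_i (c i)%:P * \prod_(j | j != i) ('X - (tm j)%:P).
have eS : emb Wp * dt g = emb S.
  rewrite eg mulr_sumr rmorph_sum; apply: eq_bigr => i _ /=.
  by rewrite mulrCA emb_Wy rmorphM /= embC.
have Sa : S.[tm a] = c a * Da.[tm a].
  rewrite horner_sum (bigD1 a) //= hornerM hornerC [X in _ + X]big1 ?addr0 // => i ia.
  rewrite hornerM horner_prod (bigD1 a) ?[a == i]eq_sym //=.
  by rewrite hornerXsubC subrr mul0r mulr0.
case: (ex_minnP ex) => -[|K] /asboolP[[r p] /= ra e] Kmin.
  have : emb r * emb r * (emb Wp * dt g) = emb (Wp * (p^`() * r - r^`() * p)).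
    rewrite rmorphM rmorphB !rmorphM /= -!emb_deriv -e expr0 !mul1r.
    rewrite (derM taylor_der); ring.
  rewrite eS -!rmorphM => /emb_inj /(congr1 (fun f => f.[tm a])).
  rewrite eW !hornerM u0 !mul0r Sa => /eqP; rewrite !mulf_eq0 (negPf ra) (negPf Da0) !orbF.
  by move/eqP.
have pa : p.[tm a] = 0.
  (* At tm a only the first term survives, so p has a factor u and K was not minimal. *)
  have : (K.+1%:R)%:P * p * r * Da + p * r^`() * u * Da + u ^+ K.+1 * r * r * S
     = p^`() * u * r * Da.
    apply: emb_inj; rewrite !rmorphD !rmorphM /= -eS eW embC rmorph_nat !rmorphM !rmorphXn /=.
    rewrite -!emb_deriv -e !emb_XsubC.
    rewrite !(derM taylor_der) (derX taylor_der) (derB taylor_der) strip_gen stripC subr0 (exprS _ K); ring.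
  move=> /(congr1 (fun f => f.[tm a])); rewrite !hornerD !hornerM horner_exp u0 expr0n /=.
  rewrite !mulr0 !mul0r !addr0 hornerC => /eqP; rewrite !mulf_eq0 (negPf Da0) (negPf ra) !orbF.
  by rewrite (negPf (F_natS_neq0 _)) => /eqP.
have [p1 ep1] : exists p1, p = u * p1.
  have /factor_theorem [p1 ->] : root p (tm a) by apply/eqP.
  by exists p1; rewrite mulrC.
suff : (K.+1 <= K)%N by rewrite ltnn.
apply: Kmin; apply/asboolP; exists (r, p1) => //=.
have tu0 : t - shC (tm a) != 0.
  by rewrite -emb_XsubC; apply/eqP => /emb_eq0 /eqP; rewrite polyXsubC_eq0.
apply: (taylorI tu0); rewrite 2!mulrA -exprS e ep1 -emb_XsubC rmorphM //=.
Qed.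

Local Notation E0 := (sh 'I_q T).
(** f stands for the sum of the iterated integrals of all words w with coefficients [cf f w]. The
    derivative of the integral of i :: w is y i times that of w, and the coefficients depend on t as
    well. *)
Definition dE (f : E0) : E0 := shmap dt f + \sum_i shC (yy i) * strip i f.
Lemma dE_der : derivation dE.
Proof.
have dm := shmap_der 'I_q taylor_der; have ds (i : 'I_q) := strip_der T i.
split=> [f g|f g]; rewrite /dE.
  rewrite dm.1 addrACA -big_split; congr (_ + _); apply: eq_bigr => i _ /=.
  by rewrite (ds i).1 mulrDr.
rewrite (derM dm) mulrDl mulrDr addrACA; congr (_ + _).
rewrite mulr_suml mulr_sumr -big_split; apply: eq_bigr => i _ /=.
rewrite (derM (ds i)); ring.
Qed.
Lemma dE_cf f w : cf (dE f) w = dt (cf f w) + \sum_i yy i * cf f (i :: w).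
Proof. by rewrite cfD cf_sum; congr (_ + _); apply: eq_bigr => i _; rewrite shCM. Qed.
Lemma dE_rstrip j f : dE (rstrip j f) = rstrip j (dE f).
Proof. by apply: shP => w; rewrite dE_cf -[RHS]/(cf (dE f) (rcons w j)) dE_cf. Qed.

(** Integrals are taken from 0, so only the empty word contributes at t = 0. *)
Definition evE (f : E0) : F := cst (cst f).
Fact evE_zmod : zmod_morphism evE. Proof. by move=> f g; rewrite /evE !rmorphB. Qed.
HB.instance Definition _ := GRing.isZmodMorphism.Build E0 F evE evE_zmod.
Fact evE_monoid : monoid_morphism evE.
Proof. by split=> [|f g]; rewrite /evE ?rmorph1 ?rmorphM. Qed.
HB.instance Definition _ := GRing.isMonoidMorphism.Build E0 F evE evE_monoid.

Definition taylor (f : E0) : T := Sh (fun w => evE (iter (size w) dE f)).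
Lemma taylor_d f : taylor (dE f) = dt (taylor f).
Proof. by apply: shP => w /=; rewrite -iterS iterSr. Qed.
Fact taylor_zmod : zmod_morphism taylor.
Proof.
move=> f g; apply: shP => w; rewrite cfB /=.
elim: {w}(size w) f g => [|k IH] f g; first by rewrite /= rmorphB.
by rewrite !iterSr (derB dE_der) IH.
Qed.
HB.instance Definition _ := GRing.isZmodMorphism.Build E0 T taylor taylor_zmod.
Fact taylor_monoid : monoid_morphism taylor.
Proof.
split.
  apply: shP => -[|[] w] /=; first by rewrite rmorph1.
  by rewrite -iterS iterSr (der1 dE_der) -[evE _]/(cf (taylor 0) w) raddf0.
move=> f g; apply: shP => w; elim: w f g => [|[] w IH] f g; first by rewrite /= rmorphM.
rewrite cfMS -!taylor_d -!IH -cfD -raddfD -dE_der.2.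
by rewrite [X in _ = cf X _]taylor_d.
Qed.
HB.instance Definition _ := GRing.isMonoidMorphism.Build E0 T taylor taylor_monoid.

Definition bounded L (f : E0) := forall w, (L <= size w)%N -> cf f w = 0.
Definition regular (f : E0) := forall w, R0 (cf f w).
(** Finite combinations of words over rational functions. With arbitrary series as coefficients the
    expansion at 0 would not be injective: a word minus its own expansion would be killed. *)
Definition nice f := exists2 L, bounded L f & regular f.

Lemma regularM f g : regular f -> regular g -> regular (f * g).
Proof.
move=> hf hg w; elim: w f g hf hg => [|i w IH] f g hf hg; first exact: R0_M.
by rewrite cfMS; apply: R0_D; apply: IH => // u; [exact: hf|exact: hg].
Qed.
Lemma boundedM L M f g : bounded L f -> bounded M g -> bounded (L + M) (f * g).
Proof.
move=> hf hg w hw.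
have h0 : forall u v, (size u + size v = size w)%N -> cf f u * cf g v = 0.
  move=> u v e; have [h|h] := leqP L (size u); first by rewrite hf // mul0r.
  by rewrite [cf g v]hg ?mulr0 //; lia.
move: h0 => {hf hg hw}; elim: w f g => [|i w IH] f g h; first exact: (h [::] [::]).
rewrite cfMS !IH ?addr0 // => u v e; first by apply: (h (u) (i :: v)) => /=; rewrite addnS e.
by apply: (h (i :: u) v) => /=; rewrite addSn e.
Qed.

Lemma nice1 : nice 1.
Proof. by exists 1%N => [[|i w]|[|i w]] //=; [exact: R0_1|exact: R0_0]. Qed.
Lemma niceB f g : nice f -> nice g -> nice (f - g).
Proof.
move=> [L bf rf] [M bg rg]; exists (maxn L M) => w; last by rewrite cfB; apply: R0_D => //; apply: R0_N.
by rewrite geq_max => /andP[hL hM]; rewrite cfB bf ?bg ?subrr.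
Qed.
Lemma nice0 : nice 0.
Proof. by rewrite -(subrr 1); apply: niceB; exact: nice1. Qed.
Lemma niceD f g : nice f -> nice g -> nice (f + g).
Proof.
by move=> hf hg; rewrite -[g]opprK -[- g]add0r; apply: niceB => //; apply: niceB => //; exact: nice0.
Qed.
Lemma niceM f g : nice f -> nice g -> nice (f * g).
Proof.
move=> [L bf rf] [M bg rg]; exists (L + M)%N; [exact: boundedM|exact: regularM].
Qed.
Lemma nice_shC f : R0 f -> nice (shC f).
Proof. by move=> hf; exists 1%N => -[|i w] //=; apply: R0_0. Qed.
Lemma nice_dE f : nice f -> nice (dE f).
Proof.
move=> [L bf rf]; exists L => w; rewrite dE_cf; first move=> hw.
  rewrite bf // big1 ?addr0; last by move=> i _; rewrite bf ?mulr0 //= ltnW.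
  by apply: shP.
apply: R0_D; first exact: R0_deriv.
by apply: R0_sum => i; apply: R0_My.
Qed.
Lemma nice_rstrip j f : nice f -> nice (rstrip j f).
Proof. by move=> [L bf rf]; exists L => w //= hw; rewrite bf // size_rcons ltnW. Qed.

(** Induction on the length of the longest words. Their coefficients are integrated, the residues
    become constant coefficients of words with one more letter, and the error is supported on
    shorter words. *)
Lemma nice_int f : nice f -> exists2 g, nice g & dE g = f.
Proof.
move=> [L]; elim: L f => [|L IH] f bf rf.
  exists 0; first exact: nice0.
  by rewrite (der0 dE_der); apply: shP => w; rewrite bf.
have ex w : exists gc : T * ('I_q -> F), R0 gc.1 /\
    cf f w = dt gc.1 + \sum_i shC (gc.2 i) * yy i.
  by have [gc ? ?] := R0_int (rf w); exists gc.
have [gc gcP] := choice ex.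
pose G : E0 := Sh (fun w => if size w == L then (gc w).1 else
  if w is i :: v then if size v == L then shC ((gc v).2 i) else 0 else 0).
have rG : regular G.
  move=> w /=; case: eqP => _; first exact: (gcP w).1.
  by case: w => [|i v]; [exact: R0_0|case: eqP => _; [exact: R0_C|exact: R0_0]].
have bG : bounded L.+2 G.
  move=> w hw /=; rewrite ifF; last by apply/eqP; lia.
  by case: w hw => // i v /=; rewrite ltnS => hw; rewrite ifF //; apply/eqP; lia.
have dG w : (L <= size w)%N -> cf (dE G) w = cf f w.
  rewrite dE_cf leq_eqVlt => /predU1P[eL|hw].
    rewrite (gcP w).2 /= eL eqxx; congr (_ + _); apply: eq_bigr => i _.
    by rewrite ifF ?eqxx ?(mulrC (yy i)) //; apply/eqP; lia.
  rewrite bf // big1 => [|i _]; last by rewrite /= !ifF ?mulr0 //; apply/eqP; lia.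
  rewrite addr0 /= ifF; last by apply/eqP; lia.
  case: w hw => [|i v] hw; first by apply: shP.
  by case: ifP => _; [exact: stripC|apply: shP].
have [||g ng eg] := IH (f - dE G).
- by move=> w hw; rewrite cfB dG // subrr.
- move=> w; rewrite cfB; apply: R0_D => //; apply: R0_N.
  by have [|? _] := @nice_dE G; first by exists L.+2.
exists (g + G); last by rewrite dE_der.1 eg subrK.
by apply: niceD => //; exists L.+2.
Qed.

(** Linear independence of hyperlogarithms over rational functions. Once denominators are cleared,
    enough derivatives turn the coefficients of the longest words into constants, not all 0. One
    more derivative is then supported on shorter words, hence 0 by induction; read at the tail of a
    longest word it exhibits a derivative in [R0] with a nonzero residue. *)
Lemma taylor_eq0 f : nice f -> taylor f = 0 -> f = 0.
Proof.
move=> [L]; elim: L f => [|L IH] f bf rf tf; first by apply: shP => w; rewrite bf.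
suff top : forall w, size w = L -> cf f w = 0.
  by apply: IH => // w; rewrite leq_eqVlt => /predU1P[/esym /top //|]; apply: bf.
have ex (w : L.-tuple 'I_q) : exists Np : nat * {poly F}, emb (Wp ^+ Np.1) * cf f w = emb Np.2.
  by have [N [p e]] := R0_den (rf w); exists (N, p).
have [Np NpP] := choice ex.
pose N := \sum_w (Np w).1.
pose p w := Wp ^+ (N - (Np w).1) * (Np w).2.
have NpN w : ((Np w).1 <= N)%N by rewrite /N (bigD1 w) //= leq_addr.
have pP (w : L.-tuple 'I_q) : emb (Wp ^+ N) * cf f w = emb (p w).
  by rewrite /p rmorphM /= -NpP mulrA -rmorphM /= -exprD subnK.
have W0 : emb (Wp ^+ N) != 0.
  by apply/eqP => /emb_eq0 /eqP; rewrite expf_eq0 (negPf Wp_neq0) andbF.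
suff p0 : forall w, p w = 0.
  move=> w /eqP sw; have := pP (Tuple sw); rewrite p0 rmorph0 => /taylor_nzd [/eqP|//].
  by rewrite (negPf W0).
move=> w; apply: contrapT => /eqP pw0.
pose M := \max_w size (p w).
have [w0 w0M] : exists w0, size (p w0) = M.
  have : (0 < #|{: L.-tuple 'I_q}|)%N by apply/card_gt0P; exists w.
  by move=> c0; have [w0 e] := @bigop.eq_bigmax _ (fun w => size (p w)) c0; exists w0.
have M0 : (0 < M)%N.
  by apply: leq_trans (bigop.leq_bigmax w); rewrite size_poly_gt0.
pose h k := iter k dE (shC (emb (Wp ^+ N)) * f).
have h0E : h 0%N = shC (emb (Wp ^+ N)) * f by [].
have hd k : [/\ bounded L.+1 (h k), regular (h k), taylor (h k) = 0 &
    forall w : L.-tuple 'I_q, cf (h k) w = emb (p w)^`(k)].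
  elim: k => [|k [b r th hw]].
    split.
    - by move=> u hu; rewrite h0E shCM bf ?mulr0.
    - move=> u; rewrite h0E shCM; apply: R0_M => //.
      exact: R0_emb.
    - by rewrite h0E rmorphM /= tf mulr0.
    - by move=> u; rewrite h0E shCM pP.
  have nk : nice (h k) by exists L.+1.
  split.
  - move=> u hu; rewrite /h iterS dE_cf b // big1 => [|i _]; first by rewrite addr0; apply: shP.
    by rewrite b ?mulr0 //= ltnW.
  - by have [? _ ?] := nice_dE nk.
  - by rewrite /h iterS taylor_d -/(h k) th; apply: shP.
  - move=> u; rewrite /h iterS dE_cf -/(h k) hw emb_deriv derivnS big1 ?addr0 // => i _.
    by rewrite b ?mulr0 //= size_tuple.
have [b r th hw] := hd M.-1.
have szd u : (size (p u)^`(M.-1) <= 1)%N.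
  apply/leq_sizeP => j j1; rewrite coef_derivn nth_default ?mul0rn //.
  have := bigop.leq_bigmax (F := fun w => size (p w)) u; rewrite -/M; move: (size _) => k.
  by move: j1 M0; lia.
have hc u : cf (h M.-1) (tval u) = shC ((p u)^`(M.-1))`_0 by rewrite hw (size1_polyC (szd u)) embC coefC.
have dh0 : dE (h M.-1) = 0.
  apply: IH.
  - move=> u; rewrite leq_eqVlt => /predU1P[/esym/eqP su|hu].
      rewrite dE_cf -[u]/(tval (Tuple su)) hc stripC add0r big1 // => i _.
      by rewrite b ?mulr0 //= (eqP su).
    rewrite dE_cf b // big1 ?addr0; first by apply: shP.
    by move=> i _; rewrite b ?mulr0 //= ltnW.
  - by have [|? _ ?] := @nice_dE (h M.-1); first by exists L.+1.
  - by rewrite taylor_d th; apply: shP.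
have c0 : ((p w0)^`(M.-1))`_0 != 0.
  rewrite coef_derivn addn0 ffactnn -mulr_natr mulf_neq0 //.
    by rewrite -w0M -[_`_ _]/(lead_coef _) lead_coef_eq0 -size_poly_gt0 w0M.
  by rewrite pnatr_eq0 -lt0n fact_gt0.
(* For the empty word the nonzero constant is itself the value at 0 of an element with zero
   expansion. *)
case: w0 c0 hc {w0M} => -[|a v] sw c0 hc.
  have := congr1 (fun f => cf f [::]) th; rewrite -[cf _ _]/(cst (cf (h M.-1) [::])).
  by rewrite (hc (Tuple sw)) /= => /eqP; apply/negP.
have si i : size (i :: v) == L by [].
have := congr1 (fun f => cf f v) dh0; rewrite dE_cf cf0 => /eqP; rewrite addr_eq0 => /eqP e.
have res : dt (cf (h M.-1) v) = \sum_i shC (- ((p (Tuple (si i)))^`(M.-1))`_0) * yy i.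
  rewrite e.
  rewrite -sumrN; apply: eq_bigr => i _.
  by rewrite -[i :: v]/(tval (Tuple (si i))) hc rmorphN mulNr [yy i * _]mulrC.
have /eqP := R0_no_residue (r v) res a; rewrite oppr_eq0.
by rewrite (_ : Tuple (si a) = Tuple sw) ?(negPf c0) //; apply: val_inj.
Qed.

Lemma int_unique f g : nice f -> nice g -> dE f = dE g -> evE f = evE g -> f = g.
Proof.
move=> nf ng dfg efg; apply/eqP; rewrite -subr_eq0; apply/eqP/taylor_eq0; first exact: niceB.
apply: shunitP.
  by rewrite -[LHS]/(evE (f - g)) rmorphB /= efg subrr.
by rewrite -taylor_d (derB dE_der) dfg subrr rmorph0; apply: shP.
Qed.


Definition nicep : {pred E0} := fun f => `[< nice f >].
Lemma nicepP f : reflect (nice f) (f \in nicep). Proof. exact: asboolP. Qed.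
Fact nicep_subring : subring_closed nicep.
Proof.
split=> [|f g /nicepP hf /nicepP hg|f g /nicepP hf /nicepP hg]; apply/nicepP.
- exact: nice1.
- exact: niceB.
- exact: niceM.
Qed.
HB.instance Definition _ := GRing.isSubringClosed.Build E0 nicep nicep_subring.

Record hlog := Hlog {hval : E0; _ : hval \in nicep}.
HB.instance Definition _ := [isSub for hval].
HB.instance Definition _ := [Choice of hlog by <:].
HB.instance Definition _ := [SubChoice_isSubComNzRing of hlog by <:].


Local Notation H := hlog.
Local Notation val := hval.

Lemma hlog_nice (f : H) : nice (val f).
Proof. by case: f => f hf; apply/nicepP. Qed.
Definition mkh (f : sh 'I_q T) (hf : nice f) : H := Hlog (introT (nicepP f) hf).
Lemma hlogP (f g : H) : val f = val g -> f = g. Proof. exact: val_inj. Qed.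

Definition hlogk (c : F) : H := mkh (nice_shC (R0_C c)).
Fact hlogk_zmod : zmod_morphism hlogk.
Proof. by move=> a b; apply: hlogP; rewrite /= !rmorphB. Qed.
HB.instance Definition _ := GRing.isZmodMorphism.Build F H hlogk hlogk_zmod.
Fact hlogk_monoid : monoid_morphism hlogk.
Proof. by split=> [|a b]; apply: hlogP; rewrite /= ?rmorph1 ?rmorphM. Qed.
HB.instance Definition _ := GRing.isMonoidMorphism.Build F H hlogk hlogk_monoid.

Definition hlogd (f : H) : H := mkh (nice_dE (hlog_nice f)).
Definition hlogN i (f : H) : H := mkh (nice_rstrip i (hlog_nice f)).
Definition hlogev (f : H) : F := evE (val f).
Fact hlogev_zmod : zmod_morphism hlogev.
Proof. by move=> a b; rewrite /hlogev !rmorphB. Qed.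
HB.instance Definition _ := GRing.isZmodMorphism.Build H F hlogev hlogev_zmod.
Fact hlogev_monoid : monoid_morphism hlogev.
Proof. by split=> [|a b]; rewrite /hlogev ?rmorph1 ?rmorphM. Qed.
HB.instance Definition _ := GRing.isMonoidMorphism.Build H F hlogev hlogev_monoid.
Definition hlogT (f : H) : T := taylor (val f).
Fact hlogT_zmod : zmod_morphism hlogT.
Proof. by move=> a b; rewrite /hlogT !rmorphB. Qed.
HB.instance Definition _ := GRing.isZmodMorphism.Build H T hlogT hlogT_zmod.
Fact hlogT_monoid : monoid_morphism hlogT.
Proof. by split=> [|a b]; rewrite /hlogT ?rmorph1 ?rmorphM. Qed.
HB.instance Definition _ := GRing.isMonoidMorphism.Build H T hlogT hlogT_monoid.

Lemma hlog_int (f : H) : exists g : H, hlogd g = f /\ hlogev g = 0.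
Proof.
have [g ng eg] := nice_int (hlog_nice f).
exists (mkh ng - hlogk (evE g)); split.
  apply: hlogP; rewrite /= (derB dE_der) eg; suff -> : dE (shC (shC (evE g))) = 0 by rewrite subr0.
  apply: shP => w; rewrite dE_cf big1 => [|i _]; last by rewrite /= mulr0.
  by rewrite addr0; case: w => [|i w]; [rewrite /= stripC|apply: shP].
by rewrite rmorphB /= /hlogev /= /evE /= /cst /= subrr.
Qed.

Definition hlogI (f : H) : H := projT1 (cid (hlog_int f)).
Lemma hlogIP f : hlogd (hlogI f) = f /\ hlogev (hlogI f) = 0.
Proof. exact: (projT2 (cid (hlog_int f))). Qed.

Lemma hlogT_inj f : hlogT f = 0 -> f = 0.
Proof. by move=> h; apply: hlogP; apply: taylor_eq0 => //; exact: hlog_nice. Qed.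

Definition hlogy i : H := mkh (nice_shC (R0_yX i 1)).
Definition hlogt : H := mkh (nice_shC (R0_t 1)).

(** The logarithm with derivative y j. As [hlogI] only comes from an existence statement, this
    explicit primitive is what computes its monodromy. *)
Definition letter j : sh 'I_q T := Sh (fun w => if w is [:: i] then (i == j)%:R else 0).
Lemma nice_letter j : nice (letter j).
Proof.
exists 2%N => [[|i [|]]|[|i [|k w]]] //=; try exact: R0_0.
by case: eqP => _; [exact: R0_1|exact: R0_0].
Qed.
Lemma dE_letter j : dE (letter j) = shC (yy j).
Proof.
apply: shP => w; rewrite dE_cf; case: w => [|i [|k w]] /=.
- rewrite (bigD1 j) //= eqxx mulr1 big1 ?addr0; first by rewrite (der0 taylor_der) add0r.
  by move=> i /negPf ->; rewrite mulr0.
- rewrite big1 ?addr0; last by move=> ? _; rewrite mulr0.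
  by case: eqP => _; [exact: (der1 taylor_der)|exact: (der0 taylor_der)].
- rewrite big1 ?addr0; last by move=> ? _; rewrite mulr0.
  exact: (der0 taylor_der).
Qed.

Definition hyperlog_build : hyperlog tm.
Proof.
refine (@Hyperlog F q tm H hlogk hlogd hlogN hlogev hlogy hlogt hlogI hlogT
  _ _ _ _ _ _ _ _ _ _ _ _ _ _ _ _ _).
- by split=> [f g|f g]; apply: hlogP; [exact: dE_der.1|exact: dE_der.2].
- by move=> i; split=> [f g|f g]; apply: hlogP; [exact: (rstrip_der T i).1|exact: (rstrip_der T i).2].
- by move=> i f; apply: hlogP; rewrite /= dE_rstrip.
- move=> c; apply: hlogP => /=; apply: shP => w; rewrite dE_cf big1 => [|i _]; last by rewrite /= mulr0.
  by rewrite addr0; case: w => [|i w]; [rewrite /= stripC|apply: shP].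
- by move=> i c; apply: hlogP; rewrite /= rstripC.
- apply: hlogP => /=; apply: shP => w; rewrite dE_cf big1 => [|i _]; last by rewrite /= mulr0.
  by rewrite addr0; case: w => [|i w]; [rewrite /= expr1 strip_gen|apply: shP].
- by move=> i; apply: hlogP; rewrite /= rstripC.
- by move=> i j; apply: hlogP; rewrite /= rstripC.
- by move=> i; apply: hlogP; rewrite /= -rmorphB -rmorphM /= !expr1 yyK // rmorph1.
- by move=> f; have [] := hlogIP f.
- by move=> f; have [] := hlogIP f.
- by [].
- by [].
- move=> i j; rewrite (_ : hlogI (hlogy j) = mkh (nice_letter j)).
    have -> : (i == j)%:R = hlogk (i == j)%:R by rewrite rmorph_nat.
    apply: hlogP; apply: shP => -[|k w] /=; first by rewrite rmorph_nat.
    by case: w.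
  apply: hlogP; have [e1 e2] := hlogIP (hlogy j).
  apply: (int_unique); [exact: hlog_nice|exact: nice_letter| |].
    by rewrite dE_letter -[LHS]/(val (hlogd _)) e1 /= expr1.
  by [].
- by move=> f; rewrite -taylor_d.
- by [].
- exact: hlogT_inj.
Defined.
End Taylor.

(** * Power series in the perturbation parameter *)

Section Series.
Variables (F : numFieldType) (q : nat) (tm : 'I_q -> F) (S : hyperlog tm).
Definition epsser := sh unit F.
HB.instance Definition _ := GRing.ComNzRing.on epsser.
Definition solser := sh unit S.
HB.instance Definition _ := GRing.ComNzRing.on solser.

Definition dB : solser -> solser := shmap (@hd _ _ _ S).
Definition NB i : solser -> solser := shmap (@hN _ _ _ S i).
Definition IB : solser -> solser := shmap (@hI _ _ _ S).
Definition evB : solser -> epsser := shmap (hev S).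
Fact evB_zmod : zmod_morphism evB. Proof. by move=> a b; rewrite /evB !rmorphB. Qed.
HB.instance Definition _ := GRing.isZmodMorphism.Build solser epsser evB evB_zmod.
Fact evB_monoid : monoid_morphism evB.
Proof. by split=> [|a b]; rewrite /evB ?rmorph1 ?rmorphM. Qed.
HB.instance Definition _ := GRing.isMonoidMorphism.Build solser epsser evB evB_monoid.
Definition kB : epsser -> solser := shmap (hk S).
Fact kB_zmod : zmod_morphism kB. Proof. by move=> a b; rewrite /kB !rmorphB. Qed.
HB.instance Definition _ := GRing.isZmodMorphism.Build epsser solser kB kB_zmod.
Fact kB_monoid : monoid_morphism kB.
Proof. by split=> [|a b]; rewrite /kB ?rmorph1 ?rmorphM. Qed.
HB.instance Definition _ := GRing.isMonoidMorphism.Build epsser solser kB kB_monoid.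
Definition TB : solser -> (sh unit (sh unit F)) := shmap (hT S).
Fact TB_zmod : zmod_morphism TB. Proof. by move=> a b; rewrite /TB !rmorphB. Qed.
HB.instance Definition _ := GRing.isZmodMorphism.Build solser (sh unit (sh unit F)) TB TB_zmod.
Fact TB_monoid : monoid_morphism TB.
Proof. by split=> [|a b]; rewrite /TB ?rmorph1 ?rmorphM. Qed.
HB.instance Definition _ := GRing.isMonoidMorphism.Build solser (sh unit (sh unit F)) TB TB_monoid.
Definition eB : S -> solser := shC.
Fact eB_zmod : zmod_morphism eB. Proof. by move=> a b; rewrite /eB !rmorphB. Qed.
HB.instance Definition _ := GRing.isZmodMorphism.Build S solser eB eB_zmod.
Fact eB_monoid : monoid_morphism eB.
Proof. by split=> [|a b]; rewrite /eB ?rmorph1 ?rmorphM. Qed.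
HB.instance Definition _ := GRing.isMonoidMorphism.Build S solser eB eB_monoid.
Definition cB : F -> solser := fun c => eB (hk S c).
Fact cB_zmod : zmod_morphism cB. Proof. by move=> a b; rewrite /cB !rmorphB. Qed.
HB.instance Definition _ := GRing.isZmodMorphism.Build F solser cB cB_zmod.
Fact cB_monoid : monoid_morphism cB.
Proof. by split=> [|a b]; rewrite /cB ?rmorph1 ?rmorphM. Qed.
HB.instance Definition _ := GRing.isMonoidMorphism.Build F solser cB cB_monoid.
Definition eps : solser := gen.
Definition tB : solser := eB (ht S).

Lemma dB_der : derivation dB. Proof. exact/shmap_der/hd_der. Qed.
Lemma NB_der i : derivation (NB i). Proof. exact/shmap_der/hN_der. Qed.
Lemma dB_k c : dB (kB c) = 0. Proof. by apply: shP => w; exact: hdk. Qed.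
Lemma NB_k i c : NB i (kB c) = 0. Proof. by apply: shP => w; exact: hNk. Qed.
Lemma dB_I f : dB (IB f) = f. Proof. by apply: shP => w; exact: hdI. Qed.
Lemma evB_I f : evB (IB f) = 0. Proof. by apply: shP => w; exact: hevI. Qed.
Lemma evB_k c : evB (kB c) = c. Proof. by apply: shP => w; exact: hevk. Qed.
Lemma kB_C c : kB (shC c) = cB c. Proof. exact: shmapC. Qed.
Lemma kB_gen : kB gen = eps.
Proof. by apply: shP => -[|[] [|u w]] //=; rewrite ?rmorph0 ?rmorph1. Qed.
Lemma evB_gen : evB eps = gen. Proof. by rewrite -kB_gen evB_k. Qed.
Lemma dB_c c : dB (cB c) = 0. Proof. by rewrite -kB_C dB_k. Qed.
Lemma NB_c i c : NB i (cB c) = 0. Proof. by rewrite -kB_C NB_k. Qed.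
Lemma evB_c c : evB (cB c) = shC c. Proof. by rewrite -kB_C evB_k. Qed.
Lemma dB_eps : dB eps = 0. Proof. by rewrite -kB_gen dB_k. Qed.
Lemma NB_eps i : NB i eps = 0. Proof. by rewrite -kB_gen NB_k. Qed.
Lemma dB_e f : dB (eB f) = eB (hd f). Proof. exact/shmap_derC/hd_der. Qed.
Lemma NB_e i f : NB i (eB f) = eB (hN i f). Proof. exact/shmap_derC/hN_der. Qed.
Lemma evB_e f : evB (eB f) = shC (hev S f). Proof. exact: shmapC. Qed.
Lemma dB_t : dB tB = 1. Proof. by rewrite dB_e hdt rmorph1. Qed.
Lemma NB_t i : NB i tB = 0. Proof. by rewrite NB_e hNt rmorph0. Qed.
Lemma evB_t : evB tB = 0. Proof. by rewrite evB_e hevt rmorph0. Qed.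

Lemma dB_kM c f : dB (kB c * f) = kB c * dB f.
Proof. by rewrite (derM dB_der) dB_k mul0r add0r. Qed.
Lemma NB_kM i c f : NB i (kB c * f) = kB c * NB i f.
Proof. by rewrite (derM (NB_der i)) NB_k mul0r add0r. Qed.
Lemma dB_cM c f : dB (cB c * f) = cB c * dB f.
Proof. by rewrite -kB_C dB_kM. Qed.
Lemma NB_cM i c f : NB i (cB c * f) = cB c * NB i f.
Proof. by rewrite -kB_C NB_kM. Qed.
Lemma dB_epsM k f : dB (eps ^+ k * f) = eps ^+ k * dB f.
Proof. by rewrite -kB_gen -rmorphXn dB_kM. Qed.
Lemma NB_epsM i k f : NB i (eps ^+ k * f) = eps ^+ k * NB i f.
Proof. by rewrite -kB_gen -rmorphXn NB_kM. Qed.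

Lemma TB_inj f : TB f = 0 -> f = 0.
Proof.
move=> Tf; apply: shP => w; apply: (@hT_inj _ _ _ S).
by have := congr1 (fun f => cf f w) Tf.
Qed.

Lemma hflat (f : S) : (forall k, hev S (iter k (@hd _ _ _ S) f) = 0) -> f = 0.
Proof.
move=> h; apply: (@hT_inj _ _ _ S); apply: coP => k; rewrite coE [RHS]/=.
suff -> : iter k (strip tt) (hT S f) = hT S (iter k (@hd _ _ _ S) f).
  by rewrite hTev h; elim: k.
by elim: k => //= k ->; rewrite hTd.
Qed.
Lemma flat f : (forall k, evB (iter k dB f) = 0) -> f = 0.
Proof.
move=> h; apply: shP => w; apply: hflat => k.
have := congr1 (fun f => cf f w) (h k); rewrite cf0 => <- /=; congr (hev S _).
by elim: k => //= k ->.
Qed.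
Lemma const_flat f : dB f = 0 -> evB f = 0 -> f = 0.
Proof.
move=> df ef; apply: flat => -[|k] //; rewrite iterSr df.
suff -> : iter k dB 0 = 0 by rewrite rmorph0.
by elim: k => //= k ->; rewrite (der0 dB_der).
Qed.
Lemma primitive_eq f g : dB f = dB g -> evB f = evB g -> f = g.
Proof.
move=> d e; apply/eqP; rewrite -subr_eq0; apply/eqP/const_flat.
  by rewrite (derB dB_der) d subrr.
by rewrite rmorphB /= e subrr.
Qed.
Lemma const_eq f c : dB f = 0 -> evB f = c -> f = kB c.
Proof. by move=> d e; apply: primitive_eq; rewrite ?dB_k // evB_k. Qed.

(** The quotient u / qq has derivative 0 and vanishes at t = 0. To avoid the division, qq^k times
    the k-th derivative of u is shown to be a multiple of u; hence all derivatives of u vanish at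
    0. *)
Lemma proportional_const u qq : qq * dB u = u * dB qq -> evB u = 0 ->
  (forall x y : epsser, x * y = 0 -> x = 0 \/ y = 0) -> evB qq <> 0 -> u = 0.
Proof.
move=> e u0 nzd q0; apply: flat => k.
have [v hv] : exists v, qq ^+ k * iter k dB u = u * v.
  elim: k => [|k [v hv]]; first by exists 1; rewrite mulr1 expr0 mul1r.
  exists (dB qq * v + qq * dB v - k%:R * dB qq * v).
  have h : dB (qq ^+ k * iter k dB u) = dB (u * v) by rewrite hv.
  move: h; rewrite !(derM dB_der) -iterS => h.
  have dqk : qq * dB (qq ^+ k) = k%:R * dB qq * qq ^+ k.
    case: k {hv h} => [|k]; first by rewrite expr0 (der1 dB_der) mulr0 !mul0r.
    by rewrite (derX dB_der) exprS; ring.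
  set X := iter k dB u in h hv *; set Y := qq ^+ k in h hv dqk *.
  have -> : qq ^+ k.+1 * iter k.+1 dB u =
      qq * (dB Y * X + Y * iter k.+1 dB u) - (qq * dB Y) * X.
    by rewrite exprS -/Y; ring.
  have -> : (qq * dB Y) * X = k%:R * dB qq * (u * v) by rewrite dqk -hv; ring.
  rewrite h; have -> : qq * (dB u * v + u * dB v) = (qq * dB u) * v + qq * u * dB v by ring.
  by rewrite e; ring.
have := congr1 evB hv; rewrite !rmorphM /= u0 mul0r rmorphXn => /nzd [] //.
move=> h; case: q0; elim: k h {v hv} => [|k IH].
  by rewrite expr0 => /eqP; rewrite oner_eq0.
by rewrite exprS => /nzd[|/IH].
Qed.

Lemma agree_map (R R' : comNzRingType) (h : R -> R') k (f g : sh unit R) :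
  agree k f g -> agree k (shmap h f) (shmap h g).
Proof. by move=> fg w hw /=; rewrite fg. Qed.
End Series.
Arguments dB {F q tm S} f : simpl never.
Arguments NB {F q tm S} i f : simpl never.
Arguments IB {F q tm S} f : simpl never.
Arguments evB {F q tm S} f : simpl never.
Arguments kB {F q tm} S f : simpl never.
Arguments TB {F q tm S} f : simpl never.
Arguments eB {F q tm S} f : simpl never.
Arguments cB {F q tm} S c : simpl never.
Arguments eps {F q tm S} : simpl never.
Arguments tB {F q tm S} : simpl never.

(** * Congruences modulo powers of eps, and monodromy of some primitives *)

Section Monodromy.
Variables (F : numFieldType) (q : nat) (tm : 'I_q -> F) (S : hyperlog tm).
Local Notation solser := (solser S).
Local Notation epsser := (epsser F).
Local Notation cB := (cB S).
Local Notation kB := (kB S).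
Local Notation hk := (hk S).
Local Notation hev := (hev S).

Lemma IB_eq (f g : solser) : dB g = f -> IB f = g - kB (evB g).
Proof.
move=> e; apply: primitive_eq; last by rewrite evB_I rmorphB /= evB_k subrr.
by rewrite dB_I (derB (dB_der S)) dB_k subr0.
Qed.
Lemma NI_eq b (f g : solser) : dB g = f -> NB b (IB f) = NB b g.
Proof. by move=> /IB_eq ->; rewrite (derB (NB_der S b)) NB_k subr0. Qed.
Lemma IB_D (f g : solser) : IB (f + g) = IB f + IB g.
Proof.
rewrite (@IB_eq _ (IB f + IB g)); last by rewrite (dB_der S).1 !dB_I.
by rewrite rmorphD /= !evB_I addr0 rmorph0 subr0.
Qed.
Lemma IB_kM c (f : solser) : IB (kB c * f) = kB c * IB f.
Proof.
rewrite (@IB_eq _ (kB c * IB f)); last by rewrite dB_kM dB_I.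
by rewrite rmorphM /= evB_I mulr0 rmorph0 subr0.
Qed.
Lemma IB_cM c (f : solser) : IB (cB c * f) = cB c * IB f.
Proof. by rewrite -kB_C IB_kM. Qed.
Lemma IB_epsM k (f : solser) : IB (eps ^+ k * f) = eps ^+ k * IB f.
Proof. by rewrite -kB_gen -rmorphXn IB_kM. Qed.
Lemma IB_0 : IB (0 : solser) = 0.
Proof. by have := IB_kM 0 0; rewrite rmorph0 !mul0r. Qed.
Lemma IB_N (f : solser) : IB (- f) = - IB f.
Proof. by apply/eqP; rewrite -addr_eq0 -IB_D addNr IB_0. Qed.
Lemma IB_sum J (r : seq J) (Q : pred J) (G : J -> solser) :
  IB (\sum_(i <- r | Q i) G i) = \sum_(i <- r | Q i) IB (G i).
Proof. exact: (big_morph IB IB_D IB_0). Qed.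

(** Unlike [agree], this congruence provides a quotient by eps^k, which is what allows eps^9 to be
    factored out at the end. *)
Definition eqm k (x y : solser) := exists z, x = y + eps ^+ k * z.
Lemma eqm_refl k x : eqm k x x. Proof. by exists 0; rewrite mulr0 addr0. Qed.
Lemma eqmD k x x' y y' : eqm k x x' -> eqm k y y' -> eqm k (x + y) (x' + y').
Proof. by move=> [z ->] [w ->]; exists (z + w); ring. Qed.
Lemma eqmN k x x' : eqm k x x' -> eqm k (- x) (- x').
Proof. by move=> [z ->]; exists (- z); ring. Qed.
Lemma eqmB k x x' y y' : eqm k x x' -> eqm k y y' -> eqm k (x - y) (x' - y').
Proof. by move=> h1 h2; apply: eqmD => //; apply: eqmN. Qed.
Lemma eqmM k x x' y y' : eqm k x x' -> eqm k y y' -> eqm k (x * y) (x' * y').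
Proof. by move=> [z ->] [w ->]; exists (x' * w + z * y' + eps ^+ k * z * w); ring. Qed.
Lemma eqmMl k c y y' : eqm k y y' -> eqm k (c * y) (c * y').
Proof. by apply: eqmM; apply: eqm_refl. Qed.
Lemma eqm_sum k J (r : seq J) (Q : pred J) (G H : J -> solser) :
  (forall i, eqm k (G i) (H i)) -> eqm k (\sum_(i <- r | Q i) G i) (\sum_(i <- r | Q i) H i).
Proof.
move=> h; elim: r => [|i r IH]; first by rewrite !big_nil; exact: eqm_refl.
by rewrite !big_cons; case: ifP => // _; apply: eqmD.
Qed.
Lemma eqm_trans k x y z : eqm k x y -> eqm k y z -> eqm k x z.
Proof. by move=> [u ->] [v ->]; exists (v + u); ring. Qed.
Lemma eqm_eps k p x y : eqm k x y -> eqm (p + k) (eps ^+ p * x) (eps ^+ p * y).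
Proof. by move=> [u ->]; exists u; rewrite exprD; ring. Qed.
Lemma eqm_le k l x y : (l <= k)%N -> eqm k x y -> eqm l x y.
Proof. by move=> lk [u ->]; exists (eps ^+ (k - l) * u); rewrite mulrA -exprD subnKC. Qed.
Lemma eqm_N k b x y : eqm k x y -> eqm k (NB b x) (NB b y).
Proof. by move=> [u ->]; exists (NB b u); rewrite (NB_der S b).1 NB_epsM. Qed.
Lemma eqm_I k x y : eqm k x y -> eqm k (IB x) (IB y).
Proof. by move=> [u ->]; exists (IB u); rewrite IB_D IB_epsM. Qed.
Lemma eqm_0 k z : eqm k (eps ^+ k * z) 0. Proof. by exists z; rewrite add0r. Qed.

Local Notation y i := (hy S i).
Local Notation dh := (@hd _ _ _ S).
Let dhD := hd_der S.

Lemma hy_d i : dh (y i) = - y i ^+ 2.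
Proof.
have := congr1 dh (hyK S i); rewrite (derM dhD) (derB dhD) hdk hdt subr0 mul1r (der1 dhD).
move=> /(congr1 ( *%R (y i))); rewrite mulr0 mulrDr mulrA [y i * (_ - _)]mulrC hyK mul1r => /eqP.
by rewrite addrC addr_eq0 => /eqP ->; rewrite expr2.
Qed.
Lemma hyM i j : tm i != tm j -> y i * y j = hk (tm i - tm j)^-1 * (y i - y j).
Proof.
move=> ij; have tij : tm i - tm j != 0 by rewrite subr_eq0.
have e : y i - y j = hk (tm i - tm j) * (y i * y j).
  rewrite -{1}[y i]mulr1 -{1}(hyK S j) -{2}[y j]mulr1 -{1}(hyK S i) rmorphB /=; ring.
by rewrite e mulrA -rmorphM /= mulVf // rmorph1 mul1r.
Qed.
Lemma hev_y i : hev (y i) = - (tm i)^-1.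
Proof.
have := congr1 hev (hyK S i); rewrite rmorphM rmorphB rmorph1 /= hevt hevk sub0r => e.
have t0 : tm i != 0.
  by apply: contra_eq_neq e => ->; rewrite oppr0 mul0r eq_sym oner_neq0.
by apply: (mulfI t0); rewrite mulrN divff // -[1]e mulNr opprK.
Qed.

Lemma hk2V : 2 * hk 2^-1 = 1.
Proof.
have -> : 2 = hk 2 by rewrite rmorph_nat.
by rewrite -rmorphM divff ?rmorph1 // pnatr_eq0.
Qed.

Lemma dB_yX i k : dB (eB (y i ^+ k.+1)) = - (k.+1)%:R * eB (y i ^+ k.+2) :> solser.
Proof.
rewrite dB_e (derX dhD) hy_d mulrN -mulrA -exprD addn2 !rmorphN rmorphM rmorph_nat /=; ring.
Qed.

Lemma NI_y2 b i : NB b (IB (eB (y i ^+ 2) : solser)) = 0.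
Proof.
rewrite (@NI_eq _ _ (- eB (y i ^+ 1))); last by rewrite (derN (dB_der S)) dB_yX; ring.
by rewrite (derN (NB_der S b)) NB_e expr1 hNy rmorph0 oppr0.
Qed.
Lemma cB2 : 2 * cB 2^-1 = 1.
Proof.
have -> : 2 = cB 2 by rewrite rmorph_nat.
by rewrite -rmorphM divff ?rmorph1 // pnatr_eq0.
Qed.
Lemma NB_yX b i k : NB b (eB (y i ^+ k) : solser) = 0.
Proof.
case: k => [|k]; first by rewrite expr0 rmorph1 (der1 (NB_der S b)).
by rewrite NB_e (derX (hN_der S b)) hNy mulr0 rmorph0.
Qed.
Lemma NI_y3 b i : NB b (IB (eB (y i ^+ 3) : solser)) = 0.
Proof.
rewrite (@NI_eq _ _ (- (cB 2^-1 * eB (y i ^+ 2)))); first by rewrite (derN (NB_der S b)) NB_cM NB_yX mulr0 oppr0.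
rewrite (derN (dB_der S)) dB_cM dB_yX.
by transitivity ((2 * cB 2^-1) * eB (y i ^+ 3)); [ring|rewrite cB2 mul1r].
Qed.
Lemma NI_ty3 b i : NB b (IB (tB * eB (y i ^+ 3) : solser)) = 0.
Proof.
have -> : (tB * eB (y i ^+ 3) : solser) = eB (y i ^+ 2) + cB (tm i) * eB (y i ^+ 3).
  rewrite -[cB _]/(eB (hk (tm i))) -[tB]/(eB (ht S)) -!rmorphM -rmorphD; congr eB.
  by rewrite -[X in X + _]mul1r -(hyK S i); ring.
by rewrite IB_D IB_cM (NB_der S b).1 NB_cM NI_y2 NI_y3 mulr0 addr0.
Qed.

Definition nu b i j : S :=
  - hk 2^-1 * (y i ^+ 2 * (j == b)%:R + hk (((i == b)%:R - (j == b)%:R) * (tm i - tm j) ^- 2)).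

Hypothesis tm_inj : injective tm.

(** Integration by parts leaves the primitive of y i^2 y j, which partial fractions reduce to y i
    and to logarithms. The case i = j is covered by the same formula, because the difference of
    Kronecker symbols vanishes together with tm i - tm j. *)
Lemma NI_y3L b i j : NB b (IB (eB (y i ^+ 3 * hI (y j)) : solser)) = eB (nu b i j).
Proof.
have dN := hN_der S b.
have NL k : hN b (hI (y k)) = (k == b)%:R by rewrite hNI eq_sym.
have hN_M0 c f : hN b (hk c * f) = hk c * hN b f by rewrite (derM dN) hNk mul0r add0r.
have hd_M0 c f : dh (hk c * f) = hk c * dh f by rewrite (derM dhD) hdk mul0r add0r.
have hNyX k l : hN b (y k ^+ l.+1) = 0 by rewrite (derX dN) hNy mulr0.
have hdyX k l : dh (y k ^+ l.+1) = - (l.+1%:R * y k ^+ l.+2).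
  by rewrite (derX dhD) hy_d mulrN -mulrA -exprD addn2.
have [g dg Ng] : exists2 g : S, dh g = y i ^+ 2 * y j &
    hN b g = - hk (((i == b)%:R - (j == b)%:R) * (tm i - tm j) ^- 2).
  have [eij|nij] := eqVneq i j.
    exists (- hk 2^-1 * y i ^+ 2); last first.
      by rewrite eij subrr mul0r rmorph0 oppr0 mulNr (derN dN) hN_M0 hNyX mulr0 oppr0.
    rewrite eij mulNr (derN dhD) hd_M0 hdyX.
    by transitivity ((2 * hk 2^-1) * y j ^+ 3); [ring|rewrite hk2V mul1r exprSr].
  have tij : tm i != tm j by rewrite (inj_eq tm_inj).
  set D := tm i - tm j.
  exists (- (hk D^-1 * y i ^+ 1) - hk (D ^- 2) * (hI (y i) - hI (y j))); last first.
    rewrite (derB dN) (derN dN) !hN_M0 hNyX mulr0 oppr0 sub0r (derB dN) !NL.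
    by rewrite rmorphM rmorphB !rmorph_nat /= mulrC.
  have h := hyM tij; rewrite -/D in h.
  rewrite (derB dhD) (derN dhD) !hd_M0 hdyX (derB dhD) !hdI.
  have -> : y i ^+ 2 * y j = y i * (y i * y j) by ring.
  rewrite h; have -> : y i * (hk D^-1 * (y i - y j)) = hk D^-1 * (y i ^+ 2 - y i * y j) by ring.
  by rewrite h -exprVn rmorphXn /=; ring.
rewrite (@NI_eq _ _ (eB (- hk 2^-1 * (y i ^+ 2 * hI (y j) - g)))); last first.
  rewrite dB_e; congr eB; rewrite mulNr (derN dhD) hd_M0 (derB dhD) (derM dhD) dg hdyX hdI.
  by transitivity ((2 * hk 2^-1) * (y i ^+ 3 * hI (y j))); [ring|rewrite hk2V mul1r].
rewrite NB_e; congr eB; rewrite /nu !mulNr (derN dN) hN_M0 (derB dN) (derM dN) hNyX NL Ng.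
by rewrite mul0r add0r opprK.
Qed.
End Monodromy.

(** * The perturbed collinear motion *)

Section NBodySolution.
Variables (F : numFieldType) (q : nat) (tm : 'I_q -> F) (S : hyperlog tm).
Local Notation solser := (solser S).
Local Notation epsser := (epsser F).
Local Notation cB := (cB S).
Local Notation kB := (kB S).

Variables (I P : finType) (chi : P -> I -> F) (m : I -> F) (mm : P -> F).
Hypothesis m0 : forall i, m i != 0.
Variables (al be : I -> F) (s : P -> F) (lam : P -> 'I_q).
Definition pair_diff (A : comNzRingType) (k : F -> A) (f : I -> A) (e : P) : A := \sum_i k (chi e i) * f i.
Local Notation ae := (pair_diff id al).
Local Notation bee := (pair_diff id be).
Hypotheses (s2 : forall e, s e * s e = 1) (be0 : forall e, bee e != 0)
  (tmE : forall e, ae e = - bee e * tm (lam e)).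
Variables (rh ph : I -> 'I_2 -> epsser).

Definition x0 e : solser := cB (bee e) * (tB - cB (tm (lam e))).
Definition zz e : solser := cB (bee e)^-1 * eB (hy S (lam e)).
Lemma x0K e : x0 e * zz e = 1.
Proof.
rewrite /x0 /zz mulrACA -rmorphM divff // rmorph1 mul1r.
have -> : cB (tm (lam e)) = eB (hk S (tm (lam e))) by [].
by rewrite -rmorphB -rmorphM hyK rmorph1.
Qed.

(** The unknown [Pi] is the part of the rescaled momenta created by the forces, divided by eps^3.
    The series [rh] and [ph] are corrections of the initial data from order eps^2 on; they will put
    the motion on the prescribed level and at a generic place in it. *)
Definition rhat (Pi : I -> 'I_2 -> solser) i a : solser :=
  kB (rh i a) + cB (m i)^-1 * (tB * kB (ph i a) + eps * IB (Pi i a)).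
Definition rho Pi i (a : 'I_2) : solser :=
  (if a == 0 then cB (al i) + cB (be i) * tB else 0) + eps ^+ 2 * rhat Pi i a.
Definition pii (Pi : I -> 'I_2 -> solser) i (a : 'I_2) : solser :=
  (if a == 0 then cB (m i * be i) else 0) + eps ^+ 2 * (kB (ph i a) + eps * Pi i a).
Definition iot (ih : P -> solser) e : solser := cB (s e) * zz e + eps ^+ 2 * ih e.
Definition del (dh : P -> solser) e : solser := cB (s e) * x0 e + eps ^+ 2 * dh e.
Definition rlB (f : I -> 'I_2 -> solser) e a : solser := pair_diff cB (fun i => f i a) e.
Definition force Pi ih i a : solser :=
  - \sum_e cB (mm e * chi e i) * iot ih e ^+ 3 * rlB (rho Pi) e a.
(** The equation [del]^2 = squared separation, divided by eps^2 and solved for its term linear in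
    [dh], with zz = 1 / x0 and s^2 = 1. *)
Definition newdel Pi (dh : P -> solser) e : solser :=
  cB (s e) * zz e * (x0 e * rlB (rhat Pi) e 0 +
    cB 2^-1 * (eps ^+ 2 * (rlB (rhat Pi) e 0 ^+ 2 + rlB (rhat Pi) e 1 ^+ 2 - dh e ^+ 2))).
(** The equation [iot] * [del] = 1 solved in the same way. In the term without a factor eps,
    [newdel] replaces [dh e]: otherwise the system would not be strictly causal. *)
Definition newiot Pi dh (ih : P -> solser) e : solser :=
  - (cB (s e) * zz e * (cB (s e) * zz e * newdel Pi dh e + eps ^+ 2 * (ih e * dh e))).

Lemma agree_eps p k (f g : solser) : agree k f g -> agree k.+1 (eps ^+ p.+1 * f) (eps ^+ p.+1 * g).
Proof.
move=> fg; have := agree_genX (p := p.+1) fg => h w hw; apply: h.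
by apply: leq_trans hw _; rewrite addSn ltnS leq_addl.
Qed.

Lemma agree_rl k (f g : I -> 'I_2 -> solser) e a : (forall i, agree k (f i a) (g i a)) ->
  agree k (rlB f e a) (rlB g e a).
Proof. by move=> h; apply: agree_sum => i; apply: agreeM; [exact: agree_refl|exact: h]. Qed.

Section Causal.
Variables (k : nat) (Pi Pi' : I -> 'I_2 -> solser) (dh dh' ih ih' : P -> solser).
Hypotheses (hPi : forall i a, agree k (Pi i a) (Pi' i a))
  (hd : forall e, agree k (dh e) (dh' e)) (hi : forall e, agree k (ih e) (ih' e)).

Lemma agree_rhat i a : agree k.+1 (rhat Pi i a) (rhat Pi' i a).
Proof.
apply: agreeD; first exact: agree_refl.
apply: agreeM; first exact: agree_refl.
apply: agreeD; first exact: agree_refl.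
by rewrite -(expr1 eps); apply: agree_eps; apply: agree_map.
Qed.
Lemma agree_rho i a : agree k.+1 (rho Pi i a) (rho Pi' i a).
Proof.
apply: agreeD; first exact: agree_refl.
by apply: agree_eps; apply: agreeW; apply: agree_rhat.
Qed.
Lemma agree_force i a : agree k.+1 (force Pi ih i a) (force Pi' ih' i a).
Proof.
apply: agreeN; apply: agree_sum => e; apply: agreeM.
  apply: agreeM; first exact: agree_refl.
  apply: agreeX; apply: agreeD; first exact: agree_refl.
  exact: agree_eps.
by apply: agree_rl => j; apply: agree_rho.
Qed.
Lemma agree_newdel e : agree k.+1 (newdel Pi dh e) (newdel Pi' dh' e).
Proof.
have hr a : agree k.+1 (rlB (rhat Pi) e a) (rlB (rhat Pi') e a).
  by apply: agree_rl => i; apply: agree_rhat.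
apply: agreeM; first exact: agree_refl.
apply: agreeD; first by apply: agreeM => //; exact: agree_refl.
apply: agreeM; first exact: agree_refl.
apply: agree_eps; apply: agreeB; last exact: agreeX.
by apply: agreeD; apply: agreeX; apply: agreeW.
Qed.
Lemma agree_newiot e : agree k.+1 (newiot Pi dh ih e) (newiot Pi' dh' ih' e).
Proof.
apply: agreeN; apply: agreeM; first exact: agree_refl.
apply: agreeD; last by apply: agree_eps; apply: agreeM.
by apply: agreeM; [exact: agree_refl|exact: agree_newdel].
Qed.
End Causal.

Lemma solution_exists : exists (Pi : I -> 'I_2 -> solser) (dh ih : P -> solser),
  [/\ forall i a, Pi i a = IB (force Pi ih i a),
      forall e, dh e = newdel Pi dh e & forall e, ih e = newiot Pi dh ih e].
Proof.
pose X := ((I * 'I_2) + (P + P))%type.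
pose Psi (Y : X -> solser) (x : X) : solser :=
  let Pi i a := Y (inl (i, a)) in
  let dh e := Y (inr (inl e)) in
  let ih e := Y (inr (inr e)) in
  match x with
  | inl ia => IB (force Pi ih ia.1 ia.2)
  | inr (inl e) => newdel Pi dh e
  | inr (inr e) => newiot Pi dh ih e
  end.
have [|Y hY] := @strict_causal_fixpoint S X Psi.
  move=> k Y Y' h [[i a]|[e|e]].
  - by apply: agree_map; apply: agree_force.
  - exact: agree_newdel.
  - exact: agree_newiot.
exists (fun i a => Y (inl (i, a))), (fun e => Y (inr (inl e))), (fun e => Y (inr (inr e))).
split.
- by move=> i a; rewrite {1}hY.
- by move=> e; rewrite {1}hY.
- by move=> e; rewrite {1}hY.
Qed.

Section Properties.
Variables (Pi : I -> 'I_2 -> solser) (dh ih : P -> solser).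
Hypotheses (hPi : forall i a, Pi i a = IB (force Pi ih i a))
  (hdh : forall e, dh e = newdel Pi dh e) (hih : forall e, ih e = newiot Pi dh ih e).

Lemma rlB_rho0 e : rlB (rho Pi) e 0 = x0 e + eps ^+ 2 * rlB (rhat Pi) e 0.
Proof.
rewrite /rlB /pair_diff /rho /= mulr_sumr.
have -> : x0 e = \sum_i cB (chi e i) * (cB (al i) + cB (be i) * tB).
  transitivity (cB (ae e) + cB (bee e) * tB).
    by rewrite /x0 tmE mulNr !rmorphN rmorphM /=; ring.
  rewrite /pair_diff !rmorph_sum mulr_suml -big_split; apply: eq_bigr => i _ /=.
  by rewrite !rmorphM /=; ring.
rewrite -big_split; apply: eq_bigr => i _ /=; ring.
Qed.
Lemma rlB_rho1 e : rlB (rho Pi) e 1 = eps ^+ 2 * rlB (rhat Pi) e 1.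
Proof.
rewrite /rlB /pair_diff /rho /= mulr_sumr; apply: eq_bigr => i _ /=; ring.
Qed.

Lemma cBs2 e : cB (s e) * cB (s e) = 1.
Proof. by rewrite -rmorphM /= s2 rmorph1. Qed.

Lemma cB2K : 2 * cB 2^-1 = 1.
Proof.
have -> : 2 = cB 2 by rewrite rmorph_nat.
by rewrite -rmorphM divff ?rmorph1 // pnatr_eq0.
Qed.

Lemma del_sq e : del dh e ^+ 2 = rlB (rho Pi) e 0 ^+ 2 + rlB (rho Pi) e 1 ^+ 2.
Proof.
rewrite rlB_rho0 rlB_rho1.
have h : 2 * (cB (s e) * x0 e) * dh e = 2 * x0 e * rlB (rhat Pi) e 0 + eps ^+ 2 *
   (rlB (rhat Pi) e 0 ^+ 2 + rlB (rhat Pi) e 1 ^+ 2 - dh e ^+ 2).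
  rewrite {1}hdh /newdel.
  set r0 := rlB _ e 0; set r1 := rlB _ e 1.
  transitivity ((cB (s e) * cB (s e)) * (x0 e * zz e) * (2 * x0 e * r0 + (2 * cB 2^-1) * (eps ^+ 2 *
   (r0 ^+ 2 + r1 ^+ 2 - dh e ^+ 2)))); first by ring.
  by rewrite cBs2 x0K cB2K !mul1r.
transitivity ((cB (s e) * cB (s e)) * x0 e ^+ 2 + eps ^+ 2 * (2 * (cB (s e) * x0 e) * dh e)
   + eps ^+ 4 * dh e ^+ 2); first by rewrite /del; ring.
by rewrite cBs2 h; ring.
Qed.

Lemma iot_del e : iot ih e * del dh e = 1.
Proof.
have h : cB (s e) * x0 e * ih e = - (cB (s e) * zz e * dh e + eps ^+ 2 * (ih e * dh e)).
  rewrite {1}hih /newiot -hdh.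
  transitivity (- ((cB (s e) * cB (s e)) * (x0 e * zz e) * (cB (s e) * zz e * dh e + eps ^+ 2 * (ih e * dh e)))).
    by ring.
  by rewrite cBs2 x0K !mul1r.
transitivity ((cB (s e) * cB (s e)) * (x0 e * zz e) + eps ^+ 2 * (cB (s e) * zz e * dh e)
   + eps ^+ 2 * (cB (s e) * x0 e * ih e) + eps ^+ 4 * (ih e * dh e)).
  by rewrite /iot /del; ring.
by rewrite cBs2 x0K h; ring.
Qed.

Lemma d_rho i a : dB (rho Pi i a) = cB (m i)^-1 * pii Pi i a.
Proof.
have dD := (dB_der S).1.
have cm : cB (m i)^-1 * cB (m i * be i) = cB (be i) by rewrite -rmorphM mulrA mulVf // mul1r.
rewrite /rho /rhat /pii dD dB_epsM dD dB_k add0r dB_cM dD.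
rewrite [tB * _]mulrC dB_kM dB_t mulr1 -{2}(expr1 eps) dB_epsM expr1 dB_I.
case: (a == 0); last by rewrite (der0 (dB_der S)) !add0r; ring.
by rewrite dD dB_c add0r dB_cM dB_t mulr1 -cm; ring.
Qed.
Lemma d_pii i a : dB (pii Pi i a) = eps ^+ 3 * force Pi ih i a.
Proof.
have dD := (dB_der S).1.
rewrite /pii dD dB_epsM dD dB_k add0r -{2}(expr1 eps) dB_epsM expr1 hPi dB_I.
have -> : dB (if a == 0 then cB (m i * be i) else 0) = 0.
  by case: ifP => _; rewrite ?dB_c // (der0 (dB_der S)).
by rewrite add0r; ring.
Qed.

Lemma ev_rho i a : evB (rho Pi i a) = (if a == 0 then shC (al i) else 0) + gen ^+ 2 * rh i a.
Proof.
rewrite /rho /rhat !(rmorphD, rmorphM) /= evB_gen !evB_k evB_I evB_t.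
rewrite mulr0 mul0r addr0 mulr0 addr0 -expr2; congr (_ + _).
by case: ifP => _; rewrite ?rmorph0 // rmorphD rmorphM /= evB_t mulr0 addr0 evB_c.
Qed.
Lemma ev_pii i a : evB (pii Pi i a) = (if a == 0 then shC (m i * be i) else 0) + gen ^+ 2 * ph i a.
Proof.
have eP : evB (Pi i a) = 0 by rewrite hPi; exact: evB_I.
rewrite /pii !(rmorphD, rmorphM) /= evB_gen evB_k eP.
rewrite mulr0 addr0 -expr2; congr (_ + _).
by case: ifP => _; rewrite ?rmorph0 // !rmorphM /= !evB_c.
Qed.
Lemma ev_del e : evB (del dh e) = shC (s e * ae e) + gen ^+ 2 * evB (dh e).
Proof.
have -> : shC (s e * ae e) = - (shC (s e) * (shC (bee e) * shC (tm (lam e)))) :> epsser.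
  by rewrite tmE -!rmorphM -rmorphN mulNr mulrN.
rewrite /del /x0 !(rmorphD, rmorphM, rmorphN) /= evB_gen evB_t !evB_c; ring.
Qed.

Variable b : 'I_q.
Hypothesis tm_inj : injective tm.
(** The leading force of the pair e is proportional to s / x0^2, the separation over the cube of the
    signed distance; [gg e] is its coefficient when x0 is written with y e. *)
Definition gg e : F := s e * mm e / bee e ^+ 2.
(** The inverse mass metric, through which the force of the pair f accelerates the separation of the
    pair e; it is 0 when the pairs have no common body. *)
Definition ip e f : F := \sum_i chi e i * chi f i / m i.
Local Notation y e := (hy S (lam e)).
Local Notation r0 := (fun e => rlB (rhat Pi) e 0).
Local Notation r1 := (fun e => rlB (rhat Pi) e 1).
Local Notation eqm := (@eqm _ _ _ S).

Lemma zzE e k : zz e ^+ k = cB ((bee e)^-1 ^+ k) * eB (y e ^+ k).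
Proof. by rewrite /zz exprMn !rmorphXn. Qed.

Lemma cB_gg e : cB (gg e) = cB (s e) * cB (mm e) * cB (bee e)^-1 ^+ 2.
Proof. by rewrite /gg -exprVn -rmorphXn -!rmorphM. Qed.
Lemma zzE' e k : zz e ^+ k = cB (bee e)^-1 ^+ k * eB (y e ^+ k).
Proof. by rewrite zzE rmorphXn. Qed.

Lemma dh_eqm e : eqm 2 (dh e) (cB (s e) * r0 e).
Proof.
rewrite hdh /newdel; exists (cB (s e) * zz e * (cB 2^-1 * (r0 e ^+ 2 + r1 e ^+ 2 - dh e ^+ 2))).
transitivity (cB (s e) * (x0 e * zz e) * r0 e +
  eps ^+ 2 * (cB (s e) * zz e * (cB 2^-1 * (r0 e ^+ 2 + r1 e ^+ 2 - dh e ^+ 2)))); first by ring.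
by rewrite x0K mulr1.
Qed.
Lemma ih_eqm e : eqm 2 (ih e) (- (cB (s e) * (zz e ^+ 2 * r0 e))).
Proof.
have [w hw] := dh_eqm e.
rewrite hih /newiot -hdh; exists (- (zz e ^+ 2 * w + cB (s e) * zz e * (ih e * dh e))).
transitivity (- ((cB (s e) * cB (s e)) * zz e ^+ 2 * dh e + eps ^+ 2 * (cB (s e) * zz e * (ih e * dh e)))).
  by ring.
by rewrite cBs2 {1}hw; ring.
Qed.

(** The factors -2 here and 1 in [pair_force1] are those of a tidal field, along the line and across
    it. *)
Lemma pair_force0 e : eqm 4 (iot ih e ^+ 3 * rlB (rho Pi) e 0)
  (cB (s e) * zz e ^+ 2 - 2 * eps ^+ 2 * (cB (s e) * (zz e ^+ 3 * r0 e))).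
Proof.
have [w hw] := ih_eqm e; have ss := cBs2 e; have xz := x0K e.
rewrite rlB_rho0 /iot hw; set sg := cB (s e) in ss *; set z := zz e in xz *; set x := x0 e in xz *.
set r := r0 e; set u := - (sg * (z ^+ 2 * r)) + eps ^+ 2 * w.
exists (3 * z ^+ 2 * sg ^+ 2 * w * x + 3 * z * sg * u ^+ 2 * (x + eps ^+ 2 * r) + 3 * z ^+ 2 * sg ^+ 2 * u * r
  + eps ^+ 2 * u ^+ 3 * (x + eps ^+ 2 * r)).
transitivity ((sg * sg) * sg * z ^+ 2 * (x * z) + eps ^+ 2 * ((sg * sg) * sg * z ^+ 3 * r)
  - eps ^+ 2 * (3 * (sg * sg) * sg * z ^+ 3 * r) * (x * z)
  + eps ^+ 4 * (3 * z ^+ 2 * sg ^+ 2 * w * x + 3 * z * sg * u ^+ 2 * (x + eps ^+ 2 * r) + 3 * z ^+ 2 * sg ^+ 2 * u * r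
  + eps ^+ 2 * u ^+ 3 * (x + eps ^+ 2 * r))); first by rewrite /u; ring.
by rewrite ss xz; ring.
Qed.
Lemma pair_force1 e : eqm 4 (iot ih e ^+ 3 * rlB (rho Pi) e 1)
  (eps ^+ 2 * (cB (s e) * (zz e ^+ 3 * r1 e))).
Proof.
have ss := cBs2 e; rewrite rlB_rho1 /iot; set sg := cB (s e) in ss *; set z := zz e.
set r := r1 e; set u := ih e.
exists (r * (3 * sg ^+ 2 * z ^+ 2 * u + 3 * eps ^+ 2 * sg * z * u ^+ 2 + eps ^+ 4 * u ^+ 3)).
transitivity (eps ^+ 2 * ((sg * sg) * sg * (z ^+ 3 * r)) +
  eps ^+ 4 * (r * (3 * sg ^+ 2 * z ^+ 2 * u + 3 * eps ^+ 2 * sg * z * u ^+ 2 + eps ^+ 4 * u ^+ 3))); first by ring.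
by rewrite ss; ring.
Qed.

Lemma force0 i : eqm 4 (force Pi ih i 0)
  (\sum_e cB (gg e * chi e i) * (2 * eps ^+ 2 * (cB (bee e)^-1 * (eB (y e ^+ 3) * r0 e)) - eB (y e ^+ 2))).
Proof.
rewrite /force; apply: eqm_trans.
  by apply: eqmN; apply: eqm_sum => e; rewrite -mulrA; apply/eqmMl/pair_force0.
rewrite -sumrN; apply: eqm_sum => e; rewrite !zzE' !(rmorphM _ (mm e)) (rmorphM _ (gg e)) /= cB_gg.
by exists 0; ring.
Qed.
Lemma force1 i : eqm 4 (force Pi ih i 1)
  (- \sum_e cB (gg e * chi e i) * (eps ^+ 2 * (cB (bee e)^-1 * (eB (y e ^+ 3) * r1 e)))).
Proof.
rewrite /force; apply: eqmN; apply: eqm_trans.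
  by apply: eqm_sum => e; rewrite -mulrA; apply/eqmMl/pair_force1.
apply: eqm_sum => e; rewrite !zzE' (rmorphM _ (mm e)) (rmorphM _ (gg e)) /= cB_gg.
by exists 0; ring.
Qed.

Lemma Pi0_eqm i : eqm 2 (Pi i 0) (- \sum_e cB (gg e * chi e i) * IB (eB (y e ^+ 2))).
Proof.
rewrite hPi; apply: eqm_trans.
  by apply: eqm_I; apply: eqm_le (force0 i).
rewrite IB_sum -sumrN; apply: eqm_sum => e; rewrite IB_cM -mulrN; apply: eqmMl.
rewrite IB_D IB_N -[X in eqm _ _ X]add0r; apply: eqmD; last exact: eqm_refl.
rewrite [2 * _]mulrC -mulrA IB_epsM; exact: eqm_0.
Qed.
Lemma Pi1_eqm i : eqm 2 (Pi i 1) 0.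
Proof.
rewrite hPi; have [w hw] := force1 i.
rewrite hw IB_D IB_N IB_sum IB_epsM.
exists (- \sum_e cB (gg e * chi e i) * IB (cB (bee e)^-1 * (eB (y e ^+ 3) * r1 e)) + eps ^+ 2 * IB w).
rewrite add0r mulrDr mulrN mulr_sumr mulrA -exprD; congr (- _ + _); apply: eq_bigr => e _.
by rewrite IB_cM IB_epsM; ring.
Qed.

(** The leading force has double poles, so the momenta are still rational at this order; one
    integration later the positions contain logarithms. *)
Lemma IPi0_eqm i : eqm 2 (IB (Pi i 0))
  (\sum_e cB (gg e * chi e i) * (eB (hI (y e)) - cB (hev S (y e)) * tB)).
Proof.
apply: eqm_trans; first exact: eqm_I (Pi0_eqm i).
rewrite IB_N IB_sum -sumrN; apply: eqm_sum => e; rewrite IB_cM -mulrN.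
suff -> : IB (IB (eB (y e ^+ 2))) = - (eB (hI (y e)) - cB (hev S (y e)) * tB).
  by rewrite opprK; exact: eqm_refl.
have -> : IB (eB (y e ^+ 2)) = - (eB (y e) - cB (hev S (y e))).
  rewrite (@IB_eq _ _ _ _ _ (- eB (y e))).
    by rewrite rmorphN /= evB_e rmorphN /= kB_C; ring.
  by rewrite (derN (dB_der S)) dB_e hy_d rmorphN opprK.
apply: primitive_eq; last by rewrite evB_I !(rmorphN, rmorphB, rmorphM) /= evB_e hevI evB_t rmorph0 mulr0 subr0 oppr0.
by rewrite dB_I !(derN (dB_der S)) !(derB (dB_der S)) dB_e hdI dB_cM dB_t mulr1.
Qed.

Lemma rhat_rl e a : rlB (rhat Pi) e a =
  kB (pair_diff (A := epsser) shC (fun i => rh i a) e)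
  + tB * kB (pair_diff (A := epsser) shC (fun i => shC (m i)^-1 * ph i a) e)
  + eps * \sum_i cB (chi e i / m i) * IB (Pi i a).
Proof.
rewrite /rlB /pair_diff !rmorph_sum !mulr_sumr -!big_split; apply: eq_bigr => i _ /=.
by rewrite !rmorphM /= !kB_C /rhat; ring.
Qed.

Lemma ip_sum e (G : P -> solser) :
  \sum_i cB (chi e i / m i) * (\sum_f cB (gg f * chi f i) * G f) = \sum_f cB (gg f * ip e f) * G f.
Proof.
under eq_bigr do rewrite mulr_sumr; rewrite exchange_big; apply: eq_bigr => f _ /=.
rewrite /ip mulr_sumr rmorph_sum mulr_suml; apply: eq_bigr => i _ /=.
rewrite mulrA -rmorphM; congr (cB _ * _); ring.
Qed.

(** All that is affine in t is left unspecified, values of the primitives at 0 included, since by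
    [NI_affine] it adds no monodromy to the integrated tidal force. *)
Lemma r0_eqm e : exists A C : epsser, eqm 3 (r0 e)
  (kB A + tB * kB C + eps * \sum_f cB (gg f * ip e f) * eB (hI (y f))).
Proof.
exists (pair_diff (A := epsser) shC (fun i => rh i 0) e).
exists (pair_diff (A := epsser) shC (fun i => shC (m i)^-1 * ph i 0) e
  - gen * \sum_f shC (gg f * ip e f * hev S (y f))).
apply: eqm_trans.
  rewrite rhat_rl; apply: eqmD; first exact: eqm_refl.
  rewrite -(expr1 eps); apply: (@eqm_eps _ _ _ _ 2 1); apply: eqm_sum => i.
  by apply/eqmMl/IPi0_eqm.
exists 0; rewrite ip_sum mulr0 addr0 !expr1 rmorphB rmorphM /= kB_gen.
have -> : \sum_f cB (gg f * ip e f) * (eB (hI (y f)) - cB (hev S (y f)) * tB) =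
   \sum_f cB (gg f * ip e f) * eB (hI (y f)) - tB * \sum_f kB (shC (gg f * ip e f * hev S (y f))).
  rewrite mulr_sumr -sumrB; apply: eq_bigr => f _.
  by rewrite kB_C (rmorphM _ (gg f * _)) /=; ring.
have -> : kB (\sum_f shC (gg f * ip e f * hev S (y f))) = \sum_f kB (shC (gg f * ip e f * hev S (y f))).
  by rewrite rmorph_sum.
ring.
Qed.
Lemma r1_eqm e : exists A C : epsser, eqm 3 (r1 e) (kB A + tB * kB C).
Proof.
exists (pair_diff (A := epsser) shC (fun i => rh i 1) e).
exists (pair_diff (A := epsser) shC (fun i => shC (m i)^-1 * ph i 1) e).
rewrite rhat_rl -[X in eqm _ _ X]addr0; apply: eqmD; first exact: eqm_refl.
rewrite -[X in eqm _ _ X](mulr0 eps) -(expr1 eps); apply: (@eqm_eps _ _ _ _ 2 1).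
rewrite [X in eqm _ _ X](_ : 0 = \sum_i cB (chi e i / m i) * 0 :> solser); last by rewrite big1 // => i _; rewrite mulr0.
by apply: eqm_sum => i; apply: eqmMl; rewrite -(IB_0 S); apply: eqm_I; apply: Pi1_eqm.
Qed.

Lemma NI_affine (A C : epsser) e : NB b (IB (eB (y e ^+ 3) * (kB A + tB * kB C))) = 0.
Proof.
have -> : eB (y e ^+ 3) * (kB A + tB * kB C) = kB A * eB (y e ^+ 3) + kB C * (tB * eB (y e ^+ 3)) by ring.
by rewrite IB_D !IB_kM (NB_der S b).1 !NB_kM NI_y3 NI_ty3 !mulr0 addr0.
Qed.

Lemma cB2M c : cB (2 * c) = 2 * cB c.
Proof. by rewrite rmorphM rmorph_nat. Qed.

(** The first monodromy of the momenta comes from the logarithms in the positions, fed back through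
    the tidal force: eps^2 from the tidal term, one more eps from the logarithms. The other terms
    have rational primitives. *)
Lemma N_Pi0 i : eqm 4 (NB b (Pi i 0)) (eps ^+ 3 * \sum_e cB (gg e * chi e i) * (2 * cB (bee e)^-1 *
   \sum_f cB (gg f * ip e f) * eB (nu S b (lam e) (lam f)))).
Proof.
rewrite hPi; apply: eqm_trans.
  by apply: eqm_N; apply: eqm_I; apply: force0.
rewrite IB_sum (der_sum (NB_der S b)) mulr_sumr; apply: eqm_sum => e.
rewrite IB_cM NB_cM [eps ^+ 3 * _]mulrCA; apply: eqmMl.
have [A [C hr]] := r0_eqm e.
rewrite IB_D IB_N (derB (NB_der S b)) NI_y2 subr0 [2 * eps ^+ 2]mulrC -[eps ^+ 2 * 2 * _]mulrA IB_epsM NB_epsM.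
apply: eqm_trans.
  apply: (@eqm_le _ _ _ _ 5) => //; apply: (@eqm_eps _ _ _ _ 3 2); apply: eqm_N; apply: eqm_I.
  by do 2 apply: eqmMl; apply: eqmMl; exact: hr.
exists 0; rewrite mulr0 addr0.
have -> : 2 * (cB (bee e)^-1 * (eB (y e ^+ 3) * (kB A + tB * kB C + eps * \sum_f cB (gg f * ip e f) * eB (hI (y f))))) =
  cB (2 * (bee e)^-1) * (eB (y e ^+ 3) * (kB A + tB * kB C) + eps ^+ 1 * (eB (y e ^+ 3) * \sum_f cB (gg f * ip e f) * eB (hI (y f)))).
  by rewrite cB2M expr1; ring.
rewrite IB_cM NB_cM IB_D (NB_der S b).1 NI_affine add0r IB_epsM NB_epsM mulr_sumr IB_sum (der_sum (NB_der S b)).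
rewrite cB2M expr1 (eq_bigr (fun f => cB (gg f * ip e f) * eB (nu S b (lam e) (lam f)))) => [|f _]; first by ring.
have -> : eB (y e ^+ 3) * (cB (gg f * ip e f) * eB (hI (y f))) =
   cB (gg f * ip e f) * eB (y e ^+ 3 * hI (y f)) by rewrite (rmorphM _ (y e ^+ 3)) /=; ring.
by rewrite IB_cM NB_cM NI_y3L.
Qed.
Lemma N_Pi1 i : eqm 4 (NB b (Pi i 1)) 0.
Proof.
rewrite hPi; apply: eqm_trans.
  by apply: eqm_N; apply: eqm_I; apply: force1.
rewrite IB_N (derN (NB_der S b)) IB_sum (der_sum (NB_der S b)) -[X in eqm _ _ X]oppr0; apply: eqmN.
rewrite [X in eqm _ _ X](_ : 0 = \sum_e cB (gg e * chi e i) * 0 :> solser); last by rewrite big1 // => e _; rewrite mulr0.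
apply: eqm_sum => e; rewrite IB_cM NB_cM; apply: eqmMl.
have [A [C hr]] := r1_eqm e.
rewrite IB_epsM NB_epsM IB_cM NB_cM; apply: eqm_trans.
  apply: (@eqm_le _ _ _ _ 5) => //; apply: (@eqm_eps _ _ _ _ 3 2); apply: eqmMl; apply: eqm_N; apply: eqm_I.
  by apply: eqmMl; exact: hr.
by rewrite NI_affine !mulr0; exact: eqm_refl.
Qed.
Lemma N_IPi0 i : eqm 2 (NB b (IB (Pi i 0))) (cB (\sum_e gg e * chi e i * (b == lam e)%:R)).
Proof.
apply: eqm_trans; first exact: eqm_N (IPi0_eqm i).
rewrite (der_sum (NB_der S b)) rmorph_sum; apply: eqm_sum => e.
rewrite NB_cM (derB (NB_der S b)) NB_cM NB_t mulr0 subr0 NB_e hNI (rmorphM _ (gg e * _)) !rmorph_nat /=.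
exact: eqm_refl.
Qed.
Lemma N_IPi1 i : eqm 2 (NB b (IB (Pi i 1))) 0.
Proof.
have -> : 0 = NB b (IB 0) :> solser by rewrite IB_0 (der0 (NB_der S b)).
by apply: eqm_N; apply: eqm_I; apply: Pi1_eqm.
Qed.

Lemma N_rho i a : NB b (rho Pi i a) = eps ^+ 3 * (cB (m i)^-1 * NB b (IB (Pi i a))).
Proof.
have Nd := NB_der S b.
have -> : rho Pi i a = (if a == 0 then cB (al i) + cB (be i) * tB else 0)
   + eps ^+ 2 * (kB (rh i a) + kB (shC (m i)^-1) * (kB (ph i a) * tB)) + eps ^+ 3 * (cB (m i)^-1 * IB (Pi i a)).
  by rewrite /rho /rhat kB_C; ring.
rewrite !Nd.1 !NB_epsM Nd.1 NB_k !NB_kM NB_t !mulr0 !addr0 mulr0 addr0 NB_cM.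
by case: ifP => _; rewrite ?(der0 Nd) ?add0r // Nd.1 NB_c NB_cM NB_t mulr0 !add0r.
Qed.
Lemma N_pii i a : NB b (pii Pi i a) = eps ^+ 3 * NB b (Pi i a).
Proof.
have Nd := NB_der S b.
have -> : pii Pi i a = (if a == 0 then cB (m i * be i) else 0)
   + eps ^+ 2 * kB (ph i a) + eps ^+ 3 * Pi i a by rewrite /pii; ring.
rewrite !Nd.1 !NB_epsM NB_k mulr0 addr0.
by case: ifP => _; rewrite ?(der0 Nd) ?NB_c add0r.
Qed.
End Properties.

(** * Leading coefficient of the symplectic pairing of two monodromy vectors *)

Section Omega.
Variables (Pi : I -> 'I_2 -> solser) (dh ih : P -> solser).
Hypotheses (hPi : forall i a, Pi i a = IB (force Pi ih i a))
  (hdh : forall e, dh e = newdel Pi dh e) (hih : forall e, ih e = newiot Pi dh ih e).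
Hypothesis tm_inj : injective tm.
Local Notation eqm := (@eqm _ _ _ S).

Definition nun (b i j : 'I_q) : F :=
  - 2^-1 * ((tm i) ^- 2 * (j == b)%:R + ((i == b)%:R - (j == b)%:R) * (tm i - tm j) ^- 2).
Lemma hev_nu b i j : hev S (nu S b i j) = nun b i j.
Proof.
rewrite /nu /nun !(rmorphD, rmorphM, rmorphN) /= !hevk hev_y.
rewrite rmorph_nat -expr2 sqrrN exprVn; congr (_ * (_ + _)).
Qed.

(** [kick] is m i times the coefficient of eps^3 in the monodromy of the position of body i, [kick2]
    the coefficient of eps^6 in that of its momentum, both at t = 0 and along the line. *)
Definition kick b i : F := \sum_e gg e * chi e i * (b == lam e)%:R.
Definition kick2 b i : F := \sum_e gg e * chi e i * (2 * (bee e)^-1 *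
   \sum_f gg f * ip e f * nun b (lam e) (lam f)).
Definition omega_sum a b : F := \sum_i (m i)^-1 * (kick a i * kick2 b i - kick2 a i * kick b i).

Definition kick2B b i : solser := \sum_e cB (gg e * chi e i) * (2 * cB (bee e)^-1 *
   \sum_f cB (gg f * ip e f) * eB (nu S b (lam e) (lam f))).
Lemma evB_kick2B b i : evB (kick2B b i) = shC (kick2 b i).
Proof.
rewrite /kick2B /kick2 !rmorph_sum; apply: eq_bigr => e _ /=.
rewrite rmorphM [in RHS]rmorphM /= evB_c; congr (_ * _).
rewrite !rmorphM /= evB_c rmorph_nat; congr (_ * _).
  by rewrite rmorph_nat.
rewrite !rmorph_sum; apply: eq_bigr => f _ /=.
rewrite (rmorphM (@evB _ _ _ S)) /= evB_c evB_e hev_nu -rmorphM //.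
Qed.

Definition omegaB a b : solser :=
  \sum_i \sum_(c < 2) (NB a (rho Pi i c) * NB b (pii Pi i c) - NB a (pii Pi i c) * NB b (rho Pi i c)).

Lemma sum2 (V : nmodType) (G : 'I_2 -> V) : \sum_(c < 2) G c = G 0 + G 1.
Proof. by rewrite !big_ord_recl big_ord0 addr0; congr (_ + G _); apply: val_inj. Qed.

(** The transverse components are divisible by eps^5 and eps^7, so their product starts at order
    eps^12. *)
Lemma half_omega a b i : eqm 10 (NB a (rho Pi i 0) * NB b (pii Pi i 0) + NB a (rho Pi i 1) * NB b (pii Pi i 1))
  (eps ^+ 9 * (cB (m i)^-1 * (cB (kick a i) * kick2B b i))).
Proof.
have [u hu] := N_IPi0 hPi hdh hih a i.
have [v hv] := N_Pi0 hPi hdh hih b tm_inj i.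
have [u' hu'] : eqm 2 (NB a (IB (Pi i 1))) 0 by apply: N_IPi1; eauto.
have [v' hv'] : eqm 4 (NB b (Pi i 1)) 0 by apply: N_Pi1; eauto.
rewrite !N_rho !N_pii hu hv hu' hv' -/(kick2B b i) -/(kick a i).
exists (cB (m i)^-1 * (cB (kick a i) * v + eps * (u * (kick2B b i + eps * v)) + eps ^+ 2 * (u' * v'))).
ring.
Qed.

Lemma omegaB_lead a b : exists Z : epsser, evB (omegaB a b) = gen ^+ 9 * (shC (omega_sum a b) + gen * Z).
Proof.
have [z heval] : eqm 10 (omegaB a b) (eps ^+ 9 * \sum_i cB (m i)^-1 * (cB (kick a i) * kick2B b i - kick2B a i * cB (kick b i))).
  rewrite mulr_sumr; apply: eqm_sum => i; rewrite sum2.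
  have -> : NB a (rho Pi i 0) * NB b (pii Pi i 0) - NB a (pii Pi i 0) * NB b (rho Pi i 0) +
   (NB a (rho Pi i 1) * NB b (pii Pi i 1) - NB a (pii Pi i 1) * NB b (rho Pi i 1)) =
   NB a (rho Pi i 0) * NB b (pii Pi i 0) + NB a (rho Pi i 1) * NB b (pii Pi i 1) -
   (NB b (rho Pi i 0) * NB a (pii Pi i 0) + NB b (rho Pi i 1) * NB a (pii Pi i 1)) by ring.
  apply: eqm_trans; first by apply: eqmB; apply: half_omega.
  by exists 0; ring.
exists (evB z); rewrite heval rmorphD (rmorphM _ (eps ^+ 9)) (rmorphM _ (eps ^+ 10)) !rmorphXn /= evB_gen mulrDr mulrA -exprSr.
congr (_ * _ + _); rewrite /omega_sum !rmorph_sum; apply: eq_bigr => i _ /=.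
by rewrite !(rmorphM, rmorphB) /= !evB_c !evB_kick2B.
Qed.

(* The value of the leading coefficient; [(tm i - tm i) ^- 2 = 0] removes the singular term. *)
Definition Omega a b : F := gg a * gg b * \sum_e gg e * (
  ip e b * (ip a e / bee e - ip a b / bee b) * (tm (lam e) - tm (lam b)) ^- 2
  - ip e a * (ip b e / bee e - ip a b / bee a) * (tm (lam e) - tm (lam a)) ^- 2).

Lemma ipC e f : ip e f = ip f e.
Proof. by apply: eq_bigr => i _; rewrite [chi e i * _]mulrC. Qed.

(** Since no other pair uses the letters of a and b, their Kronecker symbols single out one term
    each. The terms in tm^-2, due to the evaluation at t = 0, are symmetric in a and b and
    cancel. *)
Lemma omega_sumE a b : (forall e, lam e = lam a -> e = a) -> (forall e, lam e = lam b -> e = b) ->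
  omega_sum (lam a) (lam b) = Omega a b.
Proof.
move=> ua ub; have single (c : P) (G : P -> F) : (forall e, lam e = lam c -> e = c) ->
    \sum_e G e * (lam e == lam c)%:R = G c.
  move=> uc; rewrite (bigD1 c) //= eqxx mulr1 big1 ?addr0 // => e /negPf ec.
  by case: eqP => [/uc /eqP|]; rewrite ?ec // mulr0.
have kickE c i : (forall e, lam e = lam c -> e = c) -> kick (lam c) i = gg c * chi c i.
  move=> uc; rewrite /kick -(single c (fun e => gg e * chi e i)) //.
  by apply: eq_bigr => e _; rewrite eq_sym.
have k2 c d : \sum_i (m i)^-1 * (gg d * chi d i * kick2 (lam c) i) =
    - gg d * \sum_e \sum_f gg e * ip d e * (bee e)^-1 * (gg f * ip e f) *
      (tm (lam e) ^- 2 * (lam f == lam c)%:R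
       + ((lam e == lam c)%:R - (lam f == lam c)%:R) * (tm (lam e) - tm (lam f)) ^- 2).
  rewrite /kick2; under eq_bigr do rewrite !mulr_sumr.
  rewrite exchange_big mulr_sumr; apply: eq_bigr => e _ /=.
  transitivity (\sum_i (chi d i * chi e i / m i) * (gg d * gg e * (2 * (bee e)^-1 *
      \sum_f gg f * ip e f * nun (lam c) (lam e) (lam f)))).
    by apply: eq_bigr => i _; ring.
  rewrite -mulr_suml -/(ip d e); move: (ip d e) => p; rewrite !mulr_sumr; apply: eq_bigr => f _.
  rewrite /nun; set Z := _ + _ * _ ^- 2.
  have h2 : 2 * 2^-1 = 1 :> F by rewrite divff // pnatr_eq0.
  transitivity ((2 * 2^-1) * (- gg d * (gg e * p / bee e * (gg f * ip e f) * Z))); first by ring.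
  by rewrite h2 mul1r.
have D2 e f : (tm (lam e) - tm (lam f)) ^- 2 = (tm (lam f) - tm (lam e)) ^- 2.
  by rewrite -sqrrN opprB.
have k2E c d : (forall e, lam e = lam c -> e = c) -> \sum_i (m i)^-1 * (gg d * chi d i * kick2 (lam c) i) =
    - gg d * gg c * \sum_e gg e * (ip d e / bee e * ip e c * (tm (lam e) ^- 2 - (tm (lam e) - tm (lam c)) ^- 2)
      + ip d c / bee c * ip c e * (tm (lam e) - tm (lam c)) ^- 2).
  move=> uc; rewrite k2 -[RHS]mulrA; congr (_ * _).
  transitivity (\sum_e (gg e * ip d e / bee e * (gg c * ip e c) * (tm (lam e) ^- 2 - (tm (lam e) - tm (lam c)) ^- 2)
     + (\sum_f gg e * ip d e / bee e * (gg f * ip e f) * (tm (lam e) - tm (lam f)) ^- 2) * (lam e == lam c)%:R)).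
    apply: eq_bigr => e _.
    rewrite -(single c (fun f => gg e * ip d e / bee e * (gg f * ip e f) * (tm (lam e) ^- 2 - (tm (lam e) - tm (lam f)) ^- 2))) //.
    by rewrite mulr_suml -big_split; apply: eq_bigr => f _ /=; ring.
  rewrite big_split /= (single c) // [RHS]mulr_sumr -big_split; apply: eq_bigr => e _ /=.
  by rewrite (D2 c e); ring.
transitivity (\sum_i (m i)^-1 * (gg a * chi a i * kick2 (lam b) i) - \sum_i (m i)^-1 * (gg b * chi b i * kick2 (lam a) i)).
  rewrite -sumrB; apply: eq_bigr => i _; rewrite !kickE //; ring.
rewrite !k2E // /Omega (ipC b a) ![- gg _ * gg _]mulNr !mulNr opprK [gg b * gg a]mulrC addrC -mulrBr -sumrB.
congr (_ * _); apply: eq_bigr => e _; rewrite (ipC b e) (ipC a e); ring.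
Qed.
End Omega.
End NBodySolution.

(** * Isotropy of common kernels *)

Lemma sum_nv (n : nat) (V : nmodType) (G : 'I_(nv n) -> V) :
  \sum_k G k = \sum_i \sum_a G (vr i a) + \sum_i \sum_a G (vp i a) + \sum_e G (vd e).
Proof.
rewrite (reindex (@enum_rank (var n))) /=; last by exists enum_val => k _; rewrite ?enum_valK ?enum_rankK.
rewrite big_sumType /= big_sumType /= !pair_big /=.
by congr (_ + _ + _); apply: eq_bigr => -[i a].
Qed.

Definition mk_pt (n : nat) (T : Type) (fr fp : 'I_n -> 'I_2 -> T) (fd : pairs n -> T) (k : 'I_(nv n)) : T :=
  match enum_val k : var n with
  | inl (inl ia) => fr ia.1 ia.2
  | inl (inr ia) => fp ia.1 ia.2
  | inr e => fd e
  end.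
Lemma mk_vr n T fr fp fd i a : @mk_pt n T fr fp fd (vr i a) = fr i a.
Proof. by rewrite /mk_pt enum_rankK. Qed.
Lemma mk_vp n T fr fp fd i a : @mk_pt n T fr fp fd (vp i a) = fp i a.
Proof. by rewrite /mk_pt enum_rankK. Qed.
Lemma mk_vd n T fr fp fd e : @mk_pt n T fr fp fd (vd e) = fd e.
Proof. by rewrite /mk_pt enum_rankK. Qed.

Lemma meval_bigsum (n : nat) (K : comNzRingType) (x : 'I_n -> K) J (r : seq J) (P : pred J) (G : J -> {mpoly K[n]}) :
  (\sum_(j <- r | P j) G j).@[x] = \sum_(j <- r | P j) (G j).@[x].
Proof. by apply: (big_morph (meval x)) => [f g|]; rewrite ?mevalD ?meval0. Qed.

(** * Differentials of polynomials and of the equations of the phase space *)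

Section Calculus.
Variables (R : realType) (n : nat) (m : 'I_n -> R).
Local Notation C := R[i].
Local Notation poly := {mpoly C[nv n]}.
Variables (x w : 'I_(nv n) -> C).
Local Notation D g := (pdiff g x w).

Lemma pdiffD (f g : poly) : D (f + g) = D f + D g.
Proof. by rewrite /pdiff -big_split; apply: eq_bigr => k _; rewrite mderivD mevalD mulrDl. Qed.
Lemma pdiffN (f : poly) : D (- f) = - D f.
Proof. by rewrite /pdiff -sumrN; apply: eq_bigr => k _; rewrite mderivN mevalN mulNr. Qed.
Lemma pdiffB (f g : poly) : D (f - g) = D f - D g.
Proof. by rewrite pdiffD pdiffN. Qed.
Lemma pdiffM (f g : poly) : D (f * g) = D f * g.@[x] + f.@[x] * D g.
Proof.
rewrite /pdiff mulr_suml mulr_sumr -big_split; apply: eq_bigr => k _ /=.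
by rewrite mderivM mevalD !mevalM; ring.
Qed.
Lemma pdiffZ c (f : poly) : D (c *: f) = c * D f.
Proof. by rewrite /pdiff mulr_sumr; apply: eq_bigr => k _; rewrite mderivZ mevalZ mulrA. Qed.
Lemma pdiff0 : D 0 = 0.
Proof. by rewrite -(scale0r 0) pdiffZ mul0r. Qed.
Lemma pdiff_sum J (r : seq J) (P : pred J) (G : J -> poly) :
  D (\sum_(j <- r | P j) G j) = \sum_(j <- r | P j) D (G j).
Proof. exact: (big_morph (fun g => D g) pdiffD pdiff0). Qed.
Lemma pdiffX k : D 'X_k = w k.
Proof.
rewrite /pdiff (bigD1 k) //= mderivX big1 => [|j jk]; last first.
  by rewrite mderivX mnm1E eq_sym (negPf jk) scale0r meval0 mul0r.
rewrite mnm1E eqxx scale1r (_ : (U_(k) - U_(k))%MM = 0%MM) ?mpolyX0 ?meval1 ?mul1r ?addr0 //.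
by apply/mnmP => j; rewrite mnmBE subnn mnm0E.
Qed.
Lemma pdiff_sq (f : poly) : D (f ^+ 2) = 2 * (f.@[x] * D f).
Proof. by rewrite expr2 pdiffM; ring. Qed.
Lemma rdiffE (F : poly * poly) : rdiff F x w =
  ((F.2).@[x] * D F.1 - (F.1).@[x] * D F.2) / (F.2).@[x] ^+ 2.
Proof.
rewrite /rdiff /pdiff !mulr_sumr -sumrB mulr_suml; apply: eq_bigr => k _.
by rewrite /rpartial; ring.
Qed.

Definition relv (z : 'I_(nv n) -> C) (e : pairs n) a : C := z (vr (pi1 e) a) - z (vr (pi2 e) a).

Lemma eval_eq_dist e : (eq_dist R e).@[x] = x (vd e) ^+ 2 - \sum_a relv x e a ^+ 2.
Proof.
rewrite /eq_dist mevalB rmorphXn /= mevalXU meval_bigsum; congr (_ - _).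
by apply: eq_bigr => a _; rewrite rmorphXn /= mevalB !mevalXU.
Qed.
Lemma pdiff_eq_dist e : D (eq_dist R e) = 2 * (x (vd e) * w (vd e) - \sum_a relv x e a * relv w e a).
Proof.
rewrite /eq_dist pdiffB pdiff_sq pdiff_sum mevalXU pdiffX mulrBr mulr_sumr; congr (_ - _).
by apply: eq_bigr => a _; rewrite pdiff_sq mevalB pdiffB !mevalXU !pdiffX.
Qed.
Lemma eval_eq_rs a : (eq_rs m a).@[x] = (cm (mtot m))^-1 * \sum_i cm (m i) * x (vr i a).
Proof.
rewrite /eq_rs mevalZ meval_bigsum; congr (_ * _).
by apply: eq_bigr => i _ /=; rewrite mevalZ mevalXU.
Qed.
Lemma pdiff_eq_rs a : D (eq_rs m a) = (cm (mtot m))^-1 * \sum_i cm (m i) * w (vr i a).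
Proof.
rewrite /eq_rs pdiffZ pdiff_sum; congr (_ * _).
by apply: eq_bigr => i _ /=; rewrite pdiffZ pdiffX.
Qed.
Lemma eval_eq_ps a : (eq_ps R n a).@[x] = \sum_i x (vp i a).
Proof. by rewrite /eq_ps meval_bigsum; apply: eq_bigr => i _; rewrite /= mevalXU. Qed.
Lemma pdiff_eq_ps a : D (eq_ps R n a) = \sum_i w (vp i a).
Proof. by rewrite /eq_ps pdiff_sum; apply: eq_bigr => i _; rewrite /= pdiffX. Qed.
End Calculus.

Section Symplectic.
Variables (R : realType) (n : nat) (m : 'I_n -> R).
Local Notation C := R[i].
Local Notation point := ('I_(nv n) -> C).
Hypotheses (n2 : (2 < n)%N) (m_gt0 : forall i, 0 < m i).
Implicit Types (x w : point).

Lemma cm_neq0 (a : R) : a != 0 -> cm a != 0.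
Proof. by move=> a0; apply: contraNneq a0 => -[->]. Qed.
Lemma cmD (a b : R) : cm (a + b) = cm a + cm b. Proof. by rewrite /cm; simpc. Qed.
Lemma cm_sum (G : 'I_n -> R) : cm (\sum_i G i) = \sum_i cm (G i).
Proof. exact: (big_morph _ cmD). Qed.
Lemma cmi_neq0 i : cm (m i) != 0. Proof. by apply: cm_neq0; rewrite gt_eqF. Qed.
Lemma mtot_neq0 : cm (mtot m) != 0.
Proof.
apply: cm_neq0; rewrite gt_eqF // /mtot (bigD1 (Ordinal (ltnW (ltnW n2)))) //=.
by apply: ltr_pwDl => //; apply: sumr_ge0 => i _; apply: ltW.
Qed.

Lemma tangentP x w : tangent m x w <->
  [/\ forall e, x (vd e) * w (vd e) = \sum_a relv x e a * relv w e a,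
      forall a, \sum_i cm (m i) * w (vr i a) = 0 & forall a, \sum_i w (vp i a) = 0].
Proof.
have two0 : 2 != 0 :> C by rewrite pnatr_eq0.
split=> [[h1 h2 h3]|[h1 h2 h3]]; split.
- move=> e; have := h1 e; rewrite pdiff_eq_dist => /eqP; rewrite mulf_eq0 (negPf two0) subr_eq0 => /eqP //.
- move=> a; have := h2 a; rewrite pdiff_eq_rs => /eqP; rewrite mulf_eq0 invr_eq0 (negPf mtot_neq0) => /eqP //.
- by move=> a; have := h3 a; rewrite pdiff_eq_ps.
- by move=> e; rewrite pdiff_eq_dist h1 subrr mulr0.
- by move=> a; rewrite pdiff_eq_rs h2 mulr0.
- by move=> a; rewrite pdiff_eq_ps h3.
Qed.

Definition chiC (e : pairs n) (i : 'I_n) : C := (i == pi1 e)%:R - (i == pi2 e)%:R.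
Lemma chi_sum (G : 'I_n -> C) e : \sum_i chiC e i * G i = G (pi1 e) - G (pi2 e).
Proof.
have single (j : 'I_n) : \sum_i (i == j)%:R * G i = G j.
  rewrite (bigD1 j) //= eqxx mul1r big1 ?addr0 // => i /negPf ->; exact: mul0r.
by rewrite -[G (pi1 e)]single -[G (pi2 e)]single -sumrB; apply: eq_bigr => i _; rewrite mulrBl.
Qed.

(** The gradient on M in the coordinates r: a distance d is there a function of r, with gradient chi
    * (separation) / d. *)
Definition gradr (F : ratfun R n) x i a : C :=
  rpartial F (vr i a) x + \sum_e rpartial F (vd e) x * (chiC e i * relv x e a / x (vd e)).
Definition gradp (F : ratfun R n) x i a : C := rpartial F (vp i a) x.

Lemma rdiff_grad F x w : inN x -> tangent m x w ->
  rdiff F x w = \sum_i \sum_a (gradr F x i a * w (vr i a) + gradp F x i a * w (vp i a)).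
Proof.
move=> hN /tangentP[hd _ _]; rewrite /rdiff sum_nv.
under [RHS]eq_bigr do rewrite big_split /=.
rewrite big_split /= addrAC; congr (_ + _).
have -> : \sum_e rpartial F (vd e) x * w (vd e) =
  \sum_i \sum_a (\sum_e rpartial F (vd e) x * (chiC e i * relv x e a / x (vd e))) * w (vr i a).
  transitivity (\sum_e \sum_i \sum_a rpartial F (vd e) x * (chiC e i * relv x e a / x (vd e)) * w (vr i a)).
    apply: eq_bigr => e _; have de := hN e.
    rewrite -[w (vd e)](mulKf de) hd mulrA mulr_sumr exchange_big /=; apply: eq_bigr => a _.
    rewrite -[relv w e a](chi_sum (fun i => w (vr i a))) !mulr_sumr.
    by apply: eq_bigr => i _; ring.
  rewrite exchange_big /=; apply: eq_bigr => i _.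
  by rewrite exchange_big /=; apply: eq_bigr => a _; rewrite mulr_suml.
rewrite -big_split; apply: eq_bigr => i _ /=; rewrite -big_split; apply: eq_bigr => a _ /=.
by rewrite mulrDl.
Qed.

(** Hamilton's equations, projected so that the centre of mass and the total momentum stay at 0;
    pairings with tangent vectors do not see the projection. *)
Definition vel F x i a := gradp F x i a - (cm (mtot m))^-1 * \sum_j cm (m j) * gradp F x j a.
Definition frc F x i a := - gradr F x i a + cm (m i) / cm (mtot m) * \sum_j gradr F x j a.
Definition hamX F x : point := mk_pt (vel F x) (frc F x)
  (fun e => (\sum_a relv x e a * (vel F x (pi1 e) a - vel F x (pi2 e) a)) / x (vd e)).

Lemma hamX_vec F x : inN x -> ham_vec m F x (hamX F x).
Proof.
move=> hN; have tX : tangent m x (hamX F x).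
  apply/tangentP; split.
  - move=> e; rewrite /hamX mk_vd mulrC divfK //; apply: eq_bigr => a _.
    by rewrite /relv !mk_vr.
  - move=> a; under eq_bigr do rewrite /hamX mk_vr /vel mulrBr.
    rewrite sumrB -mulr_suml -cm_sum -/(mtot m) mulrA divff ?mtot_neq0 // mul1r subrr //.
  - move=> a; under eq_bigr do rewrite /hamX mk_vp /frc.
    rewrite big_split /= sumrN -!mulr_suml -cm_sum -/(mtot m) divff ?mtot_neq0 // mul1r addNr //.
split=> // w tw; rewrite (rdiff_grad F hN tw) /omega.
have /tangentP[_ wr wp] := tw.
transitivity (\sum_i \sum_a (gradr F x i a * w (vr i a) + gradp F x i a * w (vp i a))
  - \sum_a (((cm (mtot m))^-1 * \sum_j cm (m j) * gradp F x j a) * \sum_i w (vp i a)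
  + ((cm (mtot m))^-1 * \sum_j gradr F x j a) * \sum_i cm (m i) * w (vr i a))).
  rewrite [in RHS](exchange_big) /= -sumrB exchange_big /=; apply: eq_bigr => a _.
  under eq_bigr do rewrite /hamX mk_vr mk_vp /vel /frc.
  move: (\sum_j cm (m j) * gradp F x j a) (\sum_j gradr F x j a) => U V.
  rewrite !mulr_sumr -big_split -sumrB; apply: eq_bigr => i _ /=; ring.
rewrite [X in _ - X]big1 ?subr0 // => a _; by rewrite wr wp !mulr0 addr0.
Qed.

Lemma card_var : nv n = (4 * n + #|{: pairs n}|)%N.
Proof. by rewrite /nv /var !card_sum !card_prod !card_ord; congr (_ + _)%N; lia. Qed.

Section Isotropy.
Variables (Is : seq (ratfun R n)) (x : point).
Hypotheses (hM : inM m x) (jac : jac_full_rank m Is x) (szI : size Is = (2 * (n - 1))%N).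
Local Notation I_ := (nth (0, 1) Is).
Hypothesis br : forall i j : 'I_(size Is), poisson_zero m (I_ i) (I_ j) x.

Let CT := (pairs n + ('I_2 + 'I_2) + 'I_(size Is))%type.
Definition covec (c : CT) (k : 'I_(nv n)) : C :=
  match c with
  | inl (inl e) => ((eq_dist R e)^`M(k)).@[x]
  | inl (inr (inl a)) => ((eq_rs m a)^`M(k)).@[x]
  | inl (inr (inr a)) => ((eq_ps R n a)^`M(k)).@[x]
  | inr j => rpartial (I_ j) k x
  end.
Definition Phi : 'M[C]_(nv n, #|{: CT}|) := \matrix_(k, c) covec (enum_val c) k.
Definition ptrow (w : point) : 'rV[C]_(nv n) := \row_k w k.

Lemma ptrow_Phi w c : (ptrow w *m Phi) 0 (enum_rank c) = \sum_k covec c k * w k.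
Proof. by rewrite mxE; apply: eq_bigr => k _; rewrite !mxE enum_rankK mulrC. Qed.

Lemma ptrow_Phi0 w : (ptrow w *m Phi = 0) <->
  tangent m x w /\ forall j : 'I_(size Is), rdiff (I_ j) x w = 0.
Proof.
split=> [h|[[h1 h2 h3] h4]].
  have hc c : \sum_k covec c k * w k = 0 by rewrite -ptrow_Phi h mxE.
  split; last by move=> j; exact: (hc (inr j)).
  by split; [move=> e; exact: (hc (inl (inl e)))|move=> a; exact: (hc (inl (inr (inl a))))
    |move=> a; exact: (hc (inl (inr (inr a))))].
apply/rowP => c; rewrite -[c]enum_valK ptrow_Phi mxE.
by case: (enum_val c) => [[e|[a|a]]|j]; [exact: h1|exact: h2|exact: h3|exact: h4].
Qed.

Lemma CT_sum (G : CT -> C) : \sum_c G c = \sum_e G (inl (inl e)) + \sum_a G (inl (inr (inl a)))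
  + \sum_a G (inl (inr (inr a))) + \sum_j G (inr j).
Proof. by rewrite !big_sumType /= addrA. Qed.

(** In a linear relation, [jac] removes the first integrals by testing on tangent vectors. The
    constraints are then removed by test vectors along the distances, the positions and the momenta,
    in this order. *)
Lemma Phi_free : row_free Phi^T.
Proof.
apply: inj_row_free => mu /rowP hmu.
have i0 : 'I_n := Ordinal (ltnW (ltnW n2)).
pose M c := mu 0 (enum_rank c).
have hw (w : point) : \sum_c M c * \sum_k covec c k * w k = 0.
  under eq_bigr do rewrite mulr_sumr; rewrite exchange_big big1 //= => k _.
  transitivity ((\sum_c M c * covec c k) * w k).
    by rewrite mulr_suml; apply: eq_bigr => c _; rewrite mulrA.
  have := hmu k; rewrite !mxE (reindex (@enum_rank CT)) /=; last first.
    by exists enum_val => c _; rewrite ?enum_valK ?enum_rankK.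
  by under eq_bigr do rewrite !mxE enum_rankK; rewrite /M => ->; rewrite mul0r.
have mj j : M (inr j) = 0.
  apply: (jac (lam := fun j => M (inr j))) => w [t1 t2 t3].
  have := hw w; rewrite CT_sum.
  rewrite big1 => [|e _]; last by rewrite [X in _ * X](t1 e) mulr0.
  rewrite big1 => [|a _]; last by rewrite [X in _ * X](t2 a) mulr0.
  rewrite big1 => [|a _]; last by rewrite [X in _ * X](t3 a) mulr0.
  by rewrite !add0r.
have hw' w : \sum_e M (inl (inl e)) * pdiff (eq_dist R e) x w
   + \sum_a M (inl (inr (inl a))) * pdiff (eq_rs m a) x w
   + \sum_a M (inl (inr (inr a))) * pdiff (eq_ps R n a) x w = 0.
  have s0 : \sum_j M (inr j) * \sum_k covec (inr j) k * w k = 0 by apply: big1 => j _; rewrite mj mul0r.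
  by have := hw w; rewrite CT_sum s0 addr0.
have [hN _ _ _] := hM.
have me e : M (inl (inl e)) = 0.
  have := hw' (mk_pt (fun _ _ => 0) (fun _ _ => 0) (fun f => (f == e)%:R)).
  rewrite [X in _ + X + _]big1 => [|a _]; last first.
    by rewrite pdiff_eq_rs big1 ?mulr0 // => i _; rewrite mk_vr mulr0.
  rewrite [X in _ + X]big1 => [|a _]; last first.
    by rewrite pdiff_eq_ps big1 ?mulr0 // => i _; rewrite mk_vp.
  rewrite !addr0 (bigD1 e) //= big1 => [|f fe]; last first.
    rewrite pdiff_eq_dist mk_vd (negPf fe) mulr0 big1 ?subrr ?mulr0 //.
    by move=> a _; rewrite /relv !mk_vr subrr mulr0.
  rewrite pdiff_eq_dist mk_vd eqxx mulr1 big1 ?subr0 ?addr0; last first.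
    by move=> a _; rewrite /relv !mk_vr subrr mulr0.
  move/eqP; rewrite !mulf_eq0 (negPf (hN e)) orbF pnatr_eq0 orbF => /eqP //.
have mr a : M (inl (inr (inl a))) = 0.
  have := hw' (mk_pt (fun i c => ((i == i0) && (c == a))%:R) (fun _ _ => 0) (fun _ => 0)).
  rewrite big1 => [|e _]; last by rewrite me mul0r.
  rewrite [X in _ + X]big1 => [|c _]; last first.
    by rewrite pdiff_eq_ps big1 ?mulr0 // => i _; rewrite mk_vp.
  rewrite add0r addr0 (bigD1 a) //= big1 => [|c ca]; last first.
    by rewrite pdiff_eq_rs big1 ?mulr0 // => i _; rewrite mk_vr (negPf ca) andbF mulr0.
  rewrite pdiff_eq_rs (bigD1 i0) //= big1 => [|i ii]; last by rewrite mk_vr (negPf ii) mulr0.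
  rewrite mk_vr !eqxx mulr1 !addr0 => /eqP; rewrite !mulf_eq0 invr_eq0 (negPf mtot_neq0) (negPf (cmi_neq0 _)) !orbF.
  by move/eqP.
have mp a : M (inl (inr (inr a))) = 0.
  have := hw' (mk_pt (fun _ _ => 0) (fun i c => ((i == i0) && (c == a))%:R) (fun _ => 0)).
  rewrite big1 => [|e _]; last by rewrite me mul0r.
  rewrite big1 => [|c _]; last by rewrite mr mul0r.
  rewrite !add0r (bigD1 a) //= big1 => [|c ca]; last first.
    by rewrite pdiff_eq_ps big1 ?mulr0 // => i _; rewrite mk_vp (negPf ca) andbF.
  rewrite pdiff_eq_ps (bigD1 i0) //= big1 => [|i ii]; last by rewrite mk_vp (negPf ii).
  by rewrite mk_vp !eqxx !addr0 mulr1.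
apply/rowP => c; rewrite -[c]enum_valK mxE -/(M _).
by case: (enum_val c) => [[e|[a|a]]|j].
Qed.

Definition Zeta : 'M[C]_(size Is, nv n) := \matrix_(j, k) hamX (I_ j) x k.

Lemma omega_suml (y : 'rV[C]_(size Is)) w :
  omega (fun k => (y *m Zeta) 0 k) w = \sum_j y 0 j * omega (hamX (I_ j) x) w.
Proof.
rewrite /omega; under [RHS]eq_bigr do rewrite mulr_sumr; rewrite [RHS]exchange_big; apply: eq_bigr => i _ /=.
under [RHS]eq_bigr do rewrite mulr_sumr; rewrite [RHS]exchange_big; apply: eq_bigr => a _ /=.
rewrite !mxE !mulr_suml -sumrB; apply: eq_bigr => j _; rewrite !mxE; ring.
Qed.

(** The common kernel has dimension nv - (number of pairs + 4 + 2(n - 1)) = 2(n - 1). The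
    Hamiltonian vectors of the integrals are as many, independent, and lie in it by involution, so
    they span it; and the pairing of the one of I_j with w' is dI_j(w') = 0. *)
Lemma common_kernel_isotropic w w' :
  tangent m x w -> (forall j : 'I_(size Is), rdiff (I_ j) x w = 0) ->
  tangent m x w' -> (forall j : 'I_(size Is), rdiff (I_ j) x w' = 0) ->
  omega w w' = 0.
Proof.
move=> tw dw tw' dw'; have [hN _ _ _] := hM.
have hX j := hamX_vec (I_ j) hN.
have Zfree : row_free Zeta.
  apply: inj_row_free => y hy; apply/rowP => j; rewrite mxE.
  apply: (jac (lam := fun j => y 0 j)) => v tv.
  transitivity (\sum_j y 0 j * omega (hamX (I_ j) x) v).
    by apply: eq_bigr => k _; rewrite (hX k).2.
  rewrite -omega_suml hy /omega big1 // => i _; rewrite big1 // => a _.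
  by rewrite !mxE !mul0r subrr.
have ZK : (Zeta <= kermx Phi)%MS.
  apply/sub_kermxP/row_matrixP => j; rewrite row_mul row0.
  have -> : row j Zeta = ptrow (hamX (I_ j) x) by apply/rowP => k; rewrite !mxE.
  by apply/ptrow_Phi0; split; [exact: (hX j).1|move=> k; exact: br (hX j)].
have rk : \rank (kermx Phi) = size Is.
  rewrite mxrank_ker -mxrank_tr; move: Phi_free => /eqP ->.
  rewrite !card_sum !card_ord card_var szI -[X in (X + (2 + 2) + _)%N]/#|{: pairs n}|; move: #|{: pairs n}| n2 => p; lia.
have KZ : (kermx Phi <= Zeta)%MS.
  have := (mxrank_leqif_sup ZK).2; rewrite rk; move: Zfree => /eqP ->.
  by rewrite eqxx => <-.
have : (ptrow w <= Zeta)%MS.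
  by apply: submx_trans KZ; apply/sub_kermxP/ptrow_Phi0.
move=> /submxP[y ey].
have -> : omega w w' = omega (fun k => (y *m Zeta) 0 k) w'.
  by rewrite -ey /omega; apply: eq_bigr => i _; apply: eq_bigr => a _; rewrite !mxE.
by rewrite omega_suml big1 // => j _; rewrite (hX j).2 // dw' mulr0.
Qed.
End Isotropy.
End Symplectic.

(** * Homogenised evaluation of polynomials *)

Lemma mpoly_ring_ind (N : nat) (K : comNzRingType) (T : {mpoly K[N]} -> Prop) :
  (forall c, T c%:MP) -> (forall i, T 'X_i) ->
  (forall f g, T f -> T g -> T (f + g)) -> (forall f g, T f -> T g -> T (f * g)) ->
  forall f, T f.
Proof.
move=> hC hX hD hM; elim/mpolyind => [|c mo p _ _ hp]; first by rewrite -mpolyC0; apply: hC.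
apply: (hD) => //; rewrite -mul_mpolyC; apply: (hM) => //.
rewrite mpolyXE_id; elim/big_rec: _ => [|i g _ hg]; first by rewrite -mpolyC1; apply: hC.
apply: (hM) => //; elim: (mo i) => [|k IH]; first by rewrite expr0 -mpolyC1; apply: hC.
by rewrite exprS; apply: (hM).
Qed.

Section Homogenise.
Variables (N : nat) (F K : comNzRingType) (k : {rmorphism F -> K}).
Implicit Types (f g : {mpoly F[N]}) (x : 'I_N -> K) (e : K).

Definition hcomp x f : {poly K} := mmap (polyC \o k) (fun i => x i *: 'X) f.

Lemma hcompC x c : hcomp x c%:MP = (k c)%:P. Proof. exact: mmapC. Qed.
Lemma hcompX x i : hcomp x 'X_i = x i *: 'X.
Proof. by rewrite /hcomp mmapX mmap1U. Qed.
Lemma hcompD x f g : hcomp x (f + g) = hcomp x f + hcomp x g.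
Proof. exact: raddfD. Qed.
Lemma hcompM x f g : hcomp x (f * g) = hcomp x f * hcomp x g.
Proof. by rewrite /hcomp rmorphM. Qed.

(* [e ^+ D * f (x / e)] when [f] has degree at most [D], without dividing by [e]. *)
Definition heval D f x e : K := \sum_(j < D.+1) (hcomp x f)`_j * e ^+ (D - j).
End Homogenise.

(** One bound for all target rings, because the same polynomial is evaluated at series and at
    complex points. *)
Definition deg_bound N (F : comNzRingType) (D : nat) (f : {mpoly F[N]}) :=
  forall (K : comNzRingType) (k : {rmorphism F -> K}) (x : 'I_N -> K), (size (hcomp k x f) <= D.+1)%N.

Lemma deg_boundW N (F : comNzRingType) (f : {mpoly F[N]}) D D' : (D <= D')%N -> deg_bound D f -> deg_bound D' f.
Proof. by move=> h b K k x; apply: leq_trans (b K k x) _. Qed.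

Lemma deg_bound_ex N (F : comNzRingType) (f : {mpoly F[N]}) : exists D, deg_bound D f.
Proof.
elim/mpoly_ring_ind: f => [c|i|f g [Df hf] [Dg hg]|f g [Df hf] [Dg hg]].
- by exists 0%N => K k x; rewrite hcompC size_polyC; case: eqP.
- by exists 1%N => K k x; rewrite hcompX (leq_trans (size_scale_leq _ _)) ?size_polyX.
- exists (maxn Df Dg) => K k x; rewrite hcompD (leq_trans (size_polyD _ _)) // geq_max.
  by rewrite (leq_trans (hf _ k x)) ?ltnS ?leq_maxl // (leq_trans (hg _ k x)) ?ltnS ?leq_maxr.
- exists (Df + Dg)%N => K k x; rewrite hcompM (leq_trans (size_polyMleq _ _)) //.
  by have := hf _ k x; have := hg _ k x; move: (size _) (size _) => a b; lia.
Qed.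

Lemma deg_bound_all N (F : comNzRingType) (s : seq {mpoly F[N]}) :
  exists D, forall f, f \in s -> deg_bound D f.
Proof.
elim: s => [|g s [D hD]]; first by exists 0%N.
have [D' hD'] := deg_bound_ex g; exists (maxn D D') => f; rewrite inE => /orP[/eqP->|fs].
  exact: deg_boundW (leq_maxr _ _) hD'.
exact: deg_boundW (leq_maxl _ _) (hD f fs).
Qed.

Lemma hevalE N (F : fieldType) (f : {mpoly F[N]}) D x e : deg_bound D f -> e != 0 ->
  heval idfun D f x e = e ^+ D * f.@[fun i => x i / e].
Proof.
move=> hD e0.
have -> : f.@[fun i => x i / e] = (hcomp idfun x f).[e^-1].
  elim/mpoly_ring_ind: f {hD} => [c|i|f g hf hg|f g hf hg].
  - by rewrite hcompC mevalC hornerC.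
  - by rewrite hcompX mevalXU hornerZ hornerX.
  - by rewrite hcompD mevalD hornerD hf hg.
  - by rewrite hcompM mevalM hornerM hf hg.
rewrite (horner_coef_wide _ (hD _ _ _)) mulr_sumr; apply: eq_bigr => j _.
rewrite mulrCA; congr (_ * _).
have jD : (j <= D)%N by rewrite -ltnS.
by move: jD; move: (nat_of_ord j) => l jD; rewrite -{2}(subnK jD) exprD -mulrA -exprMn divff // expr1n mulr1.
Qed.

Lemma heval_rmorph N (F K K' : comNzRingType) (k : {rmorphism F -> K}) (k' : {rmorphism F -> K'})
  (h : {rmorphism K -> K'}) (f : {mpoly F[N]}) D x e : (forall c, h (k c) = k' c) ->
  h (heval k D f x e) = heval k' D f (h \o x) (h e).
Proof.
move=> hk; have E : map_poly h (hcomp k x f) = hcomp k' (h \o x) f.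
  elim/mpoly_ring_ind: f => [c|i|f g hf hg|f g hf hg].
  - by rewrite !hcompC map_polyC /= hk.
  - by rewrite !hcompX map_polyZ /= map_polyX.
  - by rewrite !hcompD (raddfD (map_poly h)) -hf -hg.
  - by rewrite !hcompM (rmorphM (map_poly h)) -hf -hg.
rewrite /heval rmorph_sum; apply: eq_bigr => j _ /=.
by rewrite (rmorphM _ _ (e ^+ _)) rmorphXn -E coef_map.
Qed.

Lemma heval_place N (F : closedFieldType) (K : comNzRingType) (iota : {rmorphism F -> K})
  (A : K -> Prop) (phi : K -> F) (f : {mpoly F[N]}) D x e :
  subalg iota A -> (forall i, A (x i)) -> A e ->
  A (heval iota D f x e) /\ (place iota A phi ->
    phi (heval iota D f x e) = heval idfun D f (phi \o x) (phi e)).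
Proof.
move=> sA Ax Ae.
have [Ac pc] : (forall j, A (hcomp iota x f)`_j) /\ (place iota A phi ->
    forall j, phi (hcomp iota x f)`_j = (hcomp idfun (phi \o x) f)`_j).
  elim/mpoly_ring_ind: f => [c|i|f g [hf pf] [hg pg]|f g [hf pf] [hg pg]].
  - split=> [j|pl j]; rewrite !hcompC !coefC; case: ifP => _; rewrite ?(placeC pl) ?(place0 pl) //.
      exact: (subalgC sA). exact: (subalg0 sA).
  - split=> [j|pl j]; rewrite !hcompX !coefZ !coefX; case: (j == 1%N); rewrite ?mulr1 ?mulr0 ?(place0 pl) //.
    exact: (subalg0 sA).
  - split=> [j|pl j]; rewrite !hcompD !coefD; first exact: (subalgD sA).
    by rewrite (placeD pl) // pf // pg.
  - split=> [j|pl j]; rewrite !hcompM !coefM.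
      by apply: (subalg_sum sA) => l; apply: (subalgM sA).
    rewrite (place_sum sA pl) => [|l]; last by apply: (subalgM sA).
    by apply: eq_bigr => l _; rewrite (placeM pl) // pf // pg.
split=> [|pl].
  by apply: (subalg_sum sA) => l; apply: (subalgM sA) => //; apply: (subalgX sA).
rewrite /heval (place_sum sA pl) => [|l]; last by apply: (subalgM sA) => //; apply: (subalgX sA).
apply: eq_bigr => l _; rewrite (placeM pl) //; last exact: (subalgX sA).
by rewrite pc // (placeX sA pl).
Qed.

(** Chain rule for e^(D+1) f(x / e): the inner derivative d x / e uses up one power of e, whence D
    on the right. *)
Lemma heval_der N (F K : comNzRingType) (k : {rmorphism F -> K}) (d : K -> K)
  (f : {mpoly F[N]}) D x e : derivation d -> (forall c, d (k c) = 0) -> d e = 0 ->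
  d (heval k D.+1 f x e) = \sum_i heval k D f^`M(i) x e * d (x i).
Proof.
move=> dD dk de.
have dE l : d (e ^+ l) = 0.
  by elim: l => [|l IH]; rewrite ?expr0 ?(der1 dD) // exprS (derM dD) de IH mul0r mulr0 addr0.
have key : (d (hcomp k x f)`_0 = 0) /\ forall j, d (hcomp k x f)`_j.+1 = \sum_i (hcomp k x f^`M(i))`_j * d (x i).
  have d0 := der0 dD.
  elim/mpoly_ring_ind: f => [c|i|f g [f0 hf] [g0 hg]|f g [f0 hf] [g0 hg]].
  - split=> [|j]; first by rewrite hcompC coefC dk.
    rewrite hcompC coefC d0 big1 // => i _.
    by rewrite mderivC -mpolyC0 hcompC rmorph0 coef0 mul0r.
  - split=> [|j]; first by rewrite hcompX coefZ coefX mulr0.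
    rewrite hcompX coefZ coefX (bigD1 i) //= mderivX mnm1E eqxx scale1r.
    rewrite (_ : (U_(i) - U_(i))%MM = 0%MM); last by apply/mnmP => l; rewrite mnmBE subnn mnm0E.
    rewrite mpolyX0 -mpolyC1 hcompC rmorph1 coef1 big1 => [|l li]; last first.
      rewrite mderivX mnm1E eq_sym (negPf li) scale0r -mpolyC0 hcompC rmorph0 coef0 mul0r //.
    rewrite eqSS addr0; case: (j == 0%N); rewrite ?mulr1 ?mul1r ?mulr0 ?mul0r //.
  - split=> [|j]; first by rewrite hcompD coefD dD.1 f0 g0 addr0.
    rewrite hcompD coefD dD.1 hf hg -big_split; apply: eq_bigr => i _ /=.
    by rewrite mderivD hcompD coefD mulrDl.
  - split=> [|j]; first by rewrite hcompM coefM big_ord1 (derM dD) f0 g0 mul0r mulr0 addr0.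
    rewrite hcompM coefM (der_sum dD).
    under eq_bigr do rewrite (derM dD).
    rewrite big_split /= big_ord_recl f0 mul0r add0r [X in _ + X]big_ord_recr /= subnn g0 mulr0 addr0.
    under eq_bigr => l _ do rewrite subSS hf mulr_suml.
    under [X in _ + X]eq_bigr => l _ do rewrite /= subSn ?(ltnSE (ltn_ord l)) // hg mulr_sumr.
    rewrite [X in X + _ = _]exchange_big [X in _ + X = _]exchange_big /= -big_split; apply: eq_bigr => i _ /=.
    rewrite mderivM hcompD !hcompM coefD !coefM mulrDl !mulr_suml; congr (_ + _); apply: eq_bigr => l _; ring.
case: key => k0 kS; rewrite /heval (der_sum dD).
under eq_bigr do rewrite (derM dD) dE mulr0 addr0.
rewrite big_ord_recl k0 mul0r add0r.
under eq_bigr => l _ do rewrite /= subSS kS mulr_suml.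
rewrite exchange_big /=; apply: eq_bigr => i _; rewrite mulr_suml; apply: eq_bigr => l _; ring.
Qed.

(** * Conservation laws *)

Section Conservation.
Variables (F : numFieldType) (q : nat) (tm : 'I_q -> F) (S : hyperlog tm).
Local Notation solser := (solser S).
Local Notation epsser := (epsser F).
Local Notation cB := (cB S).
Local Notation kB := (kB S).
Variables (I P : finType) (chi : P -> I -> F) (m : I -> F) (mm : P -> F).
Hypothesis m0 : forall i, m i != 0.
Variables (al be : I -> F) (s : P -> F) (lam : P -> 'I_q).
Local Notation ae := (pair_diff chi id al).
Local Notation bee := (pair_diff chi id be).
Hypotheses (s2 : forall e, s e * s e = 1) (be0 : forall e, bee e != 0)
  (tmE : forall e, ae e = - bee e * tm (lam e)).
Variables (rh ph : I -> 'I_2 -> epsser).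
Variables (Pi : I -> 'I_2 -> solser) (dh ih : P -> solser).
Local Notation r := (rho m al be rh ph Pi).
Local Notation p := (pii m be ph Pi).
Local Notation del := (del chi be s lam dh).
Local Notation iot := (iot chi be s lam ih).
Local Notation rel := (rlB chi r).
Local Notation force := (force chi m mm al be s lam rh ph Pi ih).
Hypotheses (hPi : forall i a, Pi i a = IB (force i a))
  (hdh : forall e, dh e = newdel chi m be s lam rh ph Pi dh e)
  (hih : forall e, ih e = newiot chi m be s lam rh ph Pi dh ih e).

Lemma d_rel e a : dB (rel e a) = \sum_i cB (chi e i) * (cB (m i)^-1 * p i a).
Proof.
rewrite /rlB /pair_diff (der_sum (dB_der S)); apply: eq_bigr => i _.
by rewrite dB_cM d_rho.
Qed.

(** Applied to d/dt it gives the evolution of the distances, to [NB b] the tangency of the monodromy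
    vectors. *)
Lemma der_del (d : solser -> solser) e : derivation d -> del e * d (del e) = \sum_a rel e a * d (rel e a).
Proof.
move=> dD; have h : d (del e ^+ 2) = d (rel e 0 ^+ 2 + rel e 1 ^+ 2) by rewrite (del_sq s2 be0 tmE hdh).
move: h; rewrite dD.1 !expr2 !(derM dD) => h.
have c2 := cB2K S.
rewrite sum2.
transitivity (cB 2^-1 * (d (del e) * del e + del e * d (del e))).
  transitivity (2 * cB 2^-1 * (del e * d (del e))); [by rewrite c2 mul1r|ring].
rewrite h.
transitivity (2 * cB 2^-1 * (rel e 0 * d (rel e 0) + rel e 1 * d (rel e 1))); first by ring.
by rewrite c2 mul1r.
Qed.
Lemma d_del e : del e * dB (del e) = \sum_a rel e a * dB (rel e a).
Proof. exact/der_del/dB_der. Qed.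

Lemma d_iot e : dB (iot e) = - (iot e ^+ 3 * \sum_a rel e a * dB (rel e a)).
Proof.
have id1 := iot_del s2 be0 hdh hih e.
have h : dB (iot e * del e) = 0 by rewrite id1 (der1 (dB_der S)).
move: h; rewrite (derM (dB_der S)) -d_del => h.
have -> : dB (iot e) = dB (iot e) * del e * iot e by rewrite -mulrA (mulrC (del e)) id1 mulr1.
have -> : dB (iot e) * del e = - (iot e * dB (del e)) by apply/eqP; rewrite -addr_eq0 h.
transitivity (- (iot e ^+ 2 * dB (del e) * (iot e * del e))); last by ring.
by rewrite id1; ring.
Qed.

Section Linear.
Hypotheses (chi0 : forall e, \sum_i chi e i = 0)
  (comal : \sum_i m i * al i = 0) (combe : \sum_i m i * be i = 0)
  (comrh : forall a, \sum_i shC (m i) * rh i a = 0) (comph : forall a, \sum_i ph i a = 0).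

Lemma sum_p a : \sum_i p i a = 0.
Proof.
apply: const_flat.
  rewrite (der_sum (dB_der S)) (eq_bigr (fun i => eps ^+ 3 * force i a)) => [|i _]; last by rewrite (d_pii hPi).
  rewrite -mulr_sumr /force sumrN exchange_big big1 ?oppr0 ?mulr0 //= => e _.
  transitivity (cB (\sum_i chi e i) * (cB (mm e) * (iot e ^+ 3 * rel e a))).
    by rewrite rmorph_sum mulr_suml; apply: eq_bigr => i _; rewrite /= rmorphM; ring.
  by rewrite chi0 rmorph0 mul0r.
rewrite rmorph_sum /=; under eq_bigr do rewrite (ev_pii hPi).
rewrite big_split /= -mulr_sumr comph mulr0 addr0.
by case: (a == 0); [rewrite -rmorph_sum combe rmorph0|rewrite big1].
Qed.

Lemma sum_r a : \sum_i cB (m i) * r i a = 0.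
Proof.
apply: const_flat.
  rewrite (der_sum (dB_der S)) (eq_bigr (fun i => p i a)) ?sum_p // => i _.
  by rewrite dB_cM d_rho // mulrA -rmorphM divff // rmorph1 mul1r.
rewrite rmorph_sum /=; under eq_bigr do rewrite rmorphM /= evB_c ev_rho mulrDr mulrCA.
rewrite big_split /= -mulr_sumr comrh mulr0 addr0.
case: (a == 0); last by rewrite big1 // => i _; rewrite mulr0.
by under eq_bigr do rewrite -rmorphM; rewrite -rmorph_sum comal rmorph0.
Qed.
End Linear.

Definition energy : solser := \sum_i cB (2 * m i)^-1 * \sum_a p i a ^+ 2 - eps ^+ 3 * \sum_e cB (mm e) * iot e.
Lemma d_energy : dB energy = 0.
Proof.
rewrite /energy (derB (dB_der S)) dB_epsM !(der_sum (dB_der S)).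
apply/eqP; rewrite subr_eq0; apply/eqP.
have c2 := cB2K S.
transitivity (eps ^+ 3 * \sum_i \sum_a cB (m i)^-1 * p i a * force i a).
  rewrite mulr_sumr; apply: eq_bigr => i _.
  rewrite dB_cM (der_sum (dB_der S)) mulr_sumr mulr_sumr; apply: eq_bigr => a _.
  rewrite expr2 (derM (dB_der S)) (d_pii hPi) invfM rmorphM.
  transitivity (2 * cB 2^-1 * (eps ^+ 3 * (cB (m i)^-1 * p i a * force i a))); first by ring.
  by rewrite c2 mul1r.
congr (_ * _).
transitivity (- \sum_e cB (mm e) * (iot e ^+ 3 * \sum_a rel e a * dB (rel e a))); last first.
  by rewrite -sumrN; apply: eq_bigr => e _; rewrite dB_cM d_iot mulrN.
transitivity (- \sum_i \sum_a \sum_e cB (m i)^-1 * p i a * (cB (mm e * chi e i) * iot e ^+ 3 * rel e a)).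
  rewrite -sumrN; apply: eq_bigr => i _; rewrite -sumrN; apply: eq_bigr => a _.
  by rewrite /force mulrN mulr_sumr.
congr (- _); under eq_bigr do rewrite exchange_big /=.
rewrite exchange_big /=; apply: eq_bigr => e _.
rewrite exchange_big /= !mulr_sumr; apply: eq_bigr => a _.
rewrite d_rel !mulr_sumr; apply: eq_bigr => i _.
rewrite rmorphM; ring.
Qed.

Definition angmom : solser := \sum_i (r i 0 * p i 1 - r i 1 * p i 0).
Lemma d_angmom : dB angmom = 0.
Proof.
rewrite /angmom (der_sum (dB_der S)).
transitivity (eps ^+ 3 * \sum_i (r i 0 * force i 1 - r i 1 * force i 0)).
  rewrite mulr_sumr; apply: eq_bigr => i _.
  rewrite (derB (dB_der S)) !(derM (dB_der S)) !d_rho // !(d_pii hPi); ring.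
rewrite [X in _ * X](_ : _ = 0) ?mulr0 //.
transitivity (- \sum_i \sum_e cB (mm e) * iot e ^+ 3 * (cB (chi e i) * r i 0 * rel e 1 - cB (chi e i) * r i 1 * rel e 0)).
  rewrite -sumrN; apply: eq_bigr => i _.
  rewrite /force !mulrN !mulr_sumr opprK -!sumrN -big_split; apply: eq_bigr => e _ /=.
  rewrite rmorphM; ring.
rewrite exchange_big big1 ?oppr0 // => e _ /=.
rewrite -mulr_sumr sumrB -!mulr_suml -/(pair_diff chi cB (fun i => r i 0) e) -/(pair_diff chi cB (fun i => r i 1) e).
by rewrite -!/(rlB _ _ _ _) (mulrC (rel e 1)) subrr mulr0.
Qed.
End Conservation.

(** * The Hamiltonian vector field *)

Section Flow.
Variables (R : realType) (n : nat) (m : 'I_n -> R).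
Local Notation C := R[i].
Local Notation point := ('I_(nv n) -> C).
Hypotheses (n2 : (2 < n)%N) (m_gt0 : forall i, 0 < m i).
Implicit Types (x w : point).
Local Notation cmm e := (cm (m (pi1 e) * m (pi2 e))).

Lemma cmM (a b : R) : cm (a * b) = cm a * cm b.
Proof. by apply/eqP; rewrite /cm /= eq_complex /= !mulr0 !mul0r subr0 addr0 !eqxx. Qed.

Lemma cm2M (a : R) : cm (2 * a) = 2 * cm a.
Proof. by rewrite cmM; congr (_ * _); rewrite /cm -[RHS]/(1 + 1) -[2]/(1 + 1); simpc. Qed.

Lemma eval_Hden x : (Hden R n).@[x] = \prod_e x (vd e).
Proof. by rewrite /Hden rmorph_prod; apply: eq_bigr => e _; rewrite /= mevalXU. Qed.
Lemma Hden_neq0 x : inN x <-> (Hden R n).@[x] != 0.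
Proof.
rewrite eval_Hden; split=> [h|/prodf_neq0 h e]; last exact: (h e isT).
by apply/prodf_neq0 => e _; apply: h.
Qed.

Local Notation V e := (\prod_(e' : pairs n | e' != e) Xd R e' : {mpoly C[nv n]}).
Lemma XdV e : Xd R e * V e = Hden R n.
Proof. by rewrite /Hden [RHS](bigD1 e). Qed.

Lemma eval_V x e : inN x -> (V e).@[x] = (Hden R n).@[x] / x (vd e).
Proof. by move=> h; rewrite -(XdV e) mevalM mevalXU mulrC mulKf. Qed.

Lemma reval_H x : inN x -> reval (Hrat m) x =
  \sum_i (cm (2 * m i))^-1 * \sum_a x (vp i a) ^+ 2 - \sum_e cmm e / x (vd e).
Proof.
move=> h; have d0 := (Hden_neq0 x).1 h; rewrite /reval /= /Hnum mevalB mevalM mulrBl mulfK //.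
congr (_ - _).
  rewrite meval_bigsum; apply: eq_bigr => i _; rewrite mevalZ meval_bigsum; congr (_ * _).
  by apply: eq_bigr => a _; rewrite rmorphXn /= mevalXU.
rewrite meval_bigsum mulr_suml; apply: eq_bigr => e _.
by rewrite mevalZ eval_V // -mulrA; congr (_ * _); rewrite mulrAC divff // mul1r.
Qed.

Lemma reval_C x : reval (Crat R n) x = \sum_i (x (vr i 0) * x (vp i 1) - x (vr i 1) * x (vp i 0)).
Proof.
rewrite /reval /= meval1 divr1 meval_bigsum; apply: eq_bigr => i _.
rewrite sum2 mevalD !meval_bigsum !sum2 !mevalZ !mevalM !mevalXU !mxE /=; ring.
Qed.

Lemma rdiff_H h x w : inN x -> rdiff (rsubc (Hrat m) h) x w =
  \sum_i (cm (m i))^-1 * \sum_a x (vp i a) * w (vp i a) + \sum_e cmm e * w (vd e) / x (vd e) ^+ 2.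
Proof.
move=> hN; have d0 := (Hden_neq0 x).1 hN; rewrite rdiffE /=.
set Q := (Hden R n).@[x] in d0 *; set dQ := pdiff (Hden R n) x w.
rewrite /Hnum !pdiffB pdiffZ !mevalB mevalZ pdiffM mevalM -/Q -/dQ.
have dV e : pdiff (V e) x w = (dQ - w (vd e) * Q / x (vd e)) / x (vd e).
  rewrite /dQ -(XdV e) pdiffM pdiffX mevalXU eval_V // -/Q.
  by have de := hN e; field.
have -> : pdiff (\sum_e cmm e *: V e) x w = \sum_e cmm e * (dQ - w (vd e) * Q / x (vd e)) / x (vd e).
  by rewrite pdiff_sum; apply: eq_bigr => e _; rewrite pdiffZ dV mulrA.
have -> : (\sum_e cmm e *: V e).@[x] = \sum_e cmm e * (Q / x (vd e)).
  by rewrite meval_bigsum; apply: eq_bigr => e _; rewrite mevalZ eval_V.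
have -> : pdiff (Hkin m) x w = \sum_i (cm (m i))^-1 * \sum_a x (vp i a) * w (vp i a).
  rewrite pdiff_sum; apply: eq_bigr => i _.
  rewrite pdiffZ pdiff_sum !mulr_sumr; apply: eq_bigr => a _.
  rewrite pdiff_sq pdiffX mevalXU cmM invfM.
  have -> : cm 2 = 2 :> C by rewrite /cm -[RHS]/(1 + 1) -[2]/(1 + 1); simpc.
  by rewrite mulrACA mulVf ?mul1r // pnatr_eq0.
set T := \sum_i _; set K := (Hkin m).@[x].
transitivity (T + (Q * - (\sum_e cmm e * (dQ - w (vd e) * Q / x (vd e)) / x (vd e)) + (\sum_e cmm e * (Q / x (vd e))) * dQ) / Q ^+ 2).
  by field.
congr (_ + _); rewrite mulrN mulr_sumr -sumrN mulr_suml -big_split mulr_suml; apply: eq_bigr => e _ /=.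
have de := hN e; field; by rewrite de d0.
Qed.

Lemma ham_flow h x w : inN x ->
  (forall a, \sum_i x (vp i a) = 0) ->
  (forall i a, w (vr i a) = (cm (m i))^-1 * x (vp i a)) ->
  (forall i a, w (vp i a) = - \sum_e cmm e * chiC R e i * (x (vd e))^-1 ^+ 3 * relv x e a) ->
  (forall e, x (vd e) * w (vd e) = \sum_a relv x e a * relv w e a) ->
  ham_vec m (rsubc (Hrat m) h) x w.
Proof.
move=> hN hp wr wp wd; have wt : tangent m x w.
  apply/(tangentP n2 m_gt0); split=> // a.
    by under eq_bigr do rewrite wr mulrA divff ?(cmi_neq0 m_gt0) // mul1r.
  under eq_bigr do rewrite wp.
  rewrite sumrN exchange_big big1 ?oppr0 //= => e _.
  have := chi_sum (fun _ => 1 : C) e; rewrite /= subrr => c0.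
  transitivity ((\sum_i chiC R e i * 1) * (cmm e * (x (vd e))^-1 ^+ 3 * relv x e a)); last by rewrite c0 mul0r.
  by rewrite mulr_suml; apply: eq_bigr => i _; ring.
split=> // v /(tangentP n2 m_gt0)[vd_ vr_ vp_].
rewrite rdiff_H // /omega.
under eq_bigr do rewrite sumrB; rewrite sumrB; congr (_ + _).
  by apply: eq_bigr => i _; rewrite mulr_sumr; apply: eq_bigr => a _; rewrite wr mulrA.
rewrite -sumrN.
transitivity (\sum_i \sum_a \sum_e cmm e * (x (vd e))^-1 ^+ 3 * relv x e a * (chiC R e i * v (vr i a))).
  apply: eq_bigr => i _; rewrite -sumrN; apply: eq_bigr => a _.
  rewrite wp mulNr opprK mulr_suml; apply: eq_bigr => e _; ring.
under eq_bigr do rewrite exchange_big; rewrite exchange_big; apply: eq_bigr => e _ /=.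
rewrite exchange_big /=; under eq_bigr do rewrite -mulr_sumr chi_sum -/(relv v _ _).
have de := hN e.
transitivity (cmm e * (x (vd e))^-1 ^+ 3 * \sum_a relv x e a * relv v e a).
  by rewrite mulr_sumr; apply: eq_bigr => a _; rewrite mulrA.
rewrite -vd_; by field.
Qed.

Lemma inMhcP h c x : inMhc m h c x <->
  inN x /\ [/\ forall e, x (vd e) ^+ 2 = \sum_a relv x e a ^+ 2,
    forall a, \sum_i cm (m i) * x (vr i a) = 0,
    forall a, \sum_i x (vp i a) = 0,
    \sum_i (cm (2 * m i))^-1 * \sum_a x (vp i a) ^+ 2 - \sum_e cmm e / x (vd e) = h &
    \sum_i (x (vr i 0) * x (vp i 1) - x (vr i 1) * x (vp i 0)) = c].
Proof.
have t0 := mtot_neq0 n2 m_gt0.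
split=> [[[hN hd hr hp] _ hH hC]|[hN [hd hr hp hH hC]]].
  split=> //; split.
  - by move=> e; have := hd e; rewrite eval_eq_dist => /eqP; rewrite subr_eq0 => /eqP.
  - by move=> a; have := hr a; rewrite eval_eq_rs => /eqP; rewrite mulf_eq0 invr_eq0 (negPf t0) => /eqP.
  - by move=> a; have := hp a; rewrite eval_eq_ps.
  - by rewrite -reval_H.
  - by rewrite -reval_C.
split; [split| |by rewrite reval_H|by rewrite reval_C] => //.
- by move=> e; rewrite eval_eq_dist hd subrr.
- by move=> a; rewrite eval_eq_rs hr mulr0.
- by move=> a; rewrite eval_eq_ps hp.
- exact/(Hden_neq0 x).1.
Qed.
End Flow.

(** * Rational functions at places *)

Section RationalAtPlace.
Variables (R : realType) (N : nat).
Local Notation C := R[i].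

(** When the partial derivatives of f have degree at most D, this is e^(D+1) times the differential
    of f at X / e in the direction Y / e. *)
Definition heval_diff (K : comNzRingType) (k : {rmorphism C -> K}) D (f : {mpoly C[N]}) (X Y : 'I_N -> K) (e : K) : K :=
  \sum_i heval k D f^`M(i) X e * Y i.

End RationalAtPlace.

Section Places.
Variables (R : realType) (n : nat) (m : 'I_n -> R).
Local Notation C := R[i].
Local Notation point := ('I_(nv n) -> C).
Hypotheses (n2 : (2 < n)%N) (m_gt0 : forall i, 0 < m i).
Local Notation cmm e := (cm (m (pi1 e) * m (pi2 e))).
Local Notation ratfun := (ratfun R n).

Lemma rdiff_heval (G : ratfun) D (X Y : point) (e : C) : e != 0 ->
  deg_bound D.+1 G.1 -> deg_bound D.+1 G.2 -> (forall i, deg_bound D G.1^`M(i)) -> (forall i, deg_bound D G.2^`M(i)) ->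
  heval idfun D.+1 G.2 X e != 0 ->
  heval idfun D.+1 G.2 X e * heval_diff idfun D G.1 X Y e - heval idfun D.+1 G.1 X e * heval_diff idfun D G.2 X Y e =
  heval idfun D.+1 G.2 X e ^+ 2 * rdiff G (fun k => X k / e) (fun k => Y k / e).
Proof.
move=> e0 b1 b2 d1 d2; rewrite (hevalE _ b1 e0) (hevalE _ b2 e0) rdiffE mulf_eq0 negb_or => /andP[_ q0].
have hd (f : {mpoly C[nv n]}) : (forall i, deg_bound D f^`M(i)) ->
    heval_diff idfun D f X Y e = e ^+ D.+1 * pdiff f (fun k => X k / e) (fun k => Y k / e).
  move=> df; rewrite /pdiff mulr_sumr; apply: eq_bigr => i _.
  rewrite hevalE // exprS; by field.
rewrite (hd _ d1) (hd _ d2); move: (e ^+ D.+1) (_.@[_]) (_.@[_]) (pdiff _ _ _) (pdiff _ _ _) q0 => E Q P a b Q0; by field.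
Qed.

Variables (K : comNzRingType) (iota : {rmorphism C -> K}) (A : K -> Prop) (phi : K -> C).
Hypotheses (sA : subalg iota A) (pl : place iota A phi).
Variables (X Y : 'I_(nv n) -> K) (e : K) (io : pairs n -> K) (h c : C).
Hypotheses (AX : forall k, A (X k)) (AY : forall k, A (Y k)) (Ae : A e) (Aio : forall p, A (io p)).
Hypothesis e0 : phi e != 0.
Definition relK (Z : 'I_(nv n) -> K) p a : K := Z (vr (pi1 p) a) - Z (vr (pi2 p) a).

Ltac inA := repeat first [exact: AX | exact: AY | exact: Ae | exact: Aio | exact: (subalgC sA) | apply: (subalgX sA)
  | apply: (subalgB sA) | apply: (subalgN sA) | apply: (subalgM sA) | (apply: (subalg_sum sA) => ?) | apply: (subalgD sA) ].

Hypotheses (iod : forall p, io p * X (vd p) = 1)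
  (dist : forall p, X (vd p) ^+ 2 = \sum_a relK X p a ^+ 2).

Lemma phi_rel Z p a : (forall k, A (Z k)) -> phi (relK Z p a) = phi (Z (vr (pi1 p) a)) - phi (Z (vr (pi2 p) a)).
Proof. by move=> AZ; rewrite /relK (placeD pl) ?(placeN sA pl) //; apply: (subalgN sA). Qed.
Lemma ArelX p a : A (relK X p a). Proof. by rewrite /relK; inA. Qed.
Lemma ArelY p a : A (relK Y p a). Proof. by rewrite /relK; inA. Qed.
Lemma phi_iod p : phi (io p) * phi (X (vd p)) = 1.
Proof. by rewrite -(placeM pl) // iod (place1 pl). Qed.
Lemma phi_d0 p : phi (X (vd p)) != 0.
Proof. by have := oner_neq0 C; rewrite -(phi_iod p); apply: contraNneq => ->; rewrite mulr0. Qed.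
Lemma phi_io p : phi (io p) = (phi (X (vd p)))^-1.
Proof. by rewrite -[LHS](mulfK (phi_d0 p)) phi_iod mul1r. Qed.
Lemma relv_div (Z : 'I_(nv n) -> K) p a : (forall k, A (Z k)) -> relv (fun k => phi (Z k) / phi e) p a = phi (relK Z p a) / phi e.
Proof. by move=> AZ; rewrite phi_rel // mulrBl. Qed.

(** The hypotheses are the equations of the level at X / e, cleared of powers of e, as they hold for
    series; inverse distances come as separate data [io] since K need not have them otherwise. *)
Lemma place_inMhc :
  (forall a, \sum_i iota (cm (m i)) * X (vr i a) = 0) ->
  (forall a, \sum_i X (vp i a) = 0) ->
  \sum_i iota (cm (2 * m i))^-1 * (\sum_a X (vp i a) ^+ 2) - e ^+ 3 * (\sum_p iota (cmm p) * io p) = iota h * e ^+ 2 ->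
  \sum_i (X (vr i 0) * X (vp i 1) - X (vr i 1) * X (vp i 0)) = iota c * e ^+ 2 ->
  inMhc m h c (fun k => phi (X k) / phi e).
Proof.
move=> hr hp hH hC; apply/(inMhcP n2 m_gt0).
have hN : inN (fun k => phi (X k) / phi e) by move=> p; rewrite mulf_neq0 ?invr_eq0 ?phi_d0.
have AR := ArelX.
split=> //; split.
- move=> p; under eq_bigr do rewrite relv_div // expr_div_n.
  rewrite -mulr_suml expr_div_n -(placeX sA pl) // dist (place_sum sA pl); last by move=> a; apply: (subalgX sA).
  by congr (_ * _); apply: eq_bigr => a _; rewrite (placeX sA pl).
- move=> a; have := congr1 phi (hr a); rewrite (place_sum sA pl) ?(place0 pl) => [hh|i]; last by inA.
  under eq_bigr do rewrite mulrA; rewrite -mulr_suml.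
  transitivity (0 / phi e); last by rewrite mul0r.
  congr (_ / _); rewrite -[RHS]hh; apply: eq_bigr => i _.
  by rewrite (placeM pl) ?(placeC pl) //; inA.
- move=> a; have := congr1 phi (hp a); rewrite (place_sum sA pl) ?(place0 pl) => [hh|i]; last by inA.
  by rewrite -mulr_suml hh mul0r.
- have := congr1 phi hH; rewrite (placeD pl) ?(placeN sA pl) ?(placeM pl) ?(placeC pl) ?(placeX sA pl); try by inA.
  rewrite !(place_sum sA pl) => [|p|i]; try by inA.
  move=> hh; apply: (mulIf (expf_neq0 2 e0)); rewrite -[RHS]hh mulrBl; congr (_ - _).
    rewrite mulr_suml; apply: eq_bigr => i _.
    rewrite (placeM pl) ?(placeC pl) ?(place_sum sA pl) => [|a||]; try by inA.
    rewrite -mulrA mulr_suml; congr (_ * _); apply: eq_bigr => a _.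
    rewrite (placeX sA pl) //; by field.
  rewrite mulr_suml mulr_sumr; apply: eq_bigr => p _.
  rewrite (placeM pl) ?(placeC pl) ?phi_io //; last by inA.
  have := phi_d0 p; move: (phi (X _)) => d d0; by field; rewrite d0.
- have := congr1 phi hC; rewrite (place_sum sA pl) ?(placeM pl) ?(placeC pl) ?(placeX sA pl) //; try by [inA|move=> i; inA].
  move=> hh; apply: (mulIf (expf_neq0 2 e0)); rewrite -[RHS]hh mulr_suml; apply: eq_bigr => i _.
  rewrite (placeD pl) ?(placeN sA pl) ?(placeM pl) //; try by inA.
  by field.
Qed.

Lemma place_flow :
  (forall a, \sum_i X (vp i a) = 0) ->
  (forall i a, Y (vr i a) = iota (cm (m i))^-1 * X (vp i a)) ->
  (forall i a, Y (vp i a) = e ^+ 3 * - (\sum_p iota (cmm p * chiC R p i) * io p ^+ 3 * relK X p a)) ->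
  (forall p, X (vd p) * Y (vd p) = \sum_a relK X p a * relK Y p a) ->
  ham_vec m (rsubc (Hrat m) h) (fun k => phi (X k) / phi e) (fun k => phi (Y k) / phi e).
Proof.
move=> hp yr yp yd; have AR := ArelX; have ARY := ArelY.
apply: (ham_flow n2 m_gt0).
- by move=> p; rewrite mulf_neq0 ?invr_eq0 ?phi_d0.
- move=> a; have := congr1 phi (hp a); rewrite (place_sum sA pl) ?(place0 pl) => [hh|i]; last by inA.
  by rewrite -mulr_suml hh mul0r.
- by move=> i a; rewrite yr (placeM pl) ?(placeC pl) ?mulrA //; inA.
- move=> i a; rewrite yp (placeM pl) ?(placeX sA pl) ?(placeN sA pl) ?(place_sum sA pl) //; try by [inA|move=> p; inA].
  rewrite mulrN mulNr; congr (- _); rewrite mulr_sumr mulr_suml.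
  apply: eq_bigr => p _; rewrite relv_div // (placeM pl) ?(placeM pl) ?(placeC pl) ?(placeX sA pl) ?phi_io //; try by inA.
  by have := phi_d0 p; move: (phi (X _)) => d d0; field; rewrite d0 e0.
- move=> p; have := congr1 phi (yd p); rewrite (placeM pl) // (place_sum sA pl); last by move=> a; apply: (subalgM sA).
  move=> hh; transitivity ((phi (X (vd p)) * phi (Y (vd p))) / phi e ^+ 2); first by field.
  rewrite hh mulr_suml; apply: eq_bigr => a _; rewrite !relv_div // (placeM pl) //; by field.
Qed.

Lemma place_tangent :
  (forall a, \sum_i iota (cm (m i)) * Y (vr i a) = 0) ->
  (forall a, \sum_i Y (vp i a) = 0) ->
  (forall p, X (vd p) * Y (vd p) = \sum_a relK X p a * relK Y p a) ->
  tangent m (fun k => phi (X k) / phi e) (fun k => phi (Y k) / phi e).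
Proof.
move=> hr hp yd; have AR := ArelX; have ARY := ArelY; apply/(tangentP n2 m_gt0); split.
- move=> p; have := congr1 phi (yd p); rewrite (placeM pl) // (place_sum sA pl); last by move=> a; apply: (subalgM sA).
  move=> hh; transitivity ((phi (X (vd p)) * phi (Y (vd p))) / phi e ^+ 2); first by field.
  rewrite hh mulr_suml; apply: eq_bigr => a _; rewrite !relv_div // (placeM pl) //; by field.
- move=> a; have := congr1 phi (hr a); rewrite (place_sum sA pl) ?(place0 pl) => [hh|i]; last by inA.
  under eq_bigr do rewrite mulrA; rewrite -mulr_suml.
  transitivity (0 / phi e); last by rewrite mul0r.
  congr (_ / _); rewrite -[RHS]hh; apply: eq_bigr => i _.
  by rewrite (placeM pl) ?(placeC pl) //; inA.
- move=> a; have := congr1 phi (hp a); rewrite (place_sum sA pl) ?(place0 pl) => [hh|i]; last by inA.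
  by rewrite -mulr_suml hh mul0r.
Qed.

Lemma place_heval f D : phi (heval iota D f X e) = heval idfun D f (phi \o X) (phi e).
Proof. exact: (heval_place phi f D sA AX Ae).2. Qed.
Lemma subalg_heval f D : A (heval iota D f X e). Proof. exact: (heval_place phi f D sA AX Ae).1. Qed.
Lemma subalg_heval_diff f D : A (heval_diff iota D f X Y e).
Proof. by apply: (subalg_sum sA) => k; apply: (subalgM sA); [exact: subalg_heval|exact: AY]. Qed.
Lemma place_heval_diff f D : phi (heval_diff iota D f X Y e) = heval_diff idfun D f (phi \o X) (phi \o Y) (phi e).
Proof.
rewrite (place_sum sA pl) => [|k]; last by apply: (subalgM sA); [exact: subalg_heval|exact: AY].
by apply: eq_bigr => k _; rewrite (placeM pl) ?place_heval //; exact: subalg_heval.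
Qed.
Lemma place_minor (a b a' b' : K) : A a -> A b -> A a' -> A b' ->
  phi (a * b - a' * b') = phi a * phi b - phi a' * phi b'.
Proof.
move=> Aa Ab Aa' Ab'; have Acd := subalgM sA Aa' Ab'.
by rewrite (placeD pl) ?(placeN sA pl) ?(placeM pl) //; [apply: (subalgM sA)|apply: (subalgN sA)].
Qed.

Lemma place_rdiff (G : ratfun) D :
  deg_bound D.+1 G.1 -> deg_bound D.+1 G.2 -> (forall i, deg_bound D G.1^`M(i)) -> (forall i, deg_bound D G.2^`M(i)) ->
  phi (heval iota D.+1 G.2 X e) != 0 ->
  phi (heval iota D.+1 G.2 X e * heval_diff iota D G.1 X Y e - heval iota D.+1 G.1 X e * heval_diff iota D G.2 X Y e) =
  phi (heval iota D.+1 G.2 X e) ^+ 2 * rdiff G (fun k => phi (X k) / phi e) (fun k => phi (Y k) / phi e).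
Proof.
move=> b1 b2 d1 d2 q0.
have hh q p q' p' : q = heval idfun D.+1 G.2 (phi \o X) (phi e) -> p = heval idfun D.+1 G.1 (phi \o X) (phi e) ->
    q' = heval_diff idfun D G.2 (phi \o X) (phi \o Y) (phi e) -> p' = heval_diff idfun D G.1 (phi \o X) (phi \o Y) (phi e) ->
    q != 0 -> q * p' - p * q' = q ^+ 2 * rdiff G (fun k => phi (X k) / phi e) (fun k => phi (Y k) / phi e).
  by move=> -> -> -> -> z; exact: (rdiff_heval (X := phi \o X) (phi \o Y) e0 b1 b2 d1 d2 z).
rewrite (place_minor (subalg_heval G.2 D.+1) (subalg_heval_diff G.1 D) (subalg_heval G.1 D.+1) (subalg_heval_diff G.2 D)).
exact: (hh _ _ _ _ (place_heval G.2 D.+1) (place_heval G.1 D.+1) (place_heval_diff G.2 D) (place_heval_diff G.1 D) q0).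
Qed.

Lemma place_rdefined (G : ratfun) D : deg_bound D G.2 ->
  rdefined G (fun k => phi (X k) / phi e) = (phi (heval iota D G.2 X e) != 0) :> Prop.
Proof. by move=> b; rewrite place_heval hevalE // mulf_eq0 negb_or expf_neq0. Qed.
End Places.

(** * The monodromy of the motion against first integrals *)

Section Obstruction.
Variables (R : realType) (n : nat) (m : 'I_n -> R).
Local Notation C := R[i].
Local Notation point := ('I_(nv n) -> C).
Hypotheses (n2 : (2 < n)%N) (m_gt0 : forall i, 0 < m i).
Local Notation cmm := (fun e : pairs n => cm (m (pi1 e) * m (pi2 e))).
Local Notation cmi := (fun i : 'I_n => cm (m i)).
Local Notation chi := (chiC R (n := n)).
Variables (q : nat) (tm : 'I_q -> C) (S : hyperlog tm) (al be : 'I_n -> C)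
  (s : pairs n -> C) (lam : pairs n -> 'I_q).
Local Notation solser := (solser S).
Local Notation epsser := (epsser C).
Local Notation cB := (cB S).
Local Notation kB := (kB S).
Local Notation ae := (pair_diff chi id al).
Local Notation bee := (pair_diff chi id be).
Hypotheses (tm_inj : injective tm)
  (s2 : forall e, s e * s e = 1) (be0 : forall e, bee e != 0)
  (tmE : forall e, ae e = - bee e * tm (lam e)).
Variables (rh ph : 'I_n -> 'I_2 -> epsser).
Variables (Pi : 'I_n -> 'I_2 -> solser) (dh ih : pairs n -> solser).
Local Notation r := (rho cmi al be rh ph Pi).
Local Notation p := (pii cmi be ph Pi).
Local Notation del := (del chi be s lam dh).
Local Notation iot := (iot chi be s lam ih).
Hypotheses (hPi : forall i a, Pi i a = IB (force chi cmi cmm al be s lam rh ph Pi ih i a))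
  (hdh : forall e, dh e = newdel chi cmi be s lam rh ph Pi dh e)
  (hih : forall e, ih e = newiot chi cmi be s lam rh ph Pi dh ih e).
Hypotheses
  (comal : \sum_i cmi i * al i = 0) (combe : \sum_i cmi i * be i = 0)
  (comrh : forall a, \sum_i shC (cmi i) * rh i a = 0) (comph : forall a, \sum_i ph i a = 0).
Variables (h c : C).
Hypotheses (en0 : evB (energy chi cmi cmm be s lam ph Pi ih) = shC h * gen ^+ 2 :> epsser)
  (an0 : evB (angmom cmi al be rh ph Pi) = shC c * gen ^+ 2 :> epsser).
Let m0 : forall i, cmi i != 0 := cmi_neq0 m_gt0.

Definition xi : 'I_(nv n) -> solser := mk_pt r p del.

Lemma chiC0 e : \sum_i chi e i = 0.
Proof. by have := chi_sum (fun _ => 1 : C) e; rewrite /= subrr => hh; rewrite -[RHS]hh; apply: eq_bigr => i _; rewrite mulr1. Qed.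
Lemma rlB_chi (f : 'I_n -> 'I_2 -> solser) e a : rlB chi f e a = f (pi1 e) a - f (pi2 e) a.
Proof.
rewrite /rlB /pair_diff.
have single (j : 'I_n) : \sum_i cB (i == j)%:R * f i a = f j a.
  rewrite (bigD1 j) //= eqxx rmorph1 mul1r big1 ?addr0 // => i /negPf ->; by rewrite rmorph0 mul0r.
rewrite -[f (pi1 e) a]single -[f (pi2 e) a]single -sumrB; apply: eq_bigr => i _.
by rewrite -mulrBl -rmorphB.
Qed.
Lemma relK_rho e a : relK xi e a = rlB chi r e a.
Proof. by rewrite /relK /xi !mk_vr rlB_chi. Qed.

Lemma relK_map (K : comNzRingType) (f : {rmorphism solser -> K}) (Z : 'I_(nv n) -> solser) e a : relK (f \o Z) e a = f (relK Z e a).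
Proof. by rewrite /relK rmorphB. Qed.

Lemma energyE : energy chi cmi cmm be s lam ph Pi ih = cB h * eps ^+ 2.
Proof.
have -> : cB h * eps ^+ 2 = kB (shC h * gen ^+ 2) by rewrite rmorphM rmorphXn /= kB_C kB_gen.
by apply: const_eq en0; apply: (d_energy m0 s2 be0 tmE hPi hdh hih).
Qed.
Lemma angmomE : angmom cmi al be rh ph Pi = cB c * eps ^+ 2.
Proof.
have -> : cB c * eps ^+ 2 = kB (shC c * gen ^+ 2) by rewrite rmorphM rmorphXn /= kB_C kB_gen.
by apply: const_eq an0; apply: (d_angmom m0 hPi).
Qed.

Section Map.
Variables (K : comNzRingType) (f : {rmorphism solser -> K}) (iota : {rmorphism C -> K}).
Hypothesis fc : forall z, f (cB z) = iota z.
Variables (A : K -> Prop) (phi : K -> C).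
Hypotheses (sA : subalg iota A) (pl : place iota A phi).
Hypotheses (AX : forall k, A (f (xi k))) (Ae : A (f eps)) (Aio : forall e, A (f (iot e))) (e0 : phi (f eps) != 0).

Lemma map_iod e : f (iot e) * (f \o xi) (vd e) = 1.
Proof. by rewrite /= /xi mk_vd -rmorphM (iot_del s2 be0 hdh hih) rmorph1. Qed.
Lemma map_dist e : (f \o xi) (vd e) ^+ 2 = \sum_a relK (f \o xi) e a ^+ 2.
Proof.
rewrite /= {1}/xi mk_vd -rmorphXn /= (del_sq s2 be0 tmE hdh) sum2 !relK_map !relK_rho.
by rewrite rmorphD !rmorphXn.
Qed.
Lemma map_p a : \sum_i (f \o xi) (vp i a) = 0.
Proof.
have := sum_p hPi chiC0 combe comph a => /(congr1 f); rewrite rmorph0 rmorph_sum => hh.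
by rewrite -[RHS]hh; apply: eq_bigr => i _; rewrite /= /xi mk_vp.
Qed.

(** Used with f = [TB] for a point at a generic time of the motion, and with f = [evB] for its
    position at t = 0. *)
Lemma map_inMhc : inMhc m h c (fun k => phi (f (xi k)) / phi (f eps)).
Proof.
apply: (place_inMhc n2 m_gt0 sA pl (X := f \o xi) (io := fun e => f (iot e)) AX Ae Aio e0 map_iod map_dist).
- move=> a; have := sum_r m0 hPi chiC0 comal combe comrh comph a => /(congr1 f); rewrite rmorph0 rmorph_sum => hh.
  by rewrite -[RHS]hh; apply: eq_bigr => i _; rewrite /= /xi mk_vr rmorphM /= fc.
- exact: map_p.
- have := congr1 f energyE; rewrite /energy rmorphB (rmorphM f (eps ^+ 3)) (rmorphM f (cB h)) !(rmorphXn f) fc => <-.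
  rewrite !rmorph_sum; congr (_ - _ * _).
    apply: eq_bigr => i _; rewrite rmorphM rmorph_sum /= fc cm2M; congr (_ * _).
    by apply: eq_bigr => a _; rewrite rmorphXn /= /xi mk_vp.
  by apply: eq_bigr => e _; rewrite rmorphM /= fc.
- have := congr1 f angmomE; rewrite /angmom (rmorphM f (cB c)) (rmorphXn f) fc => <-.
  rewrite rmorph_sum; apply: eq_bigr => i _.
  by rewrite rmorphB !rmorphM /= /xi !mk_vr !mk_vp.
Qed.

Hypothesis AY : forall k, A (f (dB (xi k))).
Lemma map_flow : ham_vec m (rsubc (Hrat m) h) (fun k => phi (f (xi k)) / phi (f eps))
  (fun k => phi (f (dB (xi k))) / phi (f eps)).
Proof.
apply: (place_flow n2 m_gt0 sA pl h (X := f \o xi) (Y := f \o (dB \o xi)) (io := fun e => f (iot e)) AX AY Ae Aio e0 map_iod).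
- exact: map_p.
- by move=> i a; rewrite /= /xi mk_vr mk_vp d_rho // rmorphM /= fc.
- move=> i a; rewrite /= {1}/xi mk_vp (d_pii hPi) rmorphM rmorphXn /=; congr (_ * _).
  rewrite /force rmorphN rmorph_sum; congr (- _); apply: eq_bigr => e _.
  by rewrite (rmorphM f (_ * _)) (rmorphM f (cB _)) (rmorphXn f) fc relK_map relK_rho.
- move=> e; rewrite /= {1 2}/xi !mk_vd -rmorphM (d_del s2 be0 tmE hdh) rmorph_sum; apply: eq_bigr => a _.
  rewrite /= rmorphM !relK_map relK_rho; congr (_ * f _).
  by rewrite /relK /= /xi !mk_vr -(derB (dB_der S)) rlB_chi.
Qed.
End Map.

Definition cBm : {rmorphism C -> solser} := cB.
Definition cTm : {rmorphism C -> sh unit (sh unit C)} := (@TB _ _ _ S) \o cB.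
Definition cEm : {rmorphism C -> epsser} := shC.

Lemma Ce_nzd (f g : epsser) : f * g = 0 -> f = 0 \/ g = 0.
Proof. exact: taylor_nzd. Qed.
Lemma Ce2_nzd (f g : sh unit (sh unit C)) : f * g = 0 -> f = 0 \/ g = 0.
Proof.
apply: sh_unit_nzd => [k|]; last exact: Ce_nzd.
apply/eqP => /(congr1 (fun f : epsser => cst f)); rewrite rmorph_nat rmorph0 => /eqP.
by rewrite (negPf (F_natS_neq0 _ _)).
Qed.
Lemma gen_neq0 : (gen : epsser) <> 0.
Proof. by move/(congr1 (fun f : epsser => cf f [:: tt])) => /eqP; rewrite /= oner_eq0. Qed.
Lemma TBeps_neq0 : TB (eps : solser) <> 0 :> sh unit (sh unit C).
Proof.
by move/(@TB_inj _ _ _ S)/(congr1 (@evB _ _ _ S)); rewrite evB_gen rmorph0; exact: gen_neq0.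
Qed.

(** P / Q is constant in t, hence equal to its value at 0, which [NB b] annihilates. *)
Lemma proportional_ev (P Q : solser) b : Q * dB P = P * dB Q -> evB Q <> 0 ->
  evB Q * evB (NB b P) = evB P * evB (NB b Q).
Proof.
move=> first_integral q0; have u0 : kB (evB Q) * P - kB (evB P) * Q = 0.
  apply: (proportional_const (qq := Q) _ _ Ce_nzd q0); last by rewrite rmorphB !rmorphM /= !evB_k mulrC subrr.
  rewrite (derB (dB_der S)) !dB_kM mulrBr mulrCA first_integral.
  by ring.
have := congr1 (NB b) u0; rewrite (derB (NB_der S b)) !NB_kM (der0 (NB_der S b)) => /(congr1 (@evB _ _ _ S)).
by rewrite rmorphB !rmorphM /= !evB_k rmorph0 => /eqP; rewrite subr_eq0 => /eqP.
Qed.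

Section FirstIntegral.
Variables (G : ratfun R n) (D : nat).
Hypotheses (b1 : deg_bound D.+1 G.1) (b2 : deg_bound D.+1 G.2)
  (d1 : forall i, deg_bound D G.1^`M(i)) (d2 : forall i, deg_bound D G.2^`M(i)).
Local Notation P := (heval cBm D.+1 G.1 xi eps).
Local Notation Q := (heval cBm D.+1 G.2 xi eps).

Lemma der_heval (d : solser -> solser) g : derivation d -> (forall z, d (cB z) = 0) -> d eps = 0 ->
  d (heval cBm D.+1 g xi eps) = heval_diff cBm D g xi (d \o xi) eps.
Proof. by move=> dD dc de; apply: heval_der. Qed.

Hypothesis brG : forall x, inMhc m h c x -> rdefined G x -> poisson_zero m (rsubc (Hrat m) h) G x.

(** Suppose the difference is not 0. Its expansion lives in a domain, so some place keeps it, the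
    denominator of G and eps nonzero. That place yields a point of the level where G is defined,
    with the Hamiltonian vector of H as image of the velocity, and a nonzero derivative of G along
    it, against [brG]. *)
Lemma first_integral : Q * dB P = P * dB Q.
Proof.
apply/eqP; rewrite -subr_eq0; apply/eqP/TB_inj.
apply: contrapT => g0.
have q0 : TB Q <> 0.
  by move/TB_inj => q0; apply: g0; rewrite q0 (der0 (dB_der S)) mul0r mulr0 subr0 rmorph0.
pose xs := TB (eps : solser) :: [seq TB (xi k) | k <- enum 'I_(nv n)] ++ [seq TB (dB (xi k)) | k <- enum 'I_(nv n)]
  ++ [seq TB (iot e) | e <- enum {: pairs n}].
have [A [sA Axs sep]] := places_exist cTm Ce2_nzd xs.
have Ae : A (TB (eps : solser)) by apply: Axs; rewrite inE eqxx.
have AX k : A (TB (xi k)).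
  apply: Axs; rewrite inE !mem_cat; apply/orP; right; apply/orP; left.
  by apply/mapP; exists k; rewrite ?mem_enum.
have AY k : A (TB (dB (xi k))).
  apply: Axs; rewrite inE !mem_cat; apply/orP; right; apply/orP; right; apply/orP; left.
  by apply/mapP; exists k; rewrite ?mem_enum.
have Aio e : A (TB (iot e)).
  apply: Axs; rewrite inE !mem_cat; apply/orP; right; apply/orP; right; apply/orP; right.
  by apply/mapP; exists e; rewrite ?mem_enum.
have TBhz g E : TB (heval cBm E g xi eps) = heval cTm E g (TB \o xi) (TB (eps : solser)) by apply: heval_rmorph.
have Ahz g E := (heval_place (fun _ => 0) g E sA AX Ae).1.
have dP g : TB (dB (heval cBm D.+1 g xi eps)) = heval_diff cTm D g (TB \o xi) (TB \o (dB \o xi)) (TB (eps : solser)).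
  rewrite (der_heval _ (dB_der S) (@dB_c _ _ _ S) (@dB_eps _ _ _ S)) rmorph_sum; apply: eq_bigr => k _.
  by rewrite rmorphM; congr (_ * _); exact: TBhz.
have Ad g : A (heval_diff cTm D g (TB \o xi) (TB \o (dB \o xi)) (TB (eps : solser))).
  by apply: (subalg_sum sA) => k; apply: (subalgM sA); [exact: Ahz|exact: AY].
have gE (a1 a2 a3 a4 : solser) b1' b2' b3' b4' : TB a1 = b1' -> TB a2 = b2' -> TB a3 = b3' -> TB a4 = b4' ->
    TB (a1 * a2 - a3 * a4) = b1' * b2' - b3' * b4'.
  by move=> <- <- <- <-; rewrite rmorphB !rmorphM.
pose q_ := heval cTm D.+1 G.2 (TB \o xi) (TB (eps : solser)); pose p_ := heval cTm D.+1 G.1 (TB \o xi) (TB (eps : solser)).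
pose q' := heval_diff cTm D G.2 (TB \o xi) (TB \o (dB \o xi)) (TB (eps : solser)).
pose p' := heval_diff cTm D G.1 (TB \o xi) (TB \o (dB \o xi)) (TB (eps : solser)).
have Eq : TB Q = q_ := TBhz _ _; have Ep : TB P = p_ := TBhz _ _.
have Eq' : TB (dB Q) = q' := dP _; have Ep' : TB (dB P) = p' := dP _.
have {}g0 : q_ * p' - p_ * q' <> 0 by rewrite -(gE _ _ _ _ _ _ _ _ Eq Ep' Ep Eq').
have {}q0 : q_ <> 0 by rewrite -Eq.
have Aq : A q_ := Ahz _ _; have Ap : A p_ := Ahz _ _.
have Aq' : A q' := Ad _; have Ap' : A p' := Ad _.
have Agg : A (q_ * p' - p_ * q') by apply: (subalgB sA); apply: (subalgM sA).
have [||phi pl] := sep (q_ * (q_ * p' - p_ * q') * TB (eps : solser)).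
- by apply: (subalgM sA) => //; apply: (subalgM sA).
- by move=> /Ce2_nzd[/Ce2_nzd[]|] //; exact: TBeps_neq0.
rewrite (placeM pl (subalgM sA Aq Agg) Ae) (placeM pl Aq Agg).
rewrite !mulf_eq0 !negb_or => /andP[/andP[pq pg] pe].
case/negP: pg; rewrite (place_rdiff sA pl (X := TB \o xi) (Y := TB \o (dB \o xi)) AX AY Ae pe b1 b2 d1 d2 pq).
have inx := map_inMhc (f := @TB _ _ _ S) (iota := cTm) (fun z => erefl) sA pl AX Ae Aio pe.
have flx := map_flow (f := @TB _ _ _ S) (iota := cTm) (fun z => erefl) sA pl AX Ae Aio pe AY.
have def : rdefined G (fun k => phi (TB (xi k)) / phi (TB (eps : solser))).
  by rewrite (place_rdefined sA pl (X := TB \o xi) AX Ae pe b2).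
by rewrite (brG inx def flx) mulr0.
Qed.

Lemma first_integral_ev b : evB Q <> 0 -> evB Q * evB (NB b P) = evB P * evB (NB b Q).
Proof. exact/proportional_ev/first_integral. Qed.
End FirstIntegral.

Section Contradiction.
Variables (Is : seq (ratfun R n)) (g : {mpoly C[nv n]}) (Dg : nat) (a b : 'I_q).
Local Notation I_ := (nth (0, 1) Is).
Hypotheses (szI : size Is = (2 * (n - 1))%N) (I0 : I_ 0 = rsubc (Hrat m) h)
  (br : forall i j : 'I_(size Is), forall x, inMhc m h c x ->
     rdefined (I_ i) x -> rdefined (I_ j) x -> poisson_zero m (I_ i) (I_ j) x)
  (hg : forall x, inMhc m h c x -> g.@[x] != 0 ->
     (forall G, G \in Is -> rdefined G x) /\ jac_full_rank m Is x)
  (bg : deg_bound Dg g).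
Definition ev_xi (k : 'I_(nv n)) : epsser := evB (xi k).
Hypotheses (g0 : heval cEm Dg g ev_xi gen <> 0)
  (om0 : omega_sum tm chi cmi cmm be s lam a b != 0).
Definition eta d (k : 'I_(nv n)) : epsser := evB (NB d (xi k)).

Lemma omega_eta : evB (omegaB cmi al be rh ph Pi a b) =
  \sum_i \sum_(c < 2) (eta a (vr i c) * eta b (vp i c) - eta a (vp i c) * eta b (vr i c)).
Proof.
rewrite /omegaB rmorph_sum; apply: eq_bigr => i _; rewrite rmorph_sum; apply: eq_bigr => d _.
by rewrite /eta /xi !mk_vr !mk_vp rmorphB !rmorphM.
Qed.

Lemma omega_neq0 : evB (omegaB cmi al be rh ph Pi a b) <> 0.
Proof.
have [Z ->] := omegaB_lead s2 be0 tmE hPi hdh hih tm_inj a b.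
move=> /Ce_nzd[]; last first.
  move/(congr1 (fun f : epsser => cst f)); rewrite rmorphD rmorphM /= cst_gen mul0r addr0 /= => /eqP.
  by rewrite (negPf om0).
elim: 9%N => [|k IH]; first by rewrite expr0 => /eqP; rewrite oner_eq0.
by rewrite exprS => /Ce_nzd[/gen_neq0|/IH].
Qed.

(** A place of the algebra generated by the data at t = 0 that kills neither g, nor the pairing of
    the two monodromy vectors, nor eps gives a point where the integrals are independent and in
    involution, with two vectors of their common kernel that are not orthogonal for [omega]. *)
Lemma no_first_integrals : False.
Proof.
pose xs := (gen : epsser) :: [seq ev_xi k | k <- enum 'I_(nv n)] ++ [seq eta a k | k <- enum 'I_(nv n)]
  ++ [seq eta b k | k <- enum 'I_(nv n)] ++ [seq evB (iot e) : epsser | e <- enum {: pairs n}].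
have [A [sA Axs sep]] := places_exist cEm Ce_nzd xs.
have Ae : A gen by apply: Axs; rewrite inE eqxx.
have AX k : A (ev_xi k).
  apply: Axs; rewrite inE !mem_cat; apply/orP; right; apply/orP; left.
  by apply/mapP; exists k; rewrite ?mem_enum.
have Aa k : A (eta a k).
  apply: Axs; rewrite inE !mem_cat; apply/orP; right; apply/orP; right; apply/orP; left.
  by apply/mapP; exists k; rewrite ?mem_enum.
have Ab k : A (eta b k).
  apply: Axs; rewrite inE !mem_cat; apply/orP; right; apply/orP; right; apply/orP; right; apply/orP; left.
  by apply/mapP; exists k; rewrite ?mem_enum.
have Aio e : A (evB (iot e)).
  apply: Axs; rewrite inE !mem_cat; apply/orP; right; apply/orP; right; apply/orP; right; apply/orP; right.
  by apply/mapP; exists e; rewrite ?mem_enum.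
have Aom : A (evB (omegaB cmi al be rh ph Pi a b)).
  rewrite omega_eta; apply: (subalg_sum sA) => i; apply: (subalg_sum sA) => d.
  by apply: (subalgB sA); apply: (subalgM sA).
have Ag := subalg_heval (fun _ => 0) sA AX Ae g Dg.
have [||phi pl] := sep (heval cEm Dg g ev_xi gen * evB (omegaB cmi al be rh ph Pi a b) * gen).
- exact: (subalgM sA (subalgM sA Ag Aom) Ae).
- by move=> /Ce_nzd[/Ce_nzd[|/omega_neq0]|/gen_neq0].
rewrite (placeM pl (subalgM sA Ag Aom) Ae) (placeM pl Ag Aom).
rewrite !mulf_eq0 !negb_or => /andP[/andP[pg po] pe].
pose x k := phi (ev_xi k) / phi gen.
have e0' : phi (evB (eps : solser)) != 0 by rewrite evB_gen.
have Ae' : A (evB (eps : solser)) by rewrite evB_gen.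
have inx : inMhc m h c x.
  have -> : x = (fun k => phi (evB (xi k)) / phi (evB (eps : solser))) by rewrite /x evB_gen.
  exact: (map_inMhc (f := @evB _ _ _ S) (iota := cEm) (@evB_c _ _ _ S) sA pl AX Ae' Aio e0').
have gx : g.@[x] != 0.
  by move: pg; rewrite (place_heval sA pl AX Ae) (hevalE _ bg pe) mulf_eq0 negb_or => /andP[_].
have [def jac] := hg inx gx.
have hM : inM m x by case: inx.
(* Tangency follows by applying [NB d] to the constraints, the vanishing of the differentials by
   applying it to the conserved quotients. *)
have key d : (forall k, A (eta d k)) ->
    tangent m x (fun k => phi (eta d k) / phi gen) /\
    forall j : 'I_(size Is), rdiff (I_ j) x (fun k => phi (eta d k) / phi gen) = 0.
  move=> Ad; split.
    apply: (place_tangent n2 m_gt0 sA pl (X := ev_xi) (Y := eta d) AX Ad pe).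
    - move=> e; have := sum_r m0 hPi chiC0 comal combe comrh comph e => /(congr1 (NB d)).
      rewrite (der_sum (NB_der S d)) (der0 (NB_der S d)) => /(congr1 (@evB _ _ _ S)).
      rewrite rmorph0 rmorph_sum => hh; rewrite -[RHS]hh; apply: eq_bigr => i _.
      by rewrite /eta /xi mk_vr NB_cM rmorphM /= evB_c.
    - move=> e; have := sum_p hPi chiC0 combe comph e => /(congr1 (NB d)).
      rewrite (der_sum (NB_der S d)) (der0 (NB_der S d)) => /(congr1 (@evB _ _ _ S)).
      rewrite rmorph0 rmorph_sum => hh; rewrite -[RHS]hh; apply: eq_bigr => i _.
      by rewrite /eta /xi mk_vp.
    - move=> e; have := der_del s2 be0 tmE hdh e (NB_der S d) => /(congr1 (@evB _ _ _ S)).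
      rewrite rmorphM rmorph_sum /ev_xi /eta /xi !mk_vd => ->; apply: eq_bigr => u _.
      rewrite rmorphM; congr (_ * _); first by rewrite -relK_rho -relK_map.
      by rewrite rlB_chi (derB (NB_der S d)) rmorphB /relK !mk_vr.
  move=> j; set G := I_ j.
  have [D hD] := deg_bound_all (G.1 :: G.2 :: [seq G.1^`M(k) | k <- enum 'I_(nv n)] ++ [seq G.2^`M(k) | k <- enum 'I_(nv n)]).
  have b1 : deg_bound D.+1 G.1 by apply: (deg_boundW (leqnSn D)); apply: hD; rewrite inE eqxx.
  have b2 : deg_bound D.+1 G.2 by apply: (deg_boundW (leqnSn D)); apply: hD; rewrite !inE eqxx orbT.
  have d1 k : deg_bound D G.1^`M(k).
    apply: hD; rewrite !inE mem_cat; apply/orP; right; apply/orP; right; apply/orP; left.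
    by apply/mapP; exists k; rewrite ?mem_enum.
  have d2 k : deg_bound D G.2^`M(k).
    apply: hD; rewrite !inE mem_cat; apply/orP; right; apply/orP; right; apply/orP; right.
    by apply/mapP; exists k; rewrite ?mem_enum.
  have GIs : G \in Is by apply: mem_nth.
  have brG y : inMhc m h c y -> rdefined G y -> poisson_zero m (rsubc (Hrat m) h) G y.
    have s0 : (0 < size Is)%N by rewrite szI; move: n2; case: (n) => [|[|[]]].
    move=> iy dy; rewrite -I0; apply: (br (i := Ordinal s0) (j := j)) => //=.
    by rewrite I0; case: iy.
  have pq : phi (heval cEm D.+1 G.2 ev_xi gen) != 0.
    by rewrite -(place_rdefined sA pl AX Ae pe b2); apply: def.
  have evhz f E : evB (heval cBm E f xi (eps : solser)) = heval cEm E f ev_xi gen.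
    by rewrite -(@evB_gen _ _ _ S); apply: heval_rmorph; exact: evB_c.
  have evN f : evB (NB d (heval cBm D.+1 f xi (eps : solser))) = heval_diff cEm D f ev_xi (eta d) gen.
    rewrite (der_heval _ _ (NB_der S d)) ?NB_eps //; last exact: NB_c.
    by rewrite rmorph_sum; apply: eq_bigr => k _; rewrite rmorphM; congr (_ * _); exact: evhz.
  have ev0 : evB (heval cBm D.+1 G.2 xi (eps : solser)) <> 0.
    by move=> z; move: pq; rewrite -evhz z (place0 pl) eqxx.
  have tr (y1 y2 y3 y4 z1 z2 z3 z4 : epsser) : y1 = z1 -> y2 = z2 -> y3 = z3 -> y4 = z4 ->
    y1 * y2 = y3 * y4 -> z1 * z2 = z3 * z4 by move=> -> -> -> ->.
  have z := tr _ _ _ _ _ _ _ _ (evhz G.2 _) (evN G.1) (evhz G.1 _) (evN G.2) (first_integral_ev b1 b2 d1 d2 brG d ev0).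
  have := place_rdiff sA pl AX Ad Ae pe b1 b2 d1 d2 pq.
  have nz (u v : C) : u != 0 -> 0 = u ^+ 2 * v -> v = 0.
    by move=> u0 /esym/eqP; rewrite mulf_eq0 expf_eq0 (negPf u0) andbF => /eqP.
  by move=> e2; apply: (nz _ _ pq); rewrite -e2 z subrr (place0 pl).
have [ta da] := key a Aa; have [tb db] := key b Ab.
have brx (i j : 'I_(size Is)) : poisson_zero m (I_ i) (I_ j) x.
  by apply: br => //; apply: def; apply: mem_nth.
have := common_kernel_isotropic n2 m_gt0 hM jac szI brx ta da tb db.
move/eqP; apply/negP; apply: contra po => /eqP om.
rewrite omega_eta (place_sum sA pl) => [|i]; last first.
  by apply: (subalg_sum sA) => d; apply: (subalgB sA); apply: (subalgM sA).
suff -> : \sum_i phi (\sum_(d < 2) (eta a (vr i d) * eta b (vp i d) - eta a (vp i d) * eta b (vr i d))) =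
    phi gen ^+ 2 * omega (fun k => phi (eta a k) / phi gen) (fun k => phi (eta b k) / phi gen).
  by rewrite om mulr0.
rewrite /omega mulr_sumr; apply: eq_bigr => i _.
rewrite (place_sum sA pl) => [|d]; last by apply: (subalgB sA); apply: (subalgM sA).
rewrite mulr_sumr; apply: eq_bigr => d _.
rewrite (place_minor sA pl) //.
move: (phi (eta a (vr i d))) (phi (eta a (vp i d))) (phi (eta b (vr i d))) (phi (eta b (vp i d))) (phi gen) pe => u1 u2 u3 u4 u5 u5_0.
by field.
Qed.
End Contradiction.
End Obstruction.

(** * Choice of the collinear motion *)

(* Up to a nonzero factor, the contribution of the triangle 0, 1, 2 to the leading
   coefficient of the symplectic pairing; A and B are the relative velocities. *)
Definition triangle_form (K : comNzRingType) (m0 m1 m2 sa sb se A B : K) : K :=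
  sa * ((m0 + m1) * B ^+ 3 - m1 * A * B ^+ 2) - sb * ((m0 + m2) * A ^+ 3 - m2 * B * A ^+ 2)
  - se * (m0 * A * B * (A + B) + m1 * A * B ^+ 2 + m2 * A ^+ 2 * B).

Lemma sqr_eq1 (F : fieldType) (s : F) : s * s = 1 -> s = 1 \/ s = -1.
Proof. by move/eqP; rewrite -expr2 sqrf_eq1 => /orP[/eqP|/eqP]; [left|right]. Qed.

Section TriReal.
Variables (R : rcfType).

(** For A = 1 the value of B makes the cubic term 4 (m0 + m1 + m2) B^2 in absolute value; since B >
    1, the other terms together stay below it for every choice of signs. *)
Lemma triangle_form_large (m0 m1 m2 sa sb se B : R) (h0 : 0 < m0) (h1 : 0 < m1) (h2 : 0 < m2) : sa * sa = 1 -> sb * sb = 1 -> se * se = 1 ->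
  (m0 + m1) * B = 4 * (m0 + m1 + m2) -> triangle_form m0 m1 m2 sa sb se 1 B != 0.
Proof.
move=> /sqr_eq1 ha /sqr_eq1 hb /sqr_eq1 he hB.
have B1 : 1 < B.
  rewrite -(ltr_pM2l (addr_gt0 h0 h1)) hB; lra.
have B0 : 0 < B by lra.
have c x : 0 < x -> x * B <= x * B ^+ 2.
  by move=> x0; rewrite ler_pM2l // expr2 ler_peMr // ltW.
have d x : 0 < x -> x <= x * B by move=> x0; rewrite ler_peMr // ltW.
have := c _ h0; have := c _ h1; have := c _ h2; have := d _ h0; have := d _ h1; have := d _ h2.
have p0 : 0 < m0 * B ^+ 2 by rewrite mulr_gt0 // exprn_gt0.
have p1 : 0 < m1 * B ^+ 2 by rewrite mulr_gt0 // exprn_gt0.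
have p2 : 0 < m2 * B ^+ 2 by rewrite mulr_gt0 // exprn_gt0.
have e3 : (m0 + m1) * B ^+ 3 = 4 * (m0 + m1 + m2) * B ^+ 2 by rewrite -hB; ring.
have pb0 : 0 < m0 * B by rewrite mulr_gt0.
rewrite /triangle_form e3.
by case: ha => ->; case: hb => ->; case: he => ->; move=> *; apply/eqP => z; lra.
Qed.

(** The two expressions are U' / m1 and V' / m2 of [triangle_form_root_neq0]. *)
Lemma triangle_form_coef (m0 m1 m2 sa sb se : R) (h0 : 0 < m0) (h1 : 0 < m1) (h2 : 0 < m2) : sa * sa = 1 -> sb * sb = 1 -> se * se = 1 ->
  - sa * m1 * (m0 + m2) - sb * m2 ^+ 2 - se * m2 * (m0 + m2) = 0 ->
  sa * m1 ^+ 2 + sb * m2 * (m0 + m1) - se * m1 * (m0 + m1) = 0 -> False.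
Proof.
move=> /sqr_eq1 ha /sqr_eq1 hb /sqr_eq1 he.
have p01 := mulr_gt0 h0 h1; have p02 := mulr_gt0 h0 h2; have p12 := mulr_gt0 h1 h2.
have p11 := mulr_gt0 h1 h1; have p22 := mulr_gt0 h2 h2.
have sq : 0 <= (m1 - m2) * (m1 - m2) by rewrite -expr2 sqr_ge0.
move: sq; rewrite !expr2 !mulrDr !mulrDl => sq.
by case: ha => ->; case: hb => ->; case: he => ->; nra.
Qed.

(** For three bodies, sum m be = sum m be^2 = 0 forces z = A / B to be a root of m1 (m0 + m2) z^2 -
    2 m1 m2 z + m2 (m0 + m1). The discriminant is negative for positive masses; u and v are the two
    parts of a root. *)
Lemma complex_root_exists (m0 m1 m2 : R) (h0 : 0 < m0) (h1 : 0 < m1) (h2 : 0 < m2) : exists u v : R, [/\ v != 0,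
  m1 * (m0 + m2) * (u ^+ 2 - v ^+ 2) - 2 * m1 * m2 * u + m2 * (m0 + m1) = 0 &
  m1 * (m0 + m2) * (2 * u * v) - 2 * m1 * m2 * v = 0].
Proof.
pose u := m2 / (m0 + m2); pose w := m2 * (m0 + m1) / (m1 * (m0 + m2)) - u ^+ 2.
have p02 : 0 < m0 + m2 := addr_gt0 h0 h2.
have w0 : 0 < w.
  have -> : w = m2 * (m0 * (m0 + m1 + m2)) / (m1 * (m0 + m2) ^+ 2).
    by rewrite /w /u; field; rewrite !gt_eqF.
  by rewrite divr_gt0 // ?mulr_gt0 ?exprn_gt0 ?addr_gt0.
exists u, (Num.sqrt w); split.
- by rewrite gt_eqF // sqrtr_gt0.
- rewrite sqr_sqrtr ?ltW // /w /u; field; by rewrite !gt_eqF.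
- rewrite /u; field; by rewrite !gt_eqF.
Qed.
End TriReal.

Section TriComplex.
Variables (R : realType) (m0 m1 m2 : R).
Hypotheses (h0 : 0 < m0) (h1 : 0 < m1) (h2 : 0 < m2).
Local Notation C := R[i].

Lemma cm0 : cm 0 = 0 :> C. Proof. by []. Qed.
Lemma cm1 : cm 1 = 1 :> C. Proof. by []. Qed.
Lemma cmN (a : R) : cm (- a) = - cm a. Proof. by apply/eqP; rewrite eq_complex /= oppr0 !eqxx. Qed.
Lemma cmB (a b : R) : cm (a - b) = cm a - cm b. Proof. by rewrite cmD cmN. Qed.
Lemma cmX (a : R) k : cm (a ^+ k) = cm a ^+ k.
Proof. by elim: k => [|k IH]; rewrite ?expr0 // !exprS cmM IH. Qed.
Lemma cm_eq0 (a : R) : (cm a == 0) = (a == 0).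
Proof. by apply/eqP/eqP => [[]|->]. Qed.

Lemma cm_sign (s : C) : s * s = 1 -> exists2 t : R, t * t = 1 & s = cm t.
Proof. by case/sqr_eq1 => ->; [exists 1|exists (-1)]; rewrite ?mulr1 ?mulN1r ?opprK // cmN. Qed.

Lemma triangle_form_cm (a b c sa sb se A B : R) :
  triangle_form (cm a) (cm b) (cm c) (cm sa) (cm sb) (cm se) (cm A) (cm B) = cm (triangle_form a b c sa sb se A B).
Proof. by rewrite /triangle_form !(cmB, cmD, cmM, cmX). Qed.

Lemma triangle_formZ (F : comNzRingType) (l a b c sa sb se A B : F) :
  triangle_form a b c sa sb se (l * A) (l * B) = l ^+ 3 * triangle_form a b c sa sb se A B.
Proof. by rewrite /triangle_form; ring. Qed.

(** Modulo the equation of z, m1 m2 times the form is z (U' z + V') with U' and V' real. As z is not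
    real, both would have to vanish, which [triangle_form_coef] excludes for all signs. *)
Lemma triangle_form_root_neq0 (u v : R) (sa sb se : C) : v != 0 ->
  m1 * (m0 + m2) * (u ^+ 2 - v ^+ 2) - 2 * m1 * m2 * u + m2 * (m0 + m1) = 0 ->
  m1 * (m0 + m2) * (2 * u * v) - 2 * m1 * m2 * v = 0 ->
  sa * sa = 1 -> sb * sb = 1 -> se * se = 1 ->
  triangle_form (cm m0) (cm m1) (cm m2) sa sb se (Complex u v) 1 != 0.
Proof.
move=> v0 hre him /cm_sign[a ha ->] /cm_sign[b hb ->] /cm_sign[e he ->]; apply/eqP => T0.
set z := Complex u v in T0 *.
have zroot : cm m1 * (cm m0 + cm m2) * z ^+ 2 - 2 * cm m1 * cm m2 * z + cm m2 * (cm m0 + cm m1) = 0.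
  have -> : cm m1 * (cm m0 + cm m2) * z ^+ 2 - 2 * cm m1 * cm m2 * z + cm m2 * (cm m0 + cm m1) =
    Complex (m1 * (m0 + m2) * (u ^+ 2 - v ^+ 2) - 2 * m1 * m2 * u + m2 * (m0 + m1))
      (m1 * (m0 + m2) * (2 * u * v) - 2 * m1 * m2 * v).
    rewrite /cm /z expr2 -[2 : C]/(1 + 1); simpc; apply/eqP; rewrite eq_complex /=.
    by apply/andP; split; apply/eqP; ring.
  by rewrite hre him.
pose U' := - a * m1 ^+ 2 * (m0 + m2) - b * m1 * m2 ^+ 2 - e * m1 * m2 * (m0 + m2).
pose V' := a * m1 ^+ 2 * m2 + b * m2 ^+ 2 * (m0 + m1) - e * m1 * m2 * (m0 + m1).
have hT : cm m1 * cm m2 * triangle_form (cm m0) (cm m1) (cm m2) (cm a) (cm b) (cm e) z 1 =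
   z * (cm U' * z + cm V') + (cm m1 * cm a - cm m2 * cm b * z) *
   (cm m1 * (cm m0 + cm m2) * z ^+ 2 - 2 * cm m1 * cm m2 * z + cm m2 * (cm m0 + cm m1)).
  by rewrite /triangle_form /U' /V' !(cmD, cmB, cmN, cmM, cmX); ring.
move: hT; rewrite T0 zroot !mulr0 addr0 => /esym/eqP; rewrite mulf_eq0 => /orP[/eqP[_ v00]|/eqP zz].
  by rewrite v00 eqxx in v0.
have uv : Complex (U' * u + V') (U' * v) = 0.
  rewrite -zz /cm /z; simpc; apply/eqP; rewrite eq_complex /=; apply/andP; split; apply/eqP; ring.
case: uv => uv /eqP; rewrite mulf_eq0 (negPf v0) orbF => /eqP U0.
rewrite U0 mul0r add0r in uv.
apply: (triangle_form_coef h0 h1 h2 ha hb he).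
  apply: (mulfI (lt0r_neq0 h1)); rewrite mulr0 -U0 /U'; ring.
by apply: (mulfI (lt0r_neq0 h2)); rewrite mulr0 -uv /V'; ring.
Qed.
End TriComplex.

Definition ord_0 k : 'I_k.+3 := ord0.
Definition ord_1 k : 'I_k.+3 := lift ord0 ord0.
Definition ord_2 k : 'I_k.+3 := lift ord0 (lift ord0 ord0).
Definition ord_add3 k (j : 'I_k) : 'I_k.+3 := lift ord0 (lift ord0 (lift ord0 j)).

Lemma sum3 k (V : nmodType) (G : 'I_k.+3 -> V) :
  \sum_i G i = G (ord_0 k) + G (ord_1 k) + G (ord_2 k) + \sum_j G (ord_add3 j).
Proof. by rewrite !big_ord_recl !addrA. Qed.

Definition iC (R : realType) : R[i] := Complex 0 1.
Lemma iC2 (R : realType) : iC R * iC R = -1.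
Proof. by apply/eqP; rewrite eq_complex /=; apply/andP; split; apply/eqP; ring. Qed.

Lemma cm_iC (R : realType) (a b a' b' : R) :
  cm a + iC R * cm b = cm a' + iC R * cm b' -> a = a' /\ b = b'.
Proof.
have e (x y : R) : cm x + iC R * cm y = Complex x y.
  by apply/eqP; rewrite eq_complex /=; apply/andP; split; apply/eqP; ring.
by rewrite !e => -[-> ->].
Qed.

Section Beta.
Variable R : realType.
Local Notation C := R[i].

Lemma velocities3 (m : 'I_3 -> R) : (forall i, 0 < m i) -> exists be : 'I_3 -> C,
  [/\ injective be, \sum_i cm (m i) * be i = 0, \sum_i cm (m i) * be i ^+ 2 = 0 &
   forall sa sb se : C, sa * sa = 1 -> sb * sb = 1 -> se * se = 1 ->
   triangle_form (cm (m (ord_0 0))) (cm (m (ord_1 0))) (cm (m (ord_2 0))) sa sb se (be (ord_0 0) - be (ord_1 0)) (be (ord_0 0) - be (ord_2 0)) != 0].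
Proof.
move=> mp; set m0 := m (ord_0 0); set m1 := m (ord_1 0); set m2 := m (ord_2 0).
have h0 : 0 < m0 := mp _; have h1 : 0 < m1 := mp _; have h2 : 0 < m2 := mp _.
have [u [v [v0 hre him]]] := complex_root_exists h0 h1 h2.
pose z : C := Complex u v.
have z0 : z != 0 by apply: contraNneq v0 => -[_ ->].
have z1 : z != 1 by apply: contraNneq v0 => -[_ ->].
pose M : C := cm (m0 + m1 + m2).
have M0 : M != 0 by rewrite cm_eq0 gt_eqF // !addr_gt0.
(* This value makes the total momentum 0; the relative velocities are then A = z and B = 1. *)
pose x0 : C := (cm m1 * z + cm m2) / M.
pose be (i : 'I_3) : C := x0 - (match val i with 0%N => 0 | 1%N => z | _ => 1 end).
have hM : M = cm m0 + cm m1 + cm m2 by rewrite /M !cmD.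
exists be; split.
- move=> [[|[|[|]]] // hi] [[|[|[|]]] // hj]; rewrite /be /= => /addrI/oppr_inj => h; try exact: val_inj.
  + by rewrite -h eqxx in z0. + by have := oner_neq0 C; rewrite -h eqxx.
  + by rewrite h eqxx in z0. + by rewrite h eqxx in z1.
  + by have := oner_neq0 C; rewrite h eqxx. + by rewrite -h eqxx in z1.
- rewrite sum3 big_ord0 addr0 /be /= -/m0 -/m1 -/m2 subr0.
  by rewrite /x0; move: M0; rewrite hM => M0; field.
- have zroot : cm m1 * (cm m0 + cm m2) * z ^+ 2 - 2 * cm m1 * cm m2 * z + cm m2 * (cm m0 + cm m1) = 0.
    have -> : cm m1 * (cm m0 + cm m2) * z ^+ 2 - 2 * cm m1 * cm m2 * z + cm m2 * (cm m0 + cm m1) =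
      Complex (m1 * (m0 + m2) * (u ^+ 2 - v ^+ 2) - 2 * m1 * m2 * u + m2 * (m0 + m1))
        (m1 * (m0 + m2) * (2 * u * v) - 2 * m1 * m2 * v).
      rewrite /cm /z expr2 -[2 : C]/(1 + 1); simpc; apply/eqP; rewrite eq_complex /=.
      by apply/andP; split; apply/eqP; ring.
    by rewrite hre him.
  rewrite sum3 big_ord0 addr0 /be /= -/m0 -/m1 -/m2 subr0.
  transitivity ((cm m1 * (cm m0 + cm m2) * z ^+ 2 - 2 * cm m1 * cm m2 * z + cm m2 * (cm m0 + cm m1)) / M); last by rewrite zroot mul0r.
  by rewrite /x0; move: M0; rewrite hM => M0; field.
- move=> sa sb se ha hb he; rewrite /be /= subr0 !opprB !addrA.
  have -> : x0 + z - x0 = z by ring.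
  have -> : x0 + 1 - x0 = 1 by ring.
  exact: triangle_form_root_neq0.
Qed.

(** A fourth body frees the ratio B / A, which can be taken real and as required by
    [triangle_form_large]: imaginary parts of the velocities balance the sum of m be^2. *)
Lemma velocities4 k (m : 'I_k.+4 -> R) : (forall i, 0 < m i) -> exists be : 'I_k.+4 -> C,
  [/\ injective be, \sum_i cm (m i) * be i = 0, \sum_i cm (m i) * be i ^+ 2 = 0 &
   forall sa sb se : C, sa * sa = 1 -> sb * sb = 1 -> se * se = 1 ->
   triangle_form (cm (m (ord_0 _))) (cm (m (ord_1 _))) (cm (m (ord_2 _))) sa sb se (be (ord_0 _) - be (ord_1 _)) (be (ord_0 _) - be (ord_2 _)) != 0].
Proof.
move=> mp; set m0 := m (ord_0 _); set m1 := m (ord_1 _); set m2 := m (ord_2 _).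
have h0 : 0 < m0 := mp _; have h1 : 0 < m1 := mp _; have h2 : 0 < m2 := mp _.
(* The first three velocities have a common imaginary part, the others are purely
   imaginary. *)
pose M := m0 + m1 + m2; have M0 : 0 < M by rewrite !addr_gt0.
pose y (j : nat) : R := j.+1%:R; have y0 j : 0 < y j by rewrite ltr0n.
pose Y1 := \sum_(j < k.+1) m (ord_add3 j) * y j.
pose Y2 := \sum_(j < k.+1) m (ord_add3 j) * y j ^+ 2.
have Y1p : 0 < Y1.
  rewrite /Y1 big_ord_recl ltr_pwDl ?mulr_gt0 //; apply: sumr_ge0 => j _; exact/ltW/mulr_gt0.
have Y2p : 0 < Y2.
  rewrite /Y2 big_ord_recl ltr_pwDl ?mulr_gt0 ?exprn_gt0 //; apply: sumr_ge0 => j _; apply/ltW/mulr_gt0 => //; exact: exprn_gt0.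
pose c0 := - (Y1 / M); have c0n : c0 < 0 by rewrite oppr_lt0 divr_gt0.
pose B := 4 * M / (m0 + m1).
have p01 : 0 < m0 + m1 by rewrite addr_gt0.
have hB : (m0 + m1) * B = 4 * M by rewrite /B; field; rewrite gt_eqF.
have B1 : 1 < B by rewrite -(ltr_pM2l p01) hB /M; lra.
pose x0 := (m1 + m2 * B) / M; pose x1 := x0 - 1; pose x2 := x0 - B.
have [n01 n02 n12] : [/\ x0 != x1, x0 != x2 & x1 != x2].
  have gen (X b : R) : 1 < b -> [/\ X != X - 1, X != X - b & X - 1 != X - b].
    by move=> b1; split; apply/eqP => z; move: b1 z; clear; lra.
  exact: gen.
have hx : m0 * x0 + m1 * x1 + m2 * x2 = 0 by rewrite /x2 /x1 /x0 /M; field; rewrite gt_eqF.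
pose qd := m0 * x0 ^+ 2 + m1 * x1 ^+ 2 + m2 * x2 ^+ 2.
have q0 : 0 < qd.
  have a : 0 <= m1 * x1 ^+ 2 by rewrite mulr_ge0 ?sqr_ge0 // ltW.
  have b : 0 <= m2 * x2 ^+ 2 by rewrite mulr_ge0 ?sqr_ge0 // ltW.
  have c : 0 < m0 * x0 ^+ 2.
    rewrite mulr_gt0 // exprn_gt0 // /x0 divr_gt0 // addr_gt0 // mulr_gt0 //; lra.
  by rewrite /qd -addrA ltr_pwDl // addr_ge0.
(* Y is the sum of m times the squared imaginary parts; the scale l gives the real parts the same
   sum. *)
pose Y := M * c0 ^+ 2 + Y2.
have Yp : 0 < Y by rewrite /Y ltr_wpDl // mulr_ge0 ?sqr_ge0 // ltW.
pose l := Num.sqrt (Y / qd).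
have l0 : 0 < l by rewrite sqrtr_gt0 divr_gt0.
have l2 : l ^+ 2 * qd = Y by rewrite sqr_sqrtr ?divfK ?gt_eqF // ltW // divr_gt0.
pose re (i : nat) : R := match i with 0%N => l * x0 | 1%N => l * x1 | 2%N => l * x2 | _ => 0 end.
pose im (i : nat) : R := match i with 0%N => c0 | 1%N => c0 | 2%N => c0 | j.+3 => y j end.
pose be (i : 'I_k.+4) : C := cm (re i) + iC R * cm (im i).
have sumE (G : nat -> R) : \sum_(i < k.+4) m i * G i = m0 * G 0%N + m1 * G 1%N + m2 * G 2%N + \sum_(j < k.+1) m (ord_add3 j) * G j.+3.
  by rewrite sum3.
have sre : \sum_i m i * re i = 0.
  rewrite (sumE re) /= [X in _ + X]big1 => [|j _]; last by rewrite mulr0.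
  rewrite addr0; transitivity (l * (m0 * x0 + m1 * x1 + m2 * x2)); first by ring.
  by rewrite hx mulr0.
have sim : \sum_i m i * im i = 0.
  rewrite (sumE im) /= -/Y1 /c0 /M; field; by rewrite gt_eqF.
have sre2 : \sum_i m i * re i ^+ 2 = Y.
  rewrite (sumE (fun i => re i ^+ 2)) /= [X in _ + X]big1 => [|j _]; last by rewrite expr2 !mulr0.
  rewrite addr0 -l2 /qd; ring.
have sim2 : \sum_i m i * im i ^+ 2 = Y.
  rewrite (sumE (fun i => im i ^+ 2)) /= -/Y2 /Y /M; ring.
have sri : \sum_i m i * (re i * im i) = 0.
  rewrite (sumE (fun i => re i * im i)) /= [X in _ + X]big1 => [|j _]; last by rewrite mul0r mulr0.
  rewrite addr0; transitivity (l * c0 * (m0 * x0 + m1 * x1 + m2 * x2)); first by ring.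
  by rewrite hx mulr0.
exists be; split.
- move=> i j /cm_iC[]; case: i => -[|[|[|i]]] hi; case: j => -[|[|[|j]]] hj /=; move=> a b; apply: val_inj => //=.
  all: try by [have := y0 j; rewrite -b ltNge ltW | have := y0 i; rewrite b ltNge ltW].
  all: try by have := mulfI (lt0r_neq0 l0) a => hh; move: n01 n02 n12; rewrite hh eqxx.
  by move/eqP: b; rewrite eqr_nat => /eqP [->].
- transitivity (cm (\sum_i m i * re i) + iC R * cm (\sum_i m i * im i)); last by rewrite sre sim cm0 mulr0 addr0.
  rewrite !cm_sum mulr_sumr -big_split; apply: eq_bigr => i _ /=.
  by rewrite /be !cmM; ring.
- transitivity (cm (\sum_i m i * re i ^+ 2) + 2 * iC R * cm (\sum_i m i * (re i * im i)) + (iC R * iC R) * cm (\sum_i m i * im i ^+ 2)).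
    rewrite !cm_sum !mulr_sumr -!big_split; apply: eq_bigr => i _ /=.
    rewrite /be !cmM; ring.
  by rewrite sre2 sri sim2 cm0 mulr0 addr0 iC2 mulN1r subrr.
- move=> sa sb se /cm_sign[a ha ->] /cm_sign[b hb ->] /cm_sign[e he ->].
  have -> : be (ord_0 _) - be (ord_1 _) = cm l * 1.
    have -> : 1 = cm x0 - cm x1 :> C by rewrite -cmB /x1 opprB addrC subrK.
    rewrite /be /= !cmM; ring.
  have -> : be (ord_0 _) - be (ord_2 _) = cm l * cm B.
    have -> : cm B = cm x0 - cm x2 :> C by rewrite -cmB /x2 opprB addrC subrK.
    rewrite /be /= !cmM; ring.
  rewrite triangle_formZ; apply: mulf_neq0; first by rewrite expf_neq0 // cm_eq0 gt_eqF.
  rewrite -(cm1 R) triangle_form_cm cm_eq0.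
  by apply: triangle_form_large.
Qed.

Lemma velocities_exist k (m : 'I_k.+3 -> R) : (forall i, 0 < m i) -> exists be : 'I_k.+3 -> C,
  [/\ injective be, \sum_i cm (m i) * be i = 0, \sum_i cm (m i) * be i ^+ 2 = 0 &
   forall sa sb se : C, sa * sa = 1 -> sb * sb = 1 -> se * se = 1 ->
   triangle_form (cm (m (ord_0 k))) (cm (m (ord_1 k))) (cm (m (ord_2 k))) sa sb se (be (ord_0 k) - be (ord_1 k)) (be (ord_0 k) - be (ord_2 k)) != 0].
Proof. by case: k m => [|k] m; [exact: velocities3|exact: velocities4]. Qed.
End Beta.

Lemma lin_large (F : numFieldType) (E : finType) (P : pred E) (u v : E -> F) (M : F) :
  0 <= M -> (forall e, P e -> v e != 0) -> exists S, forall e, P e -> M <= `|u e + S * v e|.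
Proof.
move=> M0 v0; pose c e := (M + `|u e|) / `|v e|.
have c0 e : 0 <= c e by rewrite divr_ge0 // addr_ge0.
exists (\sum_(e | P e) c e) => e Pe.
set S := \sum_(e | P e) c e.
have S0 : 0 <= S by apply: sumr_ge0.
have cS : c e <= S by rewrite /S (bigD1 e) //= lerDl; apply: sumr_ge0.
have ve : 0 < `|v e| by rewrite normr_gt0 v0.
have h : M + `|u e| <= S * `|v e| by rewrite -ler_pdivrMr.
rewrite addrC; apply: le_trans (lerB_normD _ _).
by rewrite normrM (ger0_norm S0) lerBrDr.
Qed.

Section Omega.
Variables (R : realType) (k : nat) (m : 'I_k.+3 -> R).
Hypothesis m_gt0 : forall i, 0 < m i.
Local Notation C := R[i].
Local Notation P := (pairs k.+3).
Local Notation chi := (chiC R (n := k.+3)).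
Definition mkpair (i j : 'I_k.+3) (h : (i < j)%N) : P := exist _ (i, j) h.
Definition pair01 : P := @mkpair (ord_0 k) (ord_1 k) isT.
Definition pair02 : P := @mkpair (ord_0 k) (ord_2 k) isT.
Definition pair12 : P := @mkpair (ord_1 k) (ord_2 k) isT.
Definition outer (e : P) : bool := (2 < pi2 e)%N.

Lemma inner_pairP (e : P) : ~~ outer e -> [\/ e = pair01, e = pair02 | e = pair12].
Proof.
case: e => [[[i hi] [j hj]] /= ij]; rewrite /outer /pi2 /= -leqNgt => j2.
have : ((i == 0%N) && (j == 1%N)) || ((i == 0%N) && (j == 2%N)) || ((i == 1%N) && (j == 2%N)).
  by move: ij j2 => /=; clear; case: j => [|[|[|j]]] //; case: i => [|[|i]].
move=> /orP[/orP[]|] /andP[/eqP ei /eqP ej]; subst i j; [apply: Or31|apply: Or32|apply: Or33];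
  by apply: val_inj; congr pair; apply: val_inj.
Qed.
Lemma pa_pb : (pair01 == pair02) = false. Proof. by []. Qed.
Lemma sum_pairs (V : nmodType) (G : P -> V) :
  \sum_e G e = G pair01 + G pair02 + G pair12 + \sum_(e | outer e) G e.
Proof.
rewrite (bigID outer) /= addrC; congr (_ + _).
rewrite (bigD1 pair01) //= (bigD1 pair02) //= (bigD1 pair12) //= addrA addrA big1 ?addr0 // => e.
by move=> /andP[/andP[/andP[/inner_pairP[]-> //]]]; rewrite eqxx.
Qed.

Lemma rl_chi (f : 'I_k.+3 -> C) e : pair_diff chi id f e = f (pi1 e) - f (pi2 e).
Proof. by rewrite -chi_sum. Qed.

Variable be : 'I_k.+3 -> C.
Hypothesis be_inj : injective be.
Local Notation cmi := (fun i => cm (m i)).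
Local Notation cmm := (fun e : P => cm (m (pi1 e) * m (pi2 e))).
Local Notation ip := (ip chi cmi).
Local Notation bee := (pair_diff chi id be).

Lemma bee_neq0 e : bee e != 0.
Proof.
rewrite rl_chi subr_eq0; apply/eqP => /be_inj h.
by have := valP e; rewrite /= -/(pi1 e) -/(pi2 e) h ltnn.
Qed.

(** The summand of [Omega] for the pairs 01 and 02, as a function of the signs and of the meeting
    times. *)
Definition omega_term (s : P -> C) (T : P -> C) e : C :=
  gg chi cmm be s e * (ip e pair02 * (ip pair01 e / bee e - ip pair01 pair02 / bee pair02) * (T e - T pair02) ^- 2
   - ip e pair01 * (ip pair02 e / bee e - ip pair01 pair02 / bee pair01) * (T e - T pair01) ^- 2).

Lemma ipE e f : ip e f = (chi f (pi1 e)) / cm (m (pi1 e)) - chi f (pi2 e) / cm (m (pi2 e)).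
Proof.
rewrite /ip -[RHS](chi_sum (fun i => chi f i / cm (m i))); apply: eq_bigr => i _.
by rewrite mulrA.
Qed.

(** The separations of the three pairs add up, so the meeting time of 12 is determined by the other
    two, and all differences of times are multiples of T pair01 - T pair02. *)
Lemma triangle (s T : P -> C) : T pair01 != T pair02 ->
  bee pair12 * T pair12 = bee pair02 * T pair02 - bee pair01 * T pair01 ->
  omega_term s T pair01 + omega_term s T pair02 + omega_term s T pair12 =
  triangle_form (cm (m (ord_0 k))) (cm (m (ord_1 k))) (cm (m (ord_2 k))) (s pair01) (s pair02) (s pair12) (bee pair01) (bee pair02) *
  (T pair01 - T pair02) ^- 2 / (cm (m (ord_0 k)) * bee pair01 ^+ 3 * bee pair02 ^+ 3).
Proof.
move=> Tab Tc; have A0 := bee_neq0 pair01; have B0 := bee_neq0 pair02; have D0 := bee_neq0 pair12.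
have cE : bee pair12 = bee pair02 - bee pair01 by rewrite !rl_chi /pi1 /pi2 /=; ring.
have n0 := cmi_neq0 m_gt0 (ord_0 k); have n1 := cmi_neq0 m_gt0 (ord_1 k); have n2 := cmi_neq0 m_gt0 (ord_2 k).
have Tab0 : T pair01 - T pair02 != 0 by rewrite subr_eq0.
have Tcb : T pair12 - T pair02 = bee pair01 * (T pair02 - T pair01) / bee pair12.
  by rewrite -[T pair12](mulKf D0) Tc; field: cE.
have Tca : T pair12 - T pair01 = bee pair02 * (T pair02 - T pair01) / bee pair12.
  by rewrite -[T pair12](mulKf D0) Tc; field: cE.
rewrite /omega_term /gg !ipE Tcb Tca !subrr /chiC /pi1 /pi2 /= !cmM.
move: cE D0 Tab0 A0 B0; rewrite -(opprB (T pair01)).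
move: (bee pair01) (bee pair02) (bee pair12) (T pair01 - T pair02) => A B D t -> D0 t0 A0 B0.
move: n0 n1 n2; move: (cm (m (ord_0 k))) (cm (m (ord_1 k))) (cm (m (ord_2 k))) => m0 m1 m2 n0 n1 n2.
rewrite !subrr !subr0 !sub0r /triangle_form expr0n /= invr0 !mulr0 ?sub0r ?subr0.
field; by rewrite n0 n1 n2 A0 B0 D0 t0.
Qed.

Hypothesis tri_neq0 : forall sa sb se : C, sa * sa = 1 -> sb * sb = 1 -> se * se = 1 ->
  triangle_form (cm (m (ord_0 k))) (cm (m (ord_1 k))) (cm (m (ord_2 k))) sa sb se (be (ord_0 k) - be (ord_1 k)) (be (ord_0 k) - be (ord_2 k)) != 0.

Lemma mtot3 : cm (mtot m) != 0 :> C.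
Proof. exact: (mtot_neq0 (n := k.+3)). Qed.

Lemma sign_norm (s : C) : s * s = 1 -> `|s| = 1.
Proof. by case/sqr_eq1 => ->; rewrite ?normrN normr1. Qed.

(** The right-hand side involves neither signs nor times: the outer pairs become negligible as M
    grows. *)
Lemma outer_bound (s T : P -> C) (M : C) : (forall e, s e * s e = 1) -> 1 <= M ->
  (forall e, outer e -> M <= `|T e - T pair01| /\ M <= `|T e - T pair02|) ->
  `|\sum_(e | outer e) omega_term s T e| * M <=
  \sum_(e | outer e) `|cmm e / bee e ^+ 2| * (`|ip e pair02 * (ip pair01 e / bee e - ip pair01 pair02 / bee pair02)| + `|ip e pair01 * (ip pair02 e / bee e - ip pair01 pair02 / bee pair01)|).
Proof.
move=> hs M1 hT; have M0 : 0 < M := lt_le_trans ltr01 M1.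
have inv (x : C) : M <= `|x| -> `|x ^- 2| * M <= 1.
  move=> hx; have x0 : 0 < `|x| := lt_le_trans M0 hx.
  rewrite normrV ?unitfE ?expf_eq0 -?normr_gt0 // normrX ler_pdivrMl ?exprn_gt0 // mulr1.
  rewrite expr2; apply: (le_trans hx); rewrite ler_peMl ?(ltW x0) //.
  exact: le_trans M1 hx.
rewrite -ler_pdivlMr //; apply: le_trans (ler_norm_sum _ _ _) _.
rewrite mulr_suml; apply: ler_sum => e oe; rewrite ler_pdivlMr //.
have g : `|gg chi cmm be s e| = `|cmm e / bee e ^+ 2| by rewrite /gg -mulrA normrM sign_norm ?mul1r.
rewrite /omega_term normrM g -[leLHS]mulrA.
rewrite ler_wpM2l // -[X in _ * X](gtr0_norm M0) -normrM mulrBl.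
apply: le_trans (ler_normB _ _) _; rewrite !normrM (gtr0_norm M0) -!mulrA.
have [Ta Tb] := hT e oe.
by apply: lerD; rewrite !mulrA -[X in _ <= X]mulr1 -mulrA ler_wpM2l ?mulr_ge0 ?inv.
Qed.

(** The bodies after the first three are moved far away by a factor S, which leaves the inner
    meeting times unchanged. One choice must serve all signs, because the signs are fixed only
    later, depending on the positions. *)
Lemma positions_exist : exists al : 'I_k.+3 -> C,
  let T e := - pair_diff chi id al e / bee e in
  [/\ \sum_i cmi i * al i = 0, forall e, pair_diff chi id al e != 0,
   forall e, T e = T pair01 -> e = pair01, forall e, T e = T pair02 -> e = pair02 &
   forall s, (forall e, s e * s e = 1) -> \sum_e omega_term s T e != 0].
Proof.
have A0 := bee_neq0 pair01; have B0 := bee_neq0 pair02; have D0 := bee_neq0 pair12.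
(* [t] is the ratio of the separations of 02 and 01 at time 0. The first two conditions keep the
   inner meeting times nonzero, the third keeps those of 01 and 02 distinct from each other and from
   that of 12. *)
have [t [t0 t1 tB]] : exists t : C, [/\ t != 0, t != 1 & bee pair02 != t * bee pair01].
  have e1 (l : nat) : (l.+2%:R : C) != 1 by rewrite (eqr_nat C l.+2 1).
  have e0 (l : nat) : (l.+1%:R : C) != 0 by rewrite pnatr_eq0.
  case: (eqVneq (bee pair02) (2 * bee pair01)) => h; last by exists 2; split; [exact: (e0 1%N)|exact: (e1 0%N)|].
  exists 3; split; [exact: (e0 2%N)|exact: (e1 1%N)|]; rewrite h -subr_eq0 -mulrBl mulf_neq0 //.
  by rewrite (_ : 2 - 3 = -1 :> C) ?oppr_eq0 ?oner_eq0 //; ring.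
pose al0 (i : 'I_k.+3) : C := match val i with 1%N => -1 | 2%N => - t | _ => 0 end.
pose ga (i : 'I_k.+3) : C := if (val i < 3)%N then 0 else (val i)%:R.
pose U e : C := - (al0 (pi1 e) - al0 (pi2 e)) / bee e.
pose V e : C := - (ga (pi1 e) - ga (pi2 e)) / bee e.
have V0 e : outer e -> V e != 0.
  move=> oe; rewrite mulf_neq0 ?invr_eq0 ?bee_neq0 // oppr_eq0 subr_eq0 /ga.
  have -> : (val (pi2 e) < 3)%N = false by rewrite ltnNge; have oe3 : (2 < val (pi2 e))%N := oe; rewrite oe3.
  have lt12 : (val (pi1 e) < val (pi2 e))%N := valP e.
  case: ifP => _; last by rewrite eqr_nat neq_ltn lt12.
  by rewrite eq_sym pnatr_eq0 -lt0n; apply: leq_trans oe.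
have Vi e : ~~ outer e -> V e = 0.
  by case/inner_pairP => ->; rewrite /V /ga /pi1 /pi2 /= subrr oppr0 mul0r.
pose Ta := U pair01; pose Tb := U pair02.
have TaE : Ta = - 1 / bee pair01 by rewrite /Ta /U /al0 /pi1 /pi2 /= sub0r opprK.
have TbE : Tb = - t / bee pair02 by rewrite /Tb /U /al0 /pi1 /pi2 /= sub0r opprK.
have TcE : U pair12 = (1 - t) / bee pair12 by rewrite /U /al0 /pi1 /pi2 /=; congr (_ / _); ring.
have cE : bee pair12 = bee pair02 - bee pair01 by rewrite !rl_chi /pi1 /pi2 /=; ring.
have tAB : bee pair02 - t * bee pair01 != 0 by rewrite subr_eq0.
have Tab : Ta != Tb.
  rewrite -subr_eq0 TaE TbE (_ : _ - _ = - (bee pair02 - t * bee pair01) / (bee pair01 * bee pair02)); last by field; rewrite A0 B0.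
  by rewrite mulf_neq0 ?invr_eq0 ?mulf_neq0 ?oppr_eq0.
have D0' : bee pair02 - bee pair01 != 0 by rewrite -cE.
have Tca : U pair12 != Ta.
  rewrite -subr_eq0 TcE TaE cE (_ : _ - _ = (bee pair02 - t * bee pair01) / ((bee pair02 - bee pair01) * bee pair01)); last by field; rewrite A0 D0'.
  by rewrite mulf_neq0 ?invr_eq0 ?mulf_neq0.
have Tcb : U pair12 != Tb.
  rewrite -subr_eq0 TcE TbE cE (_ : _ - _ = (bee pair02 - t * bee pair01) / ((bee pair02 - bee pair01) * bee pair02)); last by field; rewrite B0 D0'.
  by rewrite mulf_neq0 ?invr_eq0 ?mulf_neq0.
pose sg : seq C := [:: 1; -1].
pose cst3 (sa sb se : C) := triangle_form (cm (m (ord_0 k))) (cm (m (ord_1 k))) (cm (m (ord_2 k))) sa sb se (bee pair01) (bee pair02) *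
  (Ta - Tb) ^- 2 / (cm (m (ord_0 k)) * bee pair01 ^+ 3 * bee pair02 ^+ 3).
have c0 sa sb se : sa * sa = 1 -> sb * sb = 1 -> se * se = 1 -> cst3 sa sb se != 0.
  move=> ha hb he; apply: mulf_neq0; [apply: mulf_neq0|].
  - by rewrite !rl_chi; apply: tri_neq0.
  - by rewrite invr_eq0 expf_neq0 // subr_eq0.
  - by rewrite invr_eq0 !mulf_neq0 ?expf_neq0 // (cmi_neq0 m_gt0).
pose K : C := \sum_(e | outer e) `|cmm e / bee e ^+ 2| * (`|ip e pair02 * (ip pair01 e / bee e - ip pair01 pair02 / bee pair02)| + `|ip e pair01 * (ip pair02 e / bee e - ip pair01 pair02 / bee pair01)|).
have K0 : 0 <= K by apply: sumr_ge0 => e _; rewrite mulr_ge0 ?addr_ge0.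
(* A sum over the eight sign choices, so as to dominate the threshold required by each of them. *)
pose L : C := \sum_(x <- sg) \sum_(y <- sg) \sum_(z <- sg) (K + 1) / `|cst3 x y z|.
have term0 x y z : 0 <= (K + 1) / `|cst3 x y z| by rewrite divr_ge0 // addr_ge0.
have L0 : 0 <= L by apply: sumr_ge0 => x _; apply: sumr_ge0 => y _; apply: sumr_ge0 => z _.
have insg (s : C) : s * s = 1 -> s \in sg by case/sqr_eq1 => ->; rewrite !inE eqxx ?orbT.
have usg : uniq sg by rewrite /= inE andbT -subr_eq0 opprK -mulr2n mulrn_eq0 oner_eq0.
have one_le (s0 : C) (G : C -> C) : (forall x, 0 <= G x) -> s0 * s0 = 1 -> G s0 <= \sum_(x <- sg) G x.
  move=> G0 hs; rewrite (bigD1_seq s0) ?insg //= lerDl; exact: sumr_ge0.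
have KL sa sb se : sa * sa = 1 -> sb * sb = 1 -> se * se = 1 -> (K + 1) / `|cst3 sa sb se| <= L.
  move=> ha hb he.
  apply: le_trans (one_le sa (fun x => \sum_(y <- sg) \sum_(z <- sg) (K + 1) / `|cst3 x y z|) _ ha); last first.
    by move=> x; apply: sumr_ge0 => y _; apply: sumr_ge0 => z _.
  apply: le_trans (one_le sb (fun y => \sum_(z <- sg) (K + 1) / `|cst3 sa y z|) _ hb); last first.
    by move=> y; apply: sumr_ge0 => z _.
  exact: (one_le se (fun z => (K + 1) / `|cst3 sa sb z|)).
pose M := 1 + L; have M1 : 1 <= M by rewrite lerDl.
have M0 : 0 <= M by rewrite addr_ge0.
(* The outer times must avoid 0, so that no pair collides at t = 0, and stay far from the two
   selected letters. *)
pose w (i : 'I_3) : C := match val i with 0%N => 0 | 1%N => Ta | _ => Tb end.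
have [S hS] := @lin_large _ (P * 'I_3)%type (fun p => outer p.1) (fun p => U p.1 - w p.2) (fun p => V p.1) M M0 (fun p => V0 p.1).
pose sh : C := (\sum_i cmi i * (al0 i + S * ga i)) / cm (mtot m).
pose al i := al0 i + S * ga i - sh.
exists al.
set T := fun e => _.
have TE e : T e = U e + S * V e.
  by rewrite /T rl_chi /al /U /V; have := bee_neq0 e; move: (bee e) => D De; field.
have Ti e : ~~ outer e -> T e = U e by move=> oe; rewrite TE Vi // mulr0 addr0.
have Taa : T pair01 = Ta by rewrite Ti. 
have Tbb : T pair02 = Tb by rewrite Ti.
have To e i : outer e -> M <= `|T e - w i|.
  by move=> oe; rewrite TE; have := hS (e, i) oe; rewrite /= addrAC.
have Mp : 0 < M := lt_le_trans ltr01 M1.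
have far e i : outer e -> T e != w i.
  by move=> oe; rewrite -subr_eq0 -normr_gt0; apply: lt_le_trans (To e i oe).
split.
- under eq_bigr do rewrite /al mulrBr; rewrite sumrB -mulr_suml -cm_sum -/(mtot m) /sh mulrC divfK ?mtot3 //.
  by rewrite subrr.
- move=> e; have De := bee_neq0 e.
  have -> : pair_diff chi id al e = - (bee e * T e) by rewrite /T mulrC divfK // opprK.
  rewrite oppr_eq0 mulf_neq0 //; case: (boolP (outer e)) => oe; first exact: (far e ord0 oe).
  rewrite Ti //; case/inner_pairP: oe => ->.
  + by rewrite -/Ta TaE mulf_neq0 ?invr_eq0 // oppr_eq0 oner_eq0.
  + by rewrite -/Tb TbE mulf_neq0 ?invr_eq0 // oppr_eq0.
  + by rewrite TcE mulf_neq0 ?invr_eq0 // subr_eq0 eq_sym.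
- move=> e; rewrite Taa => h; case: (boolP (outer e)) => [oe|oe].
    by have := far e (lift ord0 ord0) oe; rewrite h eqxx.
  move: h; rewrite Ti //; case/inner_pairP: oe => -> // h; first by have hh : Tb = Ta := h; move: Tab; rewrite hh eqxx.
  by move: Tca; rewrite h eqxx.
- move=> e; rewrite Tbb => h; case: (boolP (outer e)) => [oe|oe].
    by have := far e (lift ord0 (lift ord0 ord0)) oe; rewrite h eqxx.
  move: h; rewrite Ti //; case/inner_pairP: oe => -> // h; first by have hh : Ta = Tb := h; move: Tab; rewrite hh eqxx.
  by move: Tcb; rewrite h eqxx.
- move=> s hs; rewrite sum_pairs triangle; first last.
  + by rewrite Taa Tbb !Ti // TaE TbE TcE cE; field; rewrite A0 B0 D0'.
  + by rewrite Taa Tbb.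
  rewrite Taa Tbb -/(cst3 (s pair01) (s pair02) (s pair12)).
  have cn := c0 _ _ _ (hs pair01) (hs pair02) (hs pair12).
  have ob : `|\sum_(e | outer e) omega_term s T e| * M <= K.
    apply: outer_bound => // e oe; rewrite Taa Tbb; split.
      exact: (To e (lift ord0 ord0) oe). exact: (To e (lift ord0 (lift ord0 ord0)) oe).
  rewrite addrC addr_eq0; apply/negP => /eqP h.
  move: ob; rewrite h normrN => ob.
  have cp : 0 < `|cst3 (s pair01) (s pair02) (s pair12)| by rewrite normr_gt0.
  have := KL _ _ _ (hs pair01) (hs pair02) (hs pair12); rewrite ler_pdivrMr // => kl.
  have : `|cst3 (s pair01) (s pair02) (s pair12)| * L <= K by apply: le_trans ob; rewrite ler_wpM2l // lerDr.
  rewrite mulrC => /(le_trans kl); rewrite gerDl ler10 //.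
Qed.
End Omega.

(** * Choice of the signs of the distances *)

Section Family.
Variables (F : numFieldType) (P : finType).
Local Notation T := (sh unit F).
Variables (dp : P -> T) (D : P -> {poly F}) (dv : P -> F).
Hypotheses (dpE : forall e, dp e * dp e = emb (D e)) (dp0 : forall e, dp e <> 0)
  (dvE : forall e, dv e * dv e = (D e).[1]).
Implicit Types (sg : P -> bool) (ga : (P -> bool) -> T) (c : F) (s : seq P).
Definition sgn (b : bool) : F := (-1) ^+ b.
Lemma sgn2 b : sgn b * sgn b = 1. Proof. by rewrite /sgn -expr2 sqrr_sign. Qed.

(* [ga] depends polynomially on eps and on the signed roots [sg e * dp e]; [c] is its
   formal value at eps = 1 and [sg e * dp e = dv e]. *)
Fixpoint sign_poly s ga c : Prop :=
  if s is e :: s' then exists ga0 c0 ga1 c1,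
    [/\ sign_poly s' ga0 c0, sign_poly s' ga1 c1, forall sg, ga sg = ga0 sg + shC (sgn (sg e)) * dp e * ga1 sg & c = c0 + dv e * c1]
  else exists2 a, forall sg, ga sg = emb a & c = a.[1].

Lemma sign_poly_emb s a : sign_poly s (fun _ => emb a) a.[1].
Proof.
elim: s a => [|e s IH] a /=; first by exists a.
exists (fun _ => emb a), a.[1], (fun _ => emb 0), (0 : {poly F}).[1]; split => // [sg|].
  by rewrite rmorph0 mulr0 addr0.
by rewrite horner0 mulr0 addr0.
Qed.
Lemma sign_polyD s ga ga' c c' : sign_poly s ga c -> sign_poly s ga' c' -> sign_poly s (fun sg => ga sg + ga' sg) (c + c').
Proof.
elim: s ga ga' c c' => [|e s IH] ga ga' c c' /=.
  move=> [a h1 ->] [a' h1' ->]; exists (a + a'); rewrite ?hornerD // => sg.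
  by rewrite h1 h1' rmorphD.
move=> [g0 [c0 [g1 [c1 [h1 h2 h3 ->]]]]] [g0' [c0' [g1' [c1' [h1' h2' h3' ->]]]]].
exists (fun sg => g0 sg + g0' sg), (c0 + c0'), (fun sg => g1 sg + g1' sg), (c1 + c1').
split; [exact: IH|exact: IH|move=> sg; rewrite h3 h3'; ring|ring].
Qed.
Lemma sign_polyM s ga ga' c c' : sign_poly s ga c -> sign_poly s ga' c' -> sign_poly s (fun sg => ga sg * ga' sg) (c * c').
Proof.
elim: s ga ga' c c' => [|e s IH] ga ga' c c' /=.
  move=> [a h1 ->] [a' h1' ->]; exists (a * a'); rewrite ?hornerM // => sg.
  by rewrite h1 h1' rmorphM.
move=> [g0 [c0 [g1 [c1 [h1 h2 h3 ->]]]]] [g0' [c0' [g1' [c1' [h1' h2' h3' ->]]]]].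
exists (fun sg => g0 sg * g0' sg + emb (D e) * (g1 sg * g1' sg)), (c0 * c0' + (D e).[1] * (c1 * c1')),
  (fun sg => g0 sg * g1' sg + g1 sg * g0' sg), (c0 * c1' + c1 * c0').
split; first by apply: sign_polyD; [exact: IH|apply: (IH (fun _ => emb (D e))); [exact: sign_poly_emb|exact: IH]].
- by apply: sign_polyD; exact: IH.
- move=> sg; rewrite h3 h3' -dpE.
  have h := congr1 (@shC unit F) (sgn2 (sg e)); move: h; rewrite rmorphM rmorph1 => h.
  rewrite -[dp e * dp e]mul1r -h; ring.
- rewrite -dvE; ring.
Qed.
Lemma sign_poly_root s e : e \in s -> sign_poly s (fun sg => shC (sgn (sg e)) * dp e) (dv e).
Proof.
elim: s => [//|f s IH] /=; rewrite inE => /orP[/eqP->|es].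
  exists (fun _ => emb 0), (0 : {poly F}).[1], (fun _ => emb 1), (1 : {poly F}).[1]; split; try exact: sign_poly_emb.
    by move=> sg; rewrite rmorph0 rmorph1 add0r mulr1.
  by rewrite horner0 hornerC add0r mulr1.
exists (fun sg => shC (sgn (sg e)) * dp e), (dv e), (fun _ => emb 0), (0 : {poly F}).[1]; split; [exact: IH|exact: sign_poly_emb| |].
  by move=> sg; rewrite rmorph0 mulr0 addr0.
by rewrite horner0 mulr0 addr0.
Qed.
Lemma sign_poly_indep s ga c sg sg' : sign_poly s ga c -> (forall e, e \in s -> sg e = sg' e) -> ga sg = ga sg'.
Proof.
elim: s ga c => [|e s IH] ga c /= => [[a h _] _|[g0 [c0 [g1 [c1 [h1 h2 h3 _]]]]] hs]; first by rewrite !h.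
rewrite !h3 (hs e) ?inE ?eqxx // (IH _ _ h1) => [|f fs]; last by apply: hs; rewrite inE fs orbT.
by rewrite (IH _ _ h2) // => f fs; apply: hs; rewrite inE fs orbT.
Qed.
(** Flipping the sign of one root separates g0 from dp e * g1, so both vanish and the induction goes
    on. A single sign choice would not do: if D e is a square, the root is a polynomial in eps whose
    value at 1 may be - dv e. *)
Lemma sign_poly_zero s ga c : uniq s -> sign_poly s ga c -> (forall sg, ga sg = 0) -> c = 0.
Proof.
elim: s ga c => [|e s IH] ga c /= => [_ [a h ->] h0|/andP[es us] [g0 [c0 [g1 [c1 [h1 h2 h3 ->]]]]] h0].
  have := h (fun _ => false); rewrite h0 => /esym /emb_eq0 ->; exact: horner0.
have two0 : shC 2 <> 0 :> T by move=> /(congr1 (fun f : T => cst f)) /eqP; rewrite /= pnatr_eq0.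
have key sg : g0 sg = 0 /\ g1 sg = 0.
  pose st b f := if f == e then b else sg f.
  have hst b : g0 (st b) = g0 sg /\ g1 (st b) = g1 sg.
    by split; [apply: (sign_poly_indep h1)|apply: (sign_poly_indep h2)] => f fs; rewrite /st; case: eqP => // fe; rewrite -fe fs in es.
  have := h3 (st false); have := h3 (st true); rewrite !h0 (hst true).1 (hst true).2 (hst false).1 (hst false).2.
  rewrite /st eqxx /sgn expr1 expr0 rmorphN rmorph1 mulN1r mul1r => e1 e2.
  have g00 : shC 2 * g0 sg = 0.
    rewrite rmorph_nat; transitivity ((g0 sg + - dp e * g1 sg) + (g0 sg + dp e * g1 sg)); first by ring.
    by rewrite -e1 -e2 addr0.
  have g0z : g0 sg = 0 by case: (taylor_nzd g00).
  split=> //; move: e2; rewrite g0z add0r => /esym /taylor_nzd[] // h; by case: (dp0 h).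
rewrite (IH _ _ us h1) => [|sg]; last by case: (key sg).
by rewrite (IH _ _ us h2) ?mulr0 ?addr0 // => sg; case: (key sg).
Qed.

(** Fractions, written as relations because the series need not be invertible; b != 0 says that the
    denominator survives at eps = 1. *)
Definition sign_rat ga c := exists al a be b, [/\ sign_poly (enum P) al a, sign_poly (enum P) be b, b != 0,
  forall sg, be sg * ga sg = al sg & b * c = a].

Lemma sign_rat_poly ga c : sign_poly (enum P) ga c -> sign_rat ga c.
Proof.
move=> h; exists ga, c, (fun _ => emb 1), (1 : {poly F}).[1]; split => //; first exact: sign_poly_emb.
- by rewrite hornerC oner_neq0.
- by move=> sg; rewrite rmorph1 mul1r.
- by rewrite hornerC mul1r.
Qed.
Lemma sign_rat_ext ga ga' c c' : sign_rat ga c -> (forall sg, ga' sg = ga sg) -> c' = c -> sign_rat ga' c'.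
Proof.
move=> [al [a [be [b [h1 h2 h3 h4 h5]]]]] gE ->; exists al, a, be, b; split=> // sg.
by rewrite gE.
Qed.
Lemma sign_ratC x : sign_rat (fun _ => shC x) x.
Proof. by apply: sign_rat_ext (sign_rat_poly (sign_poly_emb _ x%:P)) _ _ => [sg|]; rewrite ?embC ?hornerC. Qed.
Lemma sign_rat_gen : sign_rat (fun _ => gen) 1.
Proof. by apply: sign_rat_ext (sign_rat_poly (sign_poly_emb _ 'X)) _ _ => [sg|]; rewrite ?embX ?hornerX. Qed.
Lemma sign_rat_root e : sign_rat (fun sg => shC (sgn (sg e)) * dp e) (dv e).
Proof. by apply/sign_rat_poly/sign_poly_root; rewrite mem_enum. Qed.
Lemma sign_ratD ga ga' c c' : sign_rat ga c -> sign_rat ga' c' -> sign_rat (fun sg => ga sg + ga' sg) (c + c').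
Proof.
move=> [al [a [be [b [h1 h2 h3 h4 h5]]]]] [al' [a' [be' [b' [h1' h2' h3' h4' h5']]]]].
exists (fun sg => be' sg * al sg + be sg * al' sg), (b' * a + b * a'), (fun sg => be sg * be' sg), (b * b').
split; [by apply: sign_polyD; exact: sign_polyM|exact: sign_polyM|by rewrite mulf_neq0| |].
  by move=> sg; rewrite -h4 -h4'; ring.
by rewrite -h5 -h5'; ring.
Qed.
Lemma sign_ratM ga ga' c c' : sign_rat ga c -> sign_rat ga' c' -> sign_rat (fun sg => ga sg * ga' sg) (c * c').
Proof.
move=> [al [a [be [b [h1 h2 h3 h4 h5]]]]] [al' [a' [be' [b' [h1' h2' h3' h4' h5']]]]].
exists (fun sg => al sg * al' sg), (a * a'), (fun sg => be sg * be' sg), (b * b').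
split; [exact: sign_polyM|exact: sign_polyM|by rewrite mulf_neq0| |].
  by move=> sg; rewrite -h4 -h4'; ring.
by rewrite -h5 -h5'; ring.
Qed.
Lemma sign_ratN ga c : sign_rat ga c -> sign_rat (fun sg => - ga sg) (- c).
Proof.
move=> h; apply: sign_rat_ext (sign_ratM (sign_ratC (-1)) h) _ _ => [sg|]; last by rewrite mulN1r.
by rewrite rmorphN rmorph1 mulN1r.
Qed.
Lemma sign_ratB ga ga' c c' : sign_rat ga c -> sign_rat ga' c' -> sign_rat (fun sg => ga sg - ga' sg) (c - c').
Proof. by move=> h h'; apply: sign_ratD => //; apply: sign_ratN. Qed.
Lemma sign_ratX ga c k : sign_rat ga c -> sign_rat (fun sg => ga sg ^+ k) (c ^+ k).
Proof.
move=> h; elim: k => [|k IH]; first by apply: sign_rat_ext (sign_ratC 1) _ _ => [sg|]; rewrite expr0 ?rmorph1.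
by apply: sign_rat_ext (sign_ratM h IH) _ _ => [sg|]; rewrite exprS.
Qed.
Lemma sign_rat_sum (J : finType) (ga : J -> (P -> bool) -> T) (c : J -> F) : (forall j, sign_rat (ga j) (c j)) ->
  sign_rat (fun sg => \sum_j ga j sg) (\sum_j c j).
Proof.
move=> h; elim: (index_enum J) => [|j r IH].
  by apply: sign_rat_ext (sign_ratC 0) _ _ => [sg|]; rewrite big_nil ?rmorph0.
by apply: sign_rat_ext (sign_ratD (h j) IH) _ _ => [sg|]; rewrite big_cons.
Qed.
Lemma sign_rat_solve de nu ga d c : sign_rat de d -> d != 0 -> sign_rat nu c -> (forall sg, de sg * ga sg = nu sg) ->
  sign_rat ga (c / d).
Proof.
move=> [al [a [be [b [h1 h2 h3 h4 h5]]]]] d0 [al' [a' [be' [b' [h1' h2' h3' h4' h5']]]]] hE.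
exists (fun sg => be sg * al' sg), (b * a'), (fun sg => be' sg * al sg), (b' * a).
split; [exact: sign_polyM|exact: sign_polyM| | |].
- by rewrite mulf_neq0 // -h5 mulf_neq0.
- by move=> sg; rewrite -h4 -h4' -hE; ring.
- rewrite -h5 -h5'; by field.
Qed.
Lemma sign_rat_zero ga c : sign_rat ga c -> (forall sg, ga sg = 0) -> c = 0.
Proof.
move=> [al [a [be [b [h1 h2 h3 h4 h5]]]]] g0.
have a0 : a = 0 by apply: (sign_poly_zero (enum_uniq _) h1) => sg; rewrite -h4 g0 mulr0.
by move/eqP: h5; rewrite a0 mulf_eq0 (negPf h3) => /eqP.
Qed.

Definition shCm : {rmorphism F -> T} := shC.
Lemma sign_rat_heval N (f : {mpoly F[N]}) d (X : (P -> bool) -> 'I_N -> T) (x : 'I_N -> F) :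
  (forall k, sign_rat (fun sg => X sg k) (x k)) -> sign_rat (fun sg => heval shCm d f (X sg) gen) (heval idfun d f x 1).
Proof.
move=> hX; have comp : forall j, sign_rat (fun sg => (hcomp shCm (X sg) f)`_j) (hcomp idfun x f)`_j.
  elim/mpoly_ring_ind: f => [c|i|f g hf hg|f g hf hg] j.
  - apply: sign_rat_ext (sign_ratC (if j == 0%N then c else 0)) _ _ => [sg|]; rewrite hcompC coefC //.
    by case: (j == 0%N); rewrite ?rmorph0.
  - apply: sign_rat_ext (sign_ratM (hX i) (sign_ratC (j == 1%N)%:R)) _ _ => [sg|]; rewrite hcompX coefZ coefX //.
    by rewrite rmorph_nat.
  - by apply: sign_rat_ext (sign_ratD (hf j) (hg j)) _ _ => [sg|]; rewrite hcompD coefD.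
  - apply: sign_rat_ext (sign_rat_sum (fun l : 'I_j.+1 => sign_ratM (hf l) (hg (j - l)%N))) _ _ => [sg|]; by rewrite hcompM coefM.
apply: sign_rat_ext (sign_rat_sum (fun l : 'I_d.+1 => sign_ratM (comp l) (sign_ratX (d - l)%N sign_rat_gen))) _ _ => //.
Qed.
End Family.

(** * Square roots and inverses of power series *)

Section Roots.
Variable F : numFieldType.
Local Notation T := (sh unit F).

Lemma taylor_sqrt (a : F) (E : T) : a != 0 -> exists y : T, (shC a + gen ^+ 2 * y) ^+ 2 = shC (a ^+ 2) + gen ^+ 2 * E.
Proof.
move=> a0; pose Psi (Y : unit -> T) (_ : unit) : T := shC (2 * a)^-1 * (E - gen ^+ 2 * Y tt ^+ 2).
have [|Y /(_ tt) hY] := @strict_causal_fixpoint F unit Psi.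
  move=> k Y Y' h x; apply: agreeM; first exact: agree_refl.
  apply: agreeB; first exact: agree_refl.
  apply: agreeW; apply: (agree_genX (p := 2)); exact: agreeX.
exists (Y tt).
have h : 2 * shC a * Y tt = E - gen ^+ 2 * Y tt ^+ 2.
  have c1 : shC (2 * a) * shC (2 * a)^-1 = 1 :> T.
    by rewrite -rmorphM divff ?rmorph1 // mulf_neq0 // pnatr_eq0.
  by move: c1; rewrite rmorphM rmorph_nat => c1; rewrite {1}hY /Psi mulrA c1 mul1r.
transitivity (shC a ^+ 2 + gen ^+ 2 * (2 * shC a * Y tt + gen ^+ 2 * Y tt ^+ 2)); first by ring.
by rewrite h rmorphXn /=; ring.
Qed.

Lemma taylor_inv (a : F) (E : T) : a != 0 -> exists y : T, (shC a + gen * E) * y = 1.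
Proof.
move=> a0; pose Psi (Y : unit -> T) (_ : unit) : T := shC a^-1 * (1 - gen * (E * Y tt)).
have [|Y /(_ tt) hY] := @strict_causal_fixpoint F unit Psi.
  move=> k Y Y' h x; apply: agreeM; first exact: agree_refl.
  apply: agreeB; first exact: agree_refl.
  apply: agree_gen; apply: agreeM => //; exact: agree_refl.
exists (Y tt); rewrite mulrDl {1}hY /Psi mulrA -rmorphM divff // rmorph1; ring.
Qed.
End Roots.

(** * Initial data *)

Section InitialData.
Variables (R : realType) (k : nat) (m : 'I_k.+3 -> R).
Hypothesis m_gt0 : forall i, 0 < m i.
Local Notation C := R[i].
Local Notation n := k.+3.
Local Notation P := (pairs n).
Local Notation chi := (chiC R (n := n)).
Local Notation T := (sh unit C).
Local Notation cmi := (fun i => cm (m i)).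
Local Notation cmm := (fun e : P => cm (m (pi1 e) * m (pi2 e))).
Local Notation ii := (iC R).
Variables (al be : 'I_n -> C) (h c : C) (x : 'I_(nv n) -> C).
Local Notation ae := (pair_diff chi id al).
Hypotheses (ae0 : forall e, ae e != 0)
  (comal : \sum_i cmi i * al i = 0) (combe : \sum_i cmi i * be i = 0)
  (kin0 : \sum_i cmi i * be i ^+ 2 = 0) (hx : inMhc m h c x).

Definition with_lead (f : 'I_n -> C) (g : 'I_n -> 'I_2 -> T) i (a : 'I_2) : T :=
  (if a == 0 then shC (f i) else 0) + gen ^+ 2 * g i a.
(** Correcting the momenta along [kap1] and [kap2] leaves the total momentum unchanged. *)
Definition kap1 i : C := (i == ord_0 k)%:R - (i == ord_1 k)%:R.
Definition kap2 i : C := (i == ord_0 k)%:R - (i == ord_2 k)%:R.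
(** The determinant of the system for the two unknowns S1, S2 when the momenta are corrected by (S1
    kap1 + S2 kap2) (1, i) in order to adjust energy and angular momentum. *)
Definition pdet (r p : 'I_n -> 'I_2 -> C) : C :=
  (\sum_i kap1 i / cm (m i) * (p i 0 + ii * p i 1)) * (\sum_i kap2 i * (ii * r i 0 - r i 1))
  - (\sum_i kap2 i / cm (m i) * (p i 0 + ii * p i 1)) * (\sum_i kap1 i * (ii * r i 0 - r i 1)).
Hypotheses (det_x : pdet (fun i a => x (vr i a)) (fun i a => x (vp i a)) != 0)
  (det_0 : pdet (fun i a => if a == 0 then al i else 0) (fun i a => if a == 0 then cm (m i) * be i else 0) != 0).

Let lead0 (f : 'I_n -> C) i (a : 'I_2) : C := if a == 0 then f i else 0.
Let mbe i := cm (m i) * be i.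
Let r0 i a : C := x (vr i a) - lead0 al i a.
Let q0 i a : C := x (vp i a) - lead0 mbe i a.
Let rr i a : T := with_lead al (fun i a => shC (r0 i a)) i a.
Let pL i a : T := with_lead mbe (fun i a => shC (q0 i a)) i a.
Let M1 (ka : 'I_n -> C) : T := \sum_i shC (ka i / cm (m i)) * (pL i 0 + shC ii * pL i 1).
Let M2 (ka : 'I_n -> C) : T := \sum_i shC (ka i) * (shC ii * rr i 0 - rr i 1).

Lemma lead_split (f : 'I_n -> C) g i a : with_lead f (fun i a => shC (g i a)) i a = shC (lead0 f i a) + gen ^+ 2 * shC (g i a) :> T.
Proof. by rewrite /with_lead /lead0; case: (a == 0); rewrite ?rmorph0. Qed.

Lemma M1E ka : exists z, M1 ka = shC (\sum_i ka i / cm (m i) * (lead0 mbe i 0 + ii * lead0 mbe i 1)) + gen * z.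
Proof.
exists (gen * \sum_i shC (ka i / cm (m i)) * (shC (q0 i 0) + shC ii * shC (q0 i 1))).
rewrite rmorph_sum !mulr_sumr -big_split; apply: eq_bigr => i _ /=.
by move: (ka i / _) => u; rewrite /pL !lead_split !(rmorphM, rmorphD); ring.
Qed.
Lemma M2E ka : exists z, M2 ka = shC (\sum_i ka i * (ii * lead0 al i 0 - lead0 al i 1)) + gen * z.
Proof.
exists (gen * \sum_i shC (ka i) * (shC ii * shC (r0 i 0) - shC (r0 i 1))).
rewrite rmorph_sum !mulr_sumr -big_split; apply: eq_bigr => i _ /=.
by rewrite /rr !lead_split !(rmorphM, rmorphB); ring.
Qed.

Lemma det_inv : exists di : T, (M1 kap1 * M2 kap2 - M1 kap2 * M2 kap1) * di = 1.
Proof.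
have [z1 ->] := M1E kap1; have [z2 ->] := M1E kap2; have [z3 ->] := M2E kap1; have [z4 ->] := M2E kap2.
set a1 := \sum_i _; set a2 := \sum_i _; set a3 := \sum_i _; set a4 := \sum_i _.
have d0 : a1 * a2 - a3 * a4 != 0 by exact: det_0.
have [di hdi] := taylor_inv (z1 * shC a2 + shC a1 * z4 + gen * z1 * z4 - (z2 * shC a4 + shC a3 * z3 + gen * z2 * z3)) d0.
exists di; rewrite -[RHS]hdi; congr (_ * _); rewrite rmorphB !rmorphM; ring.
Qed.

Let rp e a : {poly C} := (lead0 (fun _ => ae e) (ord_0 k) a)%:P + 'X^2 * (r0 (pi1 e) a - r0 (pi2 e) a)%:P.
Let D e : {poly C} := \sum_a rp e a ^+ 2.

Lemma ae_diff e : ae e = al (pi1 e) - al (pi2 e). Proof. exact: rl_chi. Qed.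
Lemma emb_rp e a : emb (rp e a) = rr (pi1 e) a - rr (pi2 e) a.
Proof.
rewrite /rp rmorphD rmorphM rmorphXn /= embX !embC /rr !lead_split /lead0 ae_diff rmorphB.
by case: (a == 0); rewrite ?rmorphB ?rmorph0; ring.
Qed.
Lemma rp1 e a : (rp e a).[1] = relv x e a.
Proof.
rewrite /rp hornerD hornerM hornerXn !hornerC expr1n mul1r /r0 /relv /lead0 ae_diff.
by case: (a == 0); ring.
Qed.
Lemma embD e : emb (D e) = \sum_a (rr (pi1 e) a - rr (pi2 e) a) ^+ 2.
Proof. by rewrite rmorph_sum; apply: eq_bigr => a _ /=; rewrite rmorphXn /= emb_rp. Qed.
Lemma D1 e : x (vd e) * x (vd e) = (D e).[1].
Proof.
have /(inMhcP (n := n) isT m_gt0)[_ [hd _ _ _ _]] := hx.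
by rewrite -expr2 hd /D horner_sum; apply: eq_bigr => a _; rewrite horner_exp rp1.
Qed.

Lemma dp_exists e : exists y, (shC (ae e) + gen ^+ 2 * y) ^+ 2 = emb (D e).
Proof.
have [y hy] := taylor_sqrt (2 * shC (ae e) * shC (r0 (pi1 e) 0 - r0 (pi2 e) 0) + gen ^+ 2 * (shC (r0 (pi1 e) 0 - r0 (pi2 e) 0) ^+ 2 + shC (r0 (pi1 e) 1 - r0 (pi2 e) 1) ^+ 2)) (ae0 e).
have e0 : emb (rp e 0) = shC (ae e) + gen ^+ 2 * shC (r0 (pi1 e) 0 - r0 (pi2 e) 0) :> T.
  by rewrite /rp rmorphD rmorphM rmorphXn /= embX !embC.
have e1 : emb (rp e 1) = gen ^+ 2 * shC (r0 (pi1 e) 1 - r0 (pi2 e) 1) :> T.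
  by rewrite /rp rmorphD rmorphM rmorphXn /= embX !embC /lead0 /= rmorph0 add0r.
have sq (u : {poly C}) : emb (u ^+ 2) = emb u ^+ 2 := rmorphXn (@emb C) 2 u.
have sc (u : C) : shC (u ^+ 2) = shC u ^+ 2 :> T := rmorphXn (@shC unit C) 2 u.
have eD : emb (D e) = emb (rp e 0) ^+ 2 + emb (rp e 1) ^+ 2 by rewrite /D sum2 rmorphD -!sq.
exists y; rewrite eD e0 e1 hy sc; ring.
Qed.

(** In rescaled coordinates the family joins the collinear data at eps = 0 to x at eps = 1.
    Positions are interpolated, momenta corrected so as to stay on the level, and the signs of the
    distances left free. Since x is on the level the corrections vanish formally at eps = 1, so g
    cannot vanish along the family for all signs. *)
Lemma initial_data (Dg : nat) (g : {mpoly C[nv n]}) : deg_bound Dg g -> g.@[x] != 0 ->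
  exists (s : P -> C) (rh ph : 'I_n -> 'I_2 -> T) (dl io : P -> T),
  let r := with_lead al rh in let p := with_lead mbe ph in
  [/\ [/\ forall e, s e * s e = 1, forall a, \sum_i shC (cmi i) * rh i a = 0 & forall a, \sum_i ph i a = 0],
    [/\ forall e, exists z, dl e = shC (s e * ae e) + gen * z,
      forall e, dl e ^+ 2 = \sum_a (r (pi1 e) a - r (pi2 e) a) ^+ 2 & forall e, io e * dl e = 1],
    \sum_i shC (2 * cm (m i))^-1 * \sum_a p i a ^+ 2 - gen ^+ 3 * \sum_e shC (cmm e) * io e = shC h * gen ^+ 2,
    \sum_i (r i 0 * p i 1 - r i 1 * p i 0) = shC c * gen ^+ 2 &
    heval (shCm C) Dg g (mk_pt r p dl) gen <> 0].
Proof.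
move=> bg gx.
have [y hy] := choice dp_exists.
pose dp e : T := shC (ae e) + gen ^+ 2 * y e.
have dpE e : dp e * dp e = emb (D e) by rewrite -hy expr2.
have ivx e : exists z, dp e * z = 1.
  have [z hz'] := taylor_inv (gen * y e) (ae0 e).
  by exists z; rewrite -hz' /dp; ring.
have [iv hiv] := choice ivx.
have dp0 e : dp e <> 0 by move=> z; have := hiv e; rewrite z mul0r => /esym/eqP; rewrite oner_eq0.
have [di hdi] := det_inv.
have /(inMhcP (n := n) isT m_gt0)[hN [hd hr hp hH hC]] := hx.
pose dl (sg : P -> bool) e : T := shC (sgn C (sg e)) * dp e.
pose io (sg : P -> bool) e : T := shC (sgn C (sg e)) * iv e.
have sg2 b : shC (sgn C b) * shC (sgn C b) = 1 :> T by rewrite -rmorphM sgn2 rmorph1.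
have iod sg e : io sg e * dl sg e = 1 by rewrite /io /dl mulrACA sg2 mul1r mulrC hiv.
(* [tau] and [sig] are the kinetic energy and the angular momentum of the uncorrected data, divided
   by eps^2; [R1] and [R2] are what the corrections must supply. *)
pose tau : T := \sum_i (shC (be i * q0 i 0) + gen ^+ 2 * shC ((2 * cm (m i))^-1 * (q0 i 0 ^+ 2 + q0 i 1 ^+ 2))).
pose sig : T := \sum_i (shC (al i * q0 i 1 - r0 i 1 * mbe i) + gen ^+ 2 * shC (r0 i 0 * q0 i 1 - r0 i 1 * q0 i 0)).
pose R1 sg : T := shC h + gen * (\sum_e shC (cmm e) * io sg e) - tau.
pose R2 : T := shC c - sig.
pose S1 sg : T := (R1 sg * M2 kap2 - R2 * M1 kap2) * di.
pose S2 sg : T := (M1 kap1 * R2 - M2 kap1 * R1 sg) * di.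
pose dt : T := M1 kap1 * M2 kap2 - M1 kap2 * M2 kap1.
have dS1 sg : dt * S1 sg = R1 sg * M2 kap2 - R2 * M1 kap2.
  by rewrite /S1 mulrC -mulrA [di * _]mulrC hdi mulr1.
have dS2 sg : dt * S2 sg = M1 kap1 * R2 - M2 kap1 * R1 sg.
  by rewrite /S2 mulrC -mulrA [di * _]mulrC hdi mulr1.
have eq1 sg : M1 kap1 * S1 sg + M1 kap2 * S2 sg = R1 sg.
  transitivity (R1 sg * (dt * di)); last by rewrite hdi mulr1.
  by rewrite /S1 /S2 /dt; ring.
have eq2 sg : M2 kap1 * S1 sg + M2 kap2 * S2 sg = R2.
  transitivity (R2 * (dt * di)); last by rewrite hdi mulr1.
  by rewrite /S1 /S2 /dt; ring.
(* [w] is isotropic, so that energy and angular momentum are affine in [S1] and [S2]. *)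
pose w (a : 'I_2) : C := if a == 0 then 1 else ii.
pose ss sg i : T := S1 sg * shC (kap1 i) + S2 sg * shC (kap2 i).
pose ph sg i a : T := shC (q0 i a) + ss sg i * shC (w a).
pose p sg := with_lead mbe (ph sg).
have pE sg i a : p sg i a = pL i a + gen ^+ 2 * (ss sg i * shC (w a)).
  by rewrite /p /pL /with_lead /ph; ring.
have i2 : shC ii * shC ii = -1 :> T by rewrite -rmorphM iC2 rmorphN rmorph1.
have M1s sg : \sum_i shC (cm (m i))^-1 * (ss sg i * (pL i 0 + shC ii * pL i 1)) = R1 sg.
  rewrite -(eq1 sg) /M1 !mulr_suml -big_split; apply: eq_bigr => i _ /=.
  by rewrite /ss !rmorphM; ring.
have M2s sg : \sum_i ss sg i * (shC ii * rr i 0 - rr i 1) = R2.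
  rewrite -(eq2 sg) /M2 !mulr_suml -big_split; apply: eq_bigr => i _ /=.
  by rewrite /ss; ring.
have pL0 i : pL i 0 = shC (mbe i) + gen ^+ 2 * shC (q0 i 0) by [].
have pL1 i : pL i 1 = gen ^+ 2 * shC (q0 i 1) by rewrite /pL /with_lead /= add0r.
have rr0 i : rr i 0 = shC (al i) + gen ^+ 2 * shC (r0 i 0) by [].
have rr1 i : rr i 1 = gen ^+ 2 * shC (r0 i 1) by rewrite /rr /with_lead /= add0r.
have m0 i := cmi_neq0 m_gt0 i.
have two0 : (2 : C) != 0 by rewrite pnatr_eq0.
have e1 i : 2^-1 * (cm (m i) * be i ^+ 2) = (2 * cm (m i))^-1 * (mbe i * mbe i).
  by rewrite /mbe; move: (2) two0 (m0 i) => tt tt0 mi0; field; rewrite mi0 tt0.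
have e2 i : be i * q0 i 0 = 2 * (2 * cm (m i))^-1 * mbe i * q0 i 0.
  by rewrite /mbe; move: (2) two0 (m0 i) => tt tt0 mi0; field; rewrite mi0 tt0.
have e3 i : (cm (m i))^-1 = 2 * (2 * cm (m i))^-1.
  by move: (2) two0 (m0 i) => tt tt0 mi0; field; rewrite mi0 tt0.
have kin sg : \sum_i shC (2 * cm (m i))^-1 * (\sum_a p sg i a ^+ 2) = gen ^+ 2 * (tau + R1 sg) :> T.
  transitivity (shC (2^-1 * \sum_i cm (m i) * be i ^+ 2) + gen ^+ 2 * (tau + R1 sg)); last by rewrite kin0 mulr0 rmorph0 add0r.
  rewrite -(M1s sg) mulr_sumr /tau -big_split mulr_sumr rmorph_sum -big_split; apply: eq_bigr => i _ /=.
  rewrite e1 e2 e3 -!expr2 sum2 !pE pL0 pL1 /w /= rmorph1.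
  move: ((2 * cm (m i))^-1) (mbe i) (q0 i 0) (q0 i 1) (ss sg i) => u b qq qq' z.
  have s2 : shC (2 * u) = 2 * shC u :> T by rewrite rmorphM rmorph_nat.
  have s3 : shC (2 * u * b * qq) = 2 * shC u * shC b * shC qq :> T by rewrite !rmorphM rmorph_nat.
  have s4 : shC (u * b ^+ 2) = shC u * (shC b * shC b) :> T by rewrite expr2 !rmorphM.
  have s5 : shC (u * (qq ^+ 2 + qq' ^+ 2)) = shC u * (shC qq * shC qq + shC qq' * shC qq') :> T.
    by rewrite !expr2 rmorphM rmorphD !rmorphM.
  rewrite s2 s3 s4 s5.
  transitivity (shC u * (shC b * shC b) + gen ^+ 2 * (2 * shC u * shC b * shC qq + gen ^+ 2 * (shC u * (shC qq * shC qq + shC qq' * shC qq')) + 2 * shC u * (z * (shC b + gen ^+ 2 * shC qq + shC ii * (gen ^+ 2 * shC qq')))) + gen ^+ 4 * shC u * z ^+ 2 * (1 + shC ii * shC ii)); first by ring.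
  by rewrite i2 subrr mulr0 addr0.
have ang sg : \sum_i (rr i 0 * p sg i 1 - rr i 1 * p sg i 0) = gen ^+ 2 * (sig + R2).
  rewrite -(M2s sg) /sig -big_split mulr_sumr; apply: eq_bigr => i _ /=.
  rewrite !pE pL0 pL1 rr0 rr1 /w /= rmorph1 !(rmorphB, rmorphM); ring.
have fM1 ka : sign_rat dp (fun e => x (vd e)) (fun _ => M1 ka) (\sum_i ka i / cm (m i) * (x (vp i 0) + ii * x (vp i 1))).
  have fp i a : sign_rat dp (fun e => x (vd e)) (fun _ => pL i a) (x (vp i a)).
    apply: sign_rat_ext (sign_ratD dpE D1 (sign_ratC _ _ (lead0 mbe i a)) (sign_ratM dpE D1 (sign_ratX dpE D1 2 (sign_rat_gen _ _)) (sign_ratC _ _ (q0 i a)))) _ _ => [sg|].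
      exact: lead_split.
    by rewrite expr1n mul1r /q0 addrC subrK.
  exact: (sign_rat_sum dpE D1 (fun i => sign_ratM dpE D1 (sign_ratC _ _ (ka i / cm (m i))) (sign_ratD dpE D1 (fp i 0) (sign_ratM dpE D1 (sign_ratC _ _ ii) (fp i 1))))).
have fr i a : sign_rat dp (fun e => x (vd e)) (fun _ => rr i a) (x (vr i a)).
  apply: sign_rat_ext (sign_ratD dpE D1 (sign_ratC _ _ (lead0 al i a)) (sign_ratM dpE D1 (sign_ratX dpE D1 2 (sign_rat_gen _ _)) (sign_ratC _ _ (r0 i a)))) _ _ => [sg|].
    exact: lead_split.
  by rewrite expr1n mul1r /r0 addrC subrK.
have fM2 ka : sign_rat dp (fun e => x (vd e)) (fun _ => M2 ka) (\sum_i ka i * (ii * x (vr i 0) - x (vr i 1))).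
  exact: (sign_rat_sum dpE D1 (fun i => sign_ratM dpE D1 (sign_ratC _ _ (ka i)) (sign_ratB dpE D1 (sign_ratM dpE D1 (sign_ratC _ _ ii) (fr i 0)) (fr i 1)))).
have fdl e : sign_rat dp (fun e => x (vd e)) (fun sg => dl sg e) (x (vd e)) by exact: sign_rat_root.
have fio e : sign_rat dp (fun e => x (vd e)) (fun sg => io sg e) (1 / x (vd e)).
  apply: (sign_rat_solve dpE D1 (fdl e) (hN e) (sign_ratC _ _ 1)) => sg.
  by rewrite rmorph1 mulrC iod.
(* The value at eps = 1 is 0 because x satisfies the energy equation; likewise for [R2] below. *)
have fR1 : sign_rat dp (fun e => x (vd e)) R1 0.
  apply: sign_rat_ext (sign_ratB dpE D1 (sign_ratD dpE D1 (sign_ratC _ _ h) (sign_ratM dpE D1 (sign_rat_gen _ _) (sign_rat_sum dpE D1 (fun e => sign_ratM dpE D1 (sign_ratC _ _ (cmm e)) (fio e)))))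
    (sign_rat_sum dpE D1 (fun i => sign_ratD dpE D1 (sign_ratC _ _ (be i * q0 i 0)) (sign_ratM dpE D1 (sign_ratX dpE D1 2 (sign_rat_gen _ _)) (sign_ratC _ _ ((2 * cm (m i))^-1 * (q0 i 0 ^+ 2 + q0 i 1 ^+ 2))))))) _ _ => //.
  rewrite mul1r -[in RHS]hH; under [X in _ = _ + X - _]eq_bigr do rewrite mul1r.
  rewrite subrK; apply/eqP; rewrite eq_sym subr_eq0; apply/eqP.
  transitivity (2^-1 * \sum_i cm (m i) * be i ^+ 2 + \sum_i (be i * q0 i 0 + 1 ^+ 2 * ((2 * cm (m i))^-1 * (q0 i 0 ^+ 2 + q0 i 1 ^+ 2)))); last by rewrite kin0 mulr0 add0r.
  rewrite mulr_sumr -big_split; apply: eq_bigr => i _ /=.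
  rewrite cm2M e1 e2 sum2 /q0 /lead0 /= subr0; ring.
have fR2 : sign_rat dp (fun e => x (vd e)) (fun _ => R2) 0.
  apply: sign_rat_ext (sign_ratB dpE D1 (sign_ratC _ _ c) (sign_rat_sum dpE D1 (fun i => sign_ratD dpE D1 (sign_ratC _ _ (al i * q0 i 1 - r0 i 1 * mbe i)) (sign_ratM dpE D1 (sign_ratX dpE D1 2 (sign_rat_gen _ _)) (sign_ratC _ _ (r0 i 0 * q0 i 1 - r0 i 1 * q0 i 0)))))) _ _ => //.
  rewrite -[in RHS]hC; apply/eqP; rewrite eq_sym subr_eq0; apply/eqP; apply: eq_bigr => i _.
  by rewrite /r0 /q0 /lead0 /=; ring.
have fdt : sign_rat dp (fun e => x (vd e)) (fun _ => dt) (pdet (fun i a => x (vr i a)) (fun i a => x (vp i a))).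
  exact: (sign_ratB dpE D1 (sign_ratM dpE D1 (fM1 kap1) (fM2 kap2)) (sign_ratM dpE D1 (fM1 kap2) (fM2 kap1))).
have fS1 : sign_rat dp (fun e => x (vd e)) S1 0.
  apply: sign_rat_ext (sign_rat_solve dpE D1 fdt det_x (sign_ratB dpE D1 (sign_ratM dpE D1 fR1 (fM2 kap2)) (sign_ratM dpE D1 fR2 (fM1 kap2))) dS1) _ _ => //.
  by rewrite !mul0r subrr mul0r.
have fS2 : sign_rat dp (fun e => x (vd e)) S2 0.
  apply: sign_rat_ext (sign_rat_solve dpE D1 fdt det_x (sign_ratB dpE D1 (sign_ratM dpE D1 (fM1 kap1) fR2) (sign_ratM dpE D1 (fM2 kap1) fR1)) dS2) _ _ => //.
  by rewrite !mulr0 subrr mul0r.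
have fp i a : sign_rat dp (fun e => x (vd e)) (fun sg => p sg i a) (x (vp i a)).
  have fss : sign_rat dp (fun e => x (vd e)) (fun sg => ss sg i) 0.
    apply: sign_rat_ext (sign_ratD dpE D1 (sign_ratM dpE D1 fS1 (sign_ratC _ _ (kap1 i))) (sign_ratM dpE D1 fS2 (sign_ratC _ _ (kap2 i)))) _ _ => //.
    by rewrite !mul0r addr0.
  have fq : sign_rat dp (fun e => x (vd e)) (fun sg => ph sg i a) (q0 i a).
    apply: sign_rat_ext (sign_ratD dpE D1 (sign_ratC _ _ (q0 i a)) (sign_ratM dpE D1 fss (sign_ratC _ _ (w a)))) _ _ => //.
    by rewrite mul0r addr0.
  apply: sign_rat_ext (sign_ratD dpE D1 (sign_ratC _ _ (lead0 mbe i a)) (sign_ratM dpE D1 (sign_ratX dpE D1 2 (sign_rat_gen _ _)) fq)) _ _ => [sg|].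
    by rewrite /p /with_lead /lead0; case: (a == 0); rewrite ?rmorph0.
  by rewrite expr1n mul1r /q0 addrC subrK.
(* Otherwise [sign_rat_zero] would give g(x) = 0. *)
have [sg hsg] : exists sg, heval (shCm C) Dg g (mk_pt rr (p sg) (dl sg)) gen <> 0.
  apply: contrapT => nex; move/negP: gx; apply.
  have fX kk : sign_rat dp (fun e => x (vd e)) (fun sg => mk_pt rr (p sg) (dl sg) kk) (x kk).
    rewrite -(enum_valK kk); case: (enum_val kk) => [[[i a]|[i a]]|e].
    - by apply: sign_rat_ext (fr i a) _ _ => // sg; exact: mk_vr.
    - by apply: sign_rat_ext (fp i a) _ _ => // sg; exact: mk_vp.
    - by apply: sign_rat_ext (fdl e) _ _ => // sg; exact: mk_vd.
  have := sign_rat_zero dp0 (sign_rat_heval dpE D1 g Dg fX).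
  rewrite hevalE ?oner_neq0 // expr1n mul1r => gg.
  have xE : (fun i => x i / 1) = x by apply: funext => i; rewrite divr1.
  rewrite xE in gg; rewrite gg // => sg; apply: contrapT => z; by apply: nex; exists sg.
exists (fun e => sgn C (sg e)), (fun i a => shC (r0 i a)), (ph sg), (dl sg), (io sg); split.
- split; first by move=> e; exact: sgn2.
    move=> a; transitivity (shC (\sum_i cm (m i) * x (vr i a) - (if a == 0 then \sum_i cm (m i) * al i else 0)) : T).
      rewrite rmorphB !rmorph_sum /r0 /lead0; case: (a == 0); rewrite ?rmorph_sum ?rmorph0 -?sumrB ?subr0; apply: eq_bigr => i _.
        by rewrite -rmorphM -rmorphB mulrBr.
      by rewrite subr0 -rmorphM.
    by rewrite hr comal; case: ifP => _; rewrite subrr rmorph0.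
  move=> a; rewrite big_split -mulr_suml big_split /= -!mulr_sumr -!rmorph_sum.
  have ks (j : 'I_n) : \sum_i ((i == ord_0 k)%:R - (i == j)%:R) = 0 :> C.
    have single (l : 'I_n) : \sum_i (i == l)%:R = 1 :> C.
      by rewrite (bigD1 l) //= eqxx big1 ?addr0 // => i /negPf ->.
    by rewrite sumrB !single subrr.
  rewrite !ks rmorph0 !mulr0 addr0 mul0r addr0 /q0 sumrB hp /lead0 /mbe.
  by case: (a == 0); rewrite ?combe ?big1 ?subrr ?rmorph0.
- split; [|move=> e|by []].
    by move=> e; exists (gen * (shC (sgn C (sg e)) * y e)); rewrite /dl /dp rmorphM; ring.
  by rewrite -embD -dpE /dl expr2 mulrACA sg2 mul1r.
- rewrite kin /R1; ring.
- rewrite ang /R2; ring.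
- exact: hsg.
Qed.
End InitialData.

(** * A point of the level where the correction system is solvable *)

Section LevelPoint.
Variables (R : realType) (k : nat) (m : 'I_k.+3 -> R).
Hypothesis m_gt0 : forall i, 0 < m i.
Local Notation C := R[i].
Local Notation n := k.+3.
Local Notation chi := (chiC R (n := n)).
Local Notation cmi := (fun i => cm (m i)).
Local Notation cmm := (fun e : pairs n => cm (m (pi1 e) * m (pi2 e))).
Local Notation ii := (iC R).
Local Notation kap1 := (kap1 R (k := k)).
Local Notation kap2 := (kap2 R (k := k)).

Definition pdet_poly : {mpoly C[nv n]} :=
  (\sum_i (kap1 i / cm (m i)) *: ('X_(vp i 0) + ii *: 'X_(vp i 1))) * (\sum_i kap2 i *: (ii *: 'X_(vr i 0) - 'X_(vr i 1)))
  - (\sum_i (kap2 i / cm (m i)) *: ('X_(vp i 0) + ii *: 'X_(vp i 1))) * (\sum_i kap1 i *: (ii *: 'X_(vr i 0) - 'X_(vr i 1))).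
Lemma eval_pdet x : pdet_poly.@[x] = pdet m (fun i a => x (vr i a)) (fun i a => x (vp i a)).
Proof.
have h1 (ka : 'I_n -> C) : (\sum_i (ka i / cm (m i)) *: ('X_(vp i 0) + ii *: 'X_(vp i 1)) : {mpoly C[nv n]}).@[x] =
    \sum_i ka i / cm (m i) * (x (vp i 0) + ii * x (vp i 1)).
  by rewrite meval_bigsum; apply: eq_bigr => i _; rewrite mevalZ mevalD mevalZ !mevalXU.
have h2 (ka : 'I_n -> C) : (\sum_i ka i *: (ii *: 'X_(vr i 0) - 'X_(vr i 1)) : {mpoly C[nv n]}).@[x] =
    \sum_i ka i * (ii * x (vr i 0) - x (vr i 1)).
  by rewrite meval_bigsum; apply: eq_bigr => i _; rewrite mevalZ mevalB mevalZ !mevalXU.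
by rewrite /pdet_poly mevalB !mevalM !h1 !h2.
Qed.

Variables (al be : 'I_n -> C).
Local Notation ae := (pair_diff chi id al).
Hypotheses (ae0 : forall e, ae e != 0)
  (comal : \sum_i cmi i * al i = 0) (combe : \sum_i cmi i * be i = 0)
  (kin0 : \sum_i cmi i * be i ^+ 2 = 0).
Let r0 i (a : 'I_2) : C := if a == 0 then al i else 0.
Let p0 i (a : 'I_2) : C := if a == 0 then cm (m i) * be i else 0.
Hypothesis det_0 : pdet m r0 p0 != 0.

(** It makes the open set [pdet_poly] != 0 of the level nonempty, so that a dense set must meet
    it. *)
Lemma level_point (h c : C) : exists x, inMhc m h c x /\ pdet_poly.@[x] != 0.
Proof.
pose M1 (ka : 'I_n -> C) := \sum_i ka i / cm (m i) * (p0 i 0 + ii * p0 i 1).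
pose M2 (ka : 'I_n -> C) := \sum_i ka i * (ii * r0 i 0 - r0 i 1).
pose dt := M1 kap1 * M2 kap2 - M1 kap2 * M2 kap1.
have dt0 : dt != 0 by exact: det_0.
(* As in [initial_data], correcting the momenta along the isotropic direction (1, i)
   makes the two constraints linear. *)
pose t := h + \sum_e cmm e / ae e.
pose s1 := (t * M2 kap2 - c * M1 kap2) / dt.
pose s2 := (M1 kap1 * c - M2 kap1 * t) / dt.
have eq1 : M1 kap1 * s1 + M1 kap2 * s2 = t.
  by rewrite /s1 /s2; move: dt0; rewrite /dt => dt0; field.
have eq2 : M2 kap1 * s1 + M2 kap2 * s2 = c.
  by rewrite /s1 /s2; move: dt0; rewrite /dt => dt0; field.
pose ss i := s1 * kap1 i + s2 * kap2 i.
pose w (a : 'I_2) : C := if a == 0 then 1 else ii.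
pose p i a := p0 i a + ss i * w a.
pose x := mk_pt r0 p (fun e => ae e).
have i2 := iC2 R.
have ks (j : 'I_n) : \sum_i ((i == ord_0 k)%:R - (i == j)%:R) = 0 :> C.
  have single (l : 'I_n) : \sum_i (i == l)%:R = 1 :> C.
    by rewrite (bigD1 l) //= eqxx big1 ?addr0 // => i /negPf ->.
  by rewrite sumrB !single subrr.
have m0 i := cmi_neq0 m_gt0 i.
exists x; split; last first.
  rewrite eval_pdet; suff -> : pdet m (fun i a => x (vr i a)) (fun i a => x (vp i a)) = pdet m r0 p0 by [].
  rewrite /pdet.
  have e1 (ka : 'I_n -> C) : \sum_i ka i / cm (m i) * (x (vp i 0) + ii * x (vp i 1)) = M1 ka.
    apply: eq_bigr => i _; rewrite /x !mk_vp /p /w /=; congr (_ * _).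
    transitivity (p0 i 0 + ii * p0 i 1 + ss i * (1 + ii * ii)); first by ring.
    by rewrite i2 subrr !mulr0 !addr0.
  have e2 (ka : 'I_n -> C) : \sum_i ka i * (ii * x (vr i 0) - x (vr i 1)) = M2 ka.
    by apply: eq_bigr => i _; rewrite /x !mk_vr.
  by rewrite !e1 !e2.
apply/(inMhcP (n := n) isT m_gt0); split; first by move=> e; rewrite /x mk_vd.
split.
- by move=> e; rewrite /x mk_vd sum2 /relv !mk_vr /r0 /= subrr expr0n addr0 rl_chi.
- move=> a; under eq_bigr do rewrite /x mk_vr /r0.
  by case: (a == 0); rewrite ?comal // big1 // => i _; rewrite mulr0.
- move=> a; under eq_bigr do rewrite /x mk_vp /p.
  rewrite big_split -mulr_suml big_split /= -!mulr_sumr !ks !mulr0 addr0 mul0r addr0 /p0.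
  by case: (a == 0); rewrite ?combe ?big1.
- under [X in _ - X]eq_bigr do rewrite /x mk_vd.
  suff -> : \sum_i (cm (2 * m i))^-1 * (\sum_a x (vp i a) ^+ 2) = t by rewrite /t addrK.
  transitivity (2^-1 * (\sum_i cm (m i) * be i ^+ 2) + (M1 kap1 * s1 + M1 kap2 * s2)); last by rewrite kin0 mulr0 add0r.
  rewrite mulr_sumr /M1 !mulr_suml -!big_split; apply: eq_bigr => i _ /=.
  rewrite cm2M sum2 /x !mk_vp /p /w /p0 /= !mulr1 mulr0 addr0 add0r.
  have two0 : (2 : C) != 0 by rewrite pnatr_eq0.
  set b := be i; set mi := cm (m i).
  have e1 : 2^-1 * (mi * b ^+ 2) = (2 * mi)^-1 * (mi * b * (mi * b)).
    by move: (2) two0 (m0 i) => tt tt0 mi0; field; rewrite mi0 tt0.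
  have e3 : mi^-1 = 2 * (2 * mi)^-1.
    by move: (2) two0 (m0 i) => tt tt0 mi0; field; rewrite mi0 tt0.
  rewrite e1 e3 /ss; move: ((2 * mi)^-1) => u.
  transitivity (u * (mi * b * (mi * b)) + 2 * u * (mi * b) * (s1 * kap1 i + s2 * kap2 i) + u * (s1 * kap1 i + s2 * kap2 i) ^+ 2 * (1 + ii * ii)); first by ring.
  rewrite i2 subrr; ring.
- transitivity (M2 kap1 * s1 + M2 kap2 * s2); last exact: eq2.
  rewrite /M2 !mulr_suml -!big_split; apply: eq_bigr => i _ /=.
  rewrite /x !mk_vr !mk_vp /p /w /p0 /r0 /= /ss; ring.
Qed.
End LevelPoint.

(** For distinct velocities this is nonzero exactly when the pairs 01 and 02 meet at different
    times. *)
Lemma pdet_lead (R : realType) k (m : 'I_k.+3 -> R) (al be : 'I_k.+3 -> R[i]) : (forall i, 0 < m i) ->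
  pdet m (fun i a => if a == 0 then al i else 0) (fun i a => if a == 0 then cm (m i) * be i else 0) =
  iC R * ((be (ord_0 k) - be (ord_1 k)) * (al (ord_0 k) - al (ord_2 k)) - (be (ord_0 k) - be (ord_2 k)) * (al (ord_0 k) - al (ord_1 k))).
Proof.
move=> m_gt0; rewrite /pdet /=.
have h1 (e : pairs k.+3) : \sum_i chiC R e i / cm (m i) * (cm (m i) * be i + iC R * 0) = be (pi1 e) - be (pi2 e).
  rewrite -(chi_sum be); apply: eq_bigr => i _; rewrite mulr0 addr0 mulrA divfK //; exact: cmi_neq0.
have h2 (e : pairs k.+3) : \sum_i chiC R e i * (iC R * al i - 0) = iC R * (al (pi1 e) - al (pi2 e)).
  by rewrite -(chi_sum al) mulr_sumr; apply: eq_bigr => i _; rewrite subr0 mulrCA.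
have -> : \sum_i kap1 R i / cm (m i) * (cm (m i) * be i + iC R * 0) = be (ord_0 k) - be (ord_1 k) := h1 (pair01 k).
have -> : \sum_i kap2 R i / cm (m i) * (cm (m i) * be i + iC R * 0) = be (ord_0 k) - be (ord_2 k) := h1 (pair02 k).
have -> : \sum_i kap1 R i * (iC R * al i - 0) = iC R * (al (ord_0 k) - al (ord_1 k)) := h2 (pair01 k).
have -> : \sum_i kap2 R i * (iC R * al i - 0) = iC R * (al (ord_0 k) - al (ord_2 k)) := h2 (pair02 k).
ring.
Qed.

(** * Non-integrability *)

Section Nonintegrable.
Variables (R : realType) (k : nat) (m : 'I_k.+3 -> R).
Hypothesis m_gt0 : forall i, 0 < m i.
Local Notation C := R[i].
Local Notation n := k.+3.
Local Notation P := (pairs n).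
Local Notation chi := (chiC R (n := n)).
Local Notation cmi := (fun i => cm (m i)).
Local Notation cmm := (fun e : P => cm (m (pi1 e) * m (pi2 e))).

(** One factor of x^2 - y^2 vanishes, and x + y has constant term 2 a. This identifies the distances
    of the solution at t = 0 with those of the initial data. *)
Lemma sqrt_unique (a : C) (x y : sh unit C) : a != 0 -> x ^+ 2 = y ^+ 2 ->
  cst x = a -> cst y = a -> x = y.
Proof.
move=> a0 /eqP; rewrite -subr_eq0 subr_sqr => /eqP /taylor_nzd[h|h] cx cy.
  by apply/eqP; rewrite -subr_eq0 h.
have := congr1 (fun f : sh unit C => cst f) h; rewrite rmorphD /= => /eqP.
have -> : cst x + cst y = 2 * a by rewrite cx cy; ring.
by rewrite mulf_eq0 (negPf a0) pnatr_eq0.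
Qed.

Lemma not_integrable (h c : C) : ~ restricted_integrable m h c.
Proof.
case=> J [szJ _ [br [U [[US [Z hZ]] denseU hU]]]].
set Is := rsubc (Hrat m) h :: rsubc (Crat R n) c :: J in br hU.
have [be [be_inj combe kin0 tri_ne]] := velocities_exist m_gt0.
have [al [comal ae0 Ta Tb om]] := positions_exist m_gt0 be_inj tri_ne.
set Tf := fun e => - pair_diff chi id al e / pair_diff chi id be e in Ta Tb om.
have be0 := bee_neq0 be_inj.
have det0 : pdet m (fun i a => if a == 0 then al i else 0) (fun i a => if a == 0 then cm (m i) * be i else 0) != 0.
  rewrite pdet_lead // mulf_neq0 //.
    by apply/eqP => -[] /eqP; rewrite oner_eq0.
  have pab : pair02 k = pair01 k -> False by move/eqP; rewrite eq_sym pa_pb.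
  apply/negP => /eqP hh; apply: pab; apply: Ta; rewrite /Tf.
  have A0 := be0 (pair01 k); have B0 := be0 (pair02 k); move: hh A0 B0; rewrite !rl_chi -!/(pi1 _) -!/(pi2 _) /pi1 /pi2 /=.
  move: (be _ - be _) (be _ - be _) (al _ - al _) (al _ - al _) => A A' a b hh A0 B0.
  by rewrite !mulNr; congr (- _); apply/eqP; rewrite eqr_div // [_ * A]mulrC [_ * A']mulrC; apply/eqP; move/eqP: hh; rewrite subr_eq0 => /eqP.
have [x1 [x1S x1d]] := level_point m_gt0 ae0 comal combe kin0 det0 h c.
(* Density gives a point of U at which, moreover, the correction system of [initial_data] is
   solvable. *)
have [||x [[xS xd] xU]] := denseU (fun x => inMhc m h c x /\ (pdet_poly m).@[x] != 0).
- split=> [y []//|]; exists (fun g => g = pdet_poly m) => y yS; split=> [[_ yd]|[g [-> gy]]] //.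
  by exists (pdet_poly m).
- by exists x1.
have [g [Zg gx]] := (hZ x xS).1 xU.
have [Dg bg] := deg_bound_ex g.
rewrite eval_pdet in xd.
have [s [rh [ph [dl [io [[s2 comrh comph] [dl0 dl2 iod] en an g0]]]]]] :=
  initial_data m_gt0 ae0 comal combe kin0 xS xd det0 bg gx.
(* Pairs that meet at the same time share a letter; those of 01 and 02 belong to no other pair, by
   [Ta] and [Tb]. *)
pose ts := undup [seq Tf e | e <- enum {: P}].
have mem_ts e : Tf e \in ts by rewrite mem_undup; apply: map_f; rewrite mem_enum.
pose tm (i : 'I_(size ts)) : C := nth 0 ts i.
have lam_lt e : (index (Tf e) ts < size ts)%N by rewrite index_mem.
pose lam e : 'I_(size ts) := Ordinal (lam_lt e).
have tm_lam e : tm (lam e) = Tf e by rewrite /tm /= nth_index.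
have tm_inj : injective tm.
  by move=> i j /eqP; rewrite nth_uniq ?undup_uniq // => /eqP /val_inj.
have tm0 i : tm i != 0.
  have : tm i \in ts by apply: mem_nth.
  rewrite mem_undup => /mapP[e _ ->].
  by rewrite /Tf mulf_neq0 ?invr_eq0 ?oppr_eq0.
have S := hyperlog_build tm_inj tm0.
have tmE e : pair_diff chi id al e = - pair_diff chi id be e * tm (lam e).
  by rewrite tm_lam /Tf; have B0 := be0 e; field.
have [Pi [dh [ih [hPi hdh hih]]]] := solution_exists S chi cmi cmm al be s lam rh ph.
have ev_dl e : evB (del chi be s lam dh e) = dl e.
  have [z hz0] := dl0 e.
  apply: (sqrt_unique (a := s e * pair_diff chi id al e)).
  - rewrite mulf_neq0 //; apply/negP => /eqP se; have := s2 e; rewrite se mul0r => /esym/eqP.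
    by rewrite oner_eq0.
  - have ex (y : solser S) : evB (y ^+ 2) = evB y ^+ 2 := rmorphXn (@evB _ _ _ S) 2 y.
    have exD (y1 y2 : solser S) : evB (y1 ^+ 2 + y2 ^+ 2) = evB y1 ^+ 2 + evB y2 ^+ 2 by rewrite rmorphD -!ex.
    have exB (y1 y2 : solser S) : evB (y1 - y2) = evB y1 - evB y2 := rmorphB _ y1 y2.
    by rewrite dl2 -ex (del_sq s2 be0 tmE hdh) exD sum2 !rlB_chi !exB !ev_rho.
  - by rewrite (ev_del s tmE) expr2 -mulrA rmorphD (rmorphM _ gen) /= cst_gen mul0r addr0.
  - by rewrite hz0 rmorphD rmorphM /= cst_gen mul0r addr0.
have ev_io e : evB (iot chi be s lam ih e) = io e.
  have hh : evB (iot chi be s lam ih e) * dl e = 1.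
    by rewrite -(ev_dl e) -[RHS](rmorph1 (@evB _ _ _ S)) -(iot_del s2 be0 hdh hih e) rmorphM.
  by rewrite -[LHS]mul1r -(iod e) -mulrA [dl e * _]mulrC hh mulr1.
have m0 := cmi_neq0 m_gt0.
have ev_p i a : evB (pii cmi be ph Pi i a) = with_lead (fun i => cm (m i) * be i) ph i a := ev_pii hPi i a.
have ev_r i a : evB (rho cmi al be rh ph Pi i a) = with_lead al rh i a := ev_rho _ _ _ _ _ _ _ _.
have en0 : evB (energy chi cmi cmm be s lam ph Pi ih) = shC h * gen ^+ 2.
  rewrite -en /energy rmorphB; congr (_ - _).
    rewrite rmorph_sum; apply: eq_bigr => i _; rewrite (rmorphM _ (cB S _)) rmorph_sum /= evB_c; congr (_ * _).
    by apply: eq_bigr => a _; rewrite -ev_p; exact: (rmorphXn (@evB _ _ _ S) 2).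
  rewrite (rmorphM _ (eps ^+ 3)) -(@evB_gen _ _ _ S); congr (_ * _); first exact: (rmorphXn (@evB _ _ _ S) 3).
  by rewrite rmorph_sum; apply: eq_bigr => e _; rewrite rmorphM -ev_io /= evB_c.
have an0 : evB (angmom cmi al be rh ph Pi) = shC c * gen ^+ 2.
  rewrite -an /angmom rmorph_sum; apply: eq_bigr => i _.
  by rewrite rmorphB !rmorphM -!ev_p -!ev_r.
have ev_xiE : ev_xi m al be s lam rh ph Pi dh = mk_pt (with_lead al rh) (with_lead (fun i => cm (m i) * be i) ph) dl.
  apply: funext => kk; rewrite /ev_xi /xi -(enum_valK kk).
  by case: (enum_val kk) => [[[i a]|[i a]]|e]; [rewrite !mk_vr|rewrite !mk_vp|rewrite !mk_vd].
have om0 : omega_sum tm chi cmi cmm be s lam (lam (pair01 k)) (lam (pair02 k)) != 0.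
  have lamI a e : lam e = lam a -> Tf e = Tf a by rewrite -!tm_lam => ->.
  rewrite omega_sumE; last 2 first.
  - by move=> e /lamI /Ta.
  - by move=> e /lamI /Tb.
  rewrite /Omega.
  have gg0 e : gg chi cmm be s e != 0.
    rewrite /gg mulf_neq0 ?invr_eq0 ?expf_neq0 // mulf_neq0 //.
      by apply/negP => /eqP se; have := s2 e; rewrite se mul0r => /esym/eqP; rewrite oner_eq0.
    by apply: cm_neq0; rewrite mulf_neq0 // gt_eqF.
  apply: mulf_neq0; first exact: mulf_neq0.
  rewrite (_ : \sum_e _ = \sum_e omega_term m be s Tf e); first exact: om.
  by apply: eq_bigr => e _; rewrite !tm_lam.
apply: (no_first_integrals (isT : (2 < n)%N) m_gt0 tm_inj s2 be0 tmE hPi hdh hih comal combe comrh comph en0 an0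
  (Is := Is) (g := g) (Dg := Dg) _ _ br _ bg _ om0).
- by rewrite /Is /= szJ; lia.
- by [].
- by move=> y yS gy; apply: hU; apply/(hZ y yS); exists g.
- by rewrite ev_xiE.
Qed.
End Nonintegrable.

Theorem theorem1 (R : realType) (n : nat) (m : 'I_n -> R)
  (hn : (2 < n)%N) (hm : forall i, 0 < m i) (h c : R[i])
  (hc : (h, c) != (0, 0)) :
  ~ restricted_integrable m h c.
Proof.
by case: n m hn hm => [|[|[|k]]] // m _ hm; exact: not_integrable.
Qed.
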